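(* Let $p,q,r\in[0,1]$ with $p+q+r=1$ and $0<r<1$, let $s\in[0,1]$, and let $(S_n)$ be the elephant random walk with stops (ERWS) with parameters $p,q,r,s$, with number of ones $\Sigma_n=\sum_{k=1}^nX_k^2$. Assume the superdiffusive regime $\frac{p}{1-r}>\frac34$, let $L$ be the almost sure limit $L=\lim_{n\to\infty}S_n/n^{2p+r-1}$, and set $$\tau_r^2=\frac{1-r}{4p-3(1-r)}.$$ Then, as $n\to\infty$, one has the convergence in distribution $$\frac{S_n-n^{2p+r-1}L}{\sqrt{\Sigma_n}}\xrightarrow{\ \mathcal{L}\ }\mathcal{N}(0,\tau_r^2).$$ Moreover, $$\frac{S_n-n^{2p+r-1}L}{\sqrt{n^{1-r}}}\xrightarrow{\ \mathcal{L}\ }\sqrt{\Sigma'}\,\mathcal{N}(0,\tau_r^2),$$ where $\Sigma'$ is independent of the Gaussian $\mathcal{N}(0,\tau_r^2)$ random variable and $\Sigma'$ has a Mittag-Leffler distribution with parameter $1-r$.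
   Context: The elephant random walk with stops (ERWS) is defined as follows. The parameters are $p,q,r\in[0,1]$ with $p+q+r=1$, where $0<r<1$ is assumed throughout, and $s\in[0,1]$. The first step $X_1$ equals $+1$ with probability $s$ and $-1$ with probability $1-s$. For each $n\ge 1$, given $X_1,\dots,X_n$, an integer $k$ is chosen uniformly at random in $\{1,\dots,n\}$ and, independently of this choice and of the past, $X_{n+1}=X_k$ with probability $p$, $X_{n+1}=-X_k$ with probability $q$, and $X_{n+1}=0$ with probability $r$. The position of the ERWS is $S_0=0$ and $S_n=\sum_{k=1}^n X_k$ for $n\ge1$. The number of ones up to time $n$ is $\Sigma_n=\sum_{k=1}^n X_k^2$ (note $\Sigma_n\ge\Sigma_1=1$). In the superdiffusive regime $\frac{p}{1-r}>\frac34$, the sequence $S_n/n^{2p+r-1}$ converges almost surely to a random variable, denoted $L$. A random variable $X$ has a Mittag-Leffler distribution with parameter $\alpha\in(0,1]$ if $\mathbb{E}[\exp(tX)]=\sum_{n=0}^\infty \frac{t^n}{\Gamma(1+n\alpha)}$ for all $t\in\mathbb{R}$; equivalently $\mathbb{E}[X^m]=\frac{m!}{\Gamma(1+m\alpha)}$ for all integers $m\ge1$ (these moments characterize the distribution). $\xrightarrow{\mathcal{L}}$ denotes convergence in distribution and $\mathcal{N}(0,v)$ the centered Gaussian law with variance $v$. *)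

(* Defs.v *)
From HB Require Import structures.
From mathcomp Require Import all_boot all_order all_algebra.
From mathcomp Require Import all_classical all_reals all_analysis.

Set Implicit Arguments.
Unset Strict Implicit.
Unset Printing Implicit Defensive.

Import Order.TTheory GRing.Theory Num.Theory.
Import numFieldNormedType.Exports.

Local Open Scope classical_set_scope.
Local Open Scope ring_scope.

(* Only the steps X 1, X 2, ... are meaningful; X 0 is never used.
   At each time n >= 1 the hidden randomness is the remembered time K n and
   the mark e n, which is 1 (repeat), -1 (reverse) or 0 (stop).  Since
   [A], [B] and [C] may be taken to be [setT], the product rule says that the
   past (X 1, ..., X n), K n and e n are mutually independent. *)
Record is_ERWS (R : realType) (d : measure_display) (T : measurableType d)
    (P : probability T R) (p q r s : R) (X : nat -> {RV P >-> R})
    (K : nat -> {RV P >-> nat}) (e : nat -> {RV P >-> R}) : Prop := {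
  erws_first_up : P [set w | X 1%N w = 1] = s%:E ;
  erws_first_down : P [set w | X 1%N w = -1] = (1 - s)%:E ;
  erws_choice : forall n k : nat, (1 <= k <= n)%N ->
    P [set w | K n w = k] = (n%:R^-1)%:E ;
  erws_repeat : forall n : nat, (1 <= n)%N -> P [set w | e n w = 1] = p%:E ;
  erws_reverse : forall n : nat, (1 <= n)%N -> P [set w | e n w = -1] = q%:E ;
  erws_stop : forall n : nat, (1 <= n)%N -> P [set w | e n w = 0] = r%:E ;
  erws_indep : forall n : nat, (1 <= n)%N ->
    forall (A : nat -> set R) (B : set nat) (C : set R),
    (forall i, measurable (A i)) -> measurable B -> measurable C ->
    let past := [set w | forall i, (1 <= i <= n)%N -> A i (X i w)] in
    (P (past `&` (K n @^-1` B) `&` (e n @^-1` C)) =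
     P past * P (K n @^-1` B) * P (e n @^-1` C))%E ;
  erws_step : forall n : nat, (1 <= n)%N ->
    {ae P, forall w, X n.+1 w = e n w * X (K n w) w}
}.

Definition position (R : realType) (T : Type) (X : nat -> T -> R) (n : nat)
  (w : T) : R := \sum_(1 <= k < n.+1) X k w.

Definition ones (R : realType) (T : Type) (X : nat -> T -> R) (n : nat)
  (w : T) : R := \sum_(1 <= k < n.+1) X k w ^+ 2.

Definition cvg_in_law (R : realType) (d : measure_display)
    (T : measurableType d) (P : probability T R) (Y : nat -> T -> R)
    (mu : set (measurableTypeR R) -> \bar R) : Prop :=
  forall f : R -> R, continuous f -> (exists M, forall x, `|f x| <= M) ->
    ('E_P[f \o Y n])%E @[n --> \oo] --> (\int[mu]_x (f x)%:E)%E.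

Definition independent_RV (R : realType) (d : measure_display)
    (T : measurableType d) (P : probability T R) (X Y : {RV P >-> R}) : Prop :=
  forall A B : set R, measurable A -> measurable B ->
    P ((X @^-1` A) `&` (Y @^-1` B)) = (P (X @^-1` A) * P (Y @^-1` B))%E.

(* Euler's integral, used at x > 0 *)
Definition Gamma (R : realType) (x : R) : R :=
  \int[@lebesgue_measure R]_(t in `]0, +oo[) (t `^ (x - 1) * expR (- t)).

Definition mittag_leffler (R : realType) (d : measure_display)
    (T : measurableType d) (P : probability T R) (alpha : R)
    (X : {RV P >-> R}) : Prop :=
  forall t : R,
    (\sum_(0 <= n < N) t ^+ n / Gamma (1 + n%:R * alpha))%:E @[N --> \oo]
      --> ('M_P X t)%E.

(* Main.v *)
Require Import Defs.
From HB Require Import structures.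
From mathcomp Require Import all_boot all_order all_algebra.
From mathcomp Require Import all_classical all_reals all_analysis.
From mathcomp Require Import measurable_realfun.
From mathcomp Require Import ring lra.

Set Implicit Arguments.
Unset Strict Implicit.
Unset Printing Implicit Defensive.

Import Order.TTheory GRing.Theory Num.Theory.
Import numFieldNormedType.Exports.

Local Open Scope classical_set_scope.
Local Open Scope ring_scope.

(** Write [a = p - q = 2p + r - 1], [b = p + q = 1 - r] and [d = 2a - b].  The
superdiffusive regime is [d > 0], and then [tau_r^2 = b / d].  Let [S_n] be the
position and [Q_n] the number of ones.

Given the first [n] steps, the mean of [S_{n+1}] is [(1 + a/n) S_n], so that
[S_n / n^a] is nearly a martingale; the conditional variance of its increment at
time [k] is about [b Q_k / k^{1 + 2a}].  Since [Q_k / k^b] converges in mean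
square, it may be frozen at its value at time [n], and the variance left after time
[n] is then about [(Q_n / n^b) \sum_{k >= n} b k^{-1-d}], that is
[(b / d) n^{-d} Q_n / n^b].  The remainder [S_n / n^a - L] is, conditionally on the
first [n] steps, asymptotically Gaussian with this variance.  Multiplied by
[n^{d/2} = n^{a - b/2}] it has conditional variance [(b / d) Q_n / n^b], which gives
the mixture of Gaussian laws; multiplied by [n^a / sqrt Q_n] it has variance [b / d].

The Gaussian approximation is Lindeberg's replacement argument on the heat kernel
(lemma [lindeberg]).  While the walk is run from [n] to [N], the remaining variance
is run down by a deterministic clock; the heat equation cancels the leading terms of
each step ([heat_walk_step]) and the errors are summable.  The position
enters the errors only through [|S_n| <= Q_n].  These means are finite sums
over words of steps ([Ex]), identified with expectations in [mean_path].  Integrating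
the kernel against a compactly supported test function [f] replaces it by a Gaussian
smoothing of [f] ([gauss_mean]), which is close to [f] when the scale is small.
Letting [N] tend to infinity at fixed [n], by dominated convergence, brings in [L]
([limit_lindeberg], [mean_test_gauss]); compactly supported test functions suffice
because the limit is a probability ([cvg_in_law_of_test]).

The law of the limit of [Q_n / n^b] comes from its moments: rising factorials are
eigenfunctions of the process [Q_n] ([Ex_rising]), so their means are products, and
Euler's formula for Gamma ([cvg_prod_Gamma]) yields the moments
[m! / Gamma (1 + m b)] of the Mittag-Leffler law.  They determine the moment
generating function of the limit ([mgf_of_moments]).

For the random normalisation, [Q_n / n^b] must not be small: the mean of
[1 / sqrt Q_n] is [O(n^{-b/2})] ([Ex_inv_sqrt]), so the walks with
[Q_n < dl * n^b] have probability [O(sqrt dl)] and can be discarded. *)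

(** * Power inequalities *)

Section power_inequalities.
Context {R : realType}.
Implicit Types a d x u : R.

Lemma powR_pD u a d : 0 < u -> u `^ (a + d) = u `^ a * u `^ d.
Proof. by move=> u0; rewrite powRD// (gt_eqF u0) implybT. Qed.

(** The weighted inequality between arithmetic and geometric means of [1] and [u]. *)
Lemma powR_tangent a u : 0 <= a <= 1 -> 0 <= u -> u `^ a <= 1 - a + a * u.
Proof.
move=> /andP[a0 a1]; rewrite le_eqVlt => /predU1P[<-|u0].
  have [->|an0] := eqVneq a 0; first by rewrite powRr0; lra.
  by rewrite powR0//; lra.
rewrite /powR gt_eqF//; set l := ln u.
have -> : u = expR (a * l) * expR ((1 - a) * l).
  by rewrite -expRD -mulrDl (_ : a + (1 - a) = 1); [rewrite mul1r lnK|ring].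
have E1 : expR (a * l) * expR (- (a * l)) = 1 by rewrite expRxMexpNx_1.
have h1 := expR_ge1Dx ((1 - a) * l).
have h2 := expR_ge1Dx (- (a * l)).
have p0 := expR_gt0 (a * l).
set p := expR (a * l) in p0 E1 *; set v := expR _ in h1 *.
set w := expR _ in h2 E1 *.
rewrite -[X in X - a]E1 -[X in _ - X]mulr1 -E1.
have H1 : p * (1 + (1 - a) * l) <= p * v by rewrite ler_pM2l.
have H2 : p * (1 - a * l) <= p * w by rewrite ler_pM2l.
rewrite E1 mulr1 in H2 *.
have K1 := ler_wpM2l a0 H1.
have a1' : 0 <= 1 - a by rewrite subr_ge0.
have K2 := ler_wpM2l a1' H2.
have -> : p = a * (p * (1 + (1 - a) * l)) + (1 - a) * (p * (1 - a * l)) by ring.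
lra.
Qed.

Lemma powR_bernoulli_le a x : 0 <= a <= 1 -> 0 <= x ->
  (1 + x) `^ a <= 1 + a * x.
Proof.
move=> a01 x0; have x1 : 0 <= 1 + x by lra.
apply: le_trans (powR_tangent a01 x1) _.
lra.
Qed.

(** Lower companion of Bernoulli's inequality, with a relative error of second order;
it follows from Bernoulli's inequality for the exponent [1 - a], because
[(1 + x) `^ a * (1 + x) `^ (1 - a) = 1 + x]. *)
Lemma powR_bernoulli_second a x : 0 <= a <= 1 -> 0 <= x ->
  1 + a * x <= (1 + x ^+ 2) * (1 + x) `^ a.
Proof.
move=> a01 x0; have a01' : 0 <= 1 - a <= 1 by lra.
have h := powR_bernoulli_le a01' x0.
have x1 : 0 < 1 + x by lra.
have E : (1 + x) `^ a * (1 + x) `^ (1 - a) = 1 + x.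
  rewrite -powR_pD//.
  by rewrite (_ : a + (1 - a) = 1) ?powRr1 ?ltW//; ring.
have p0 := powR_gt0 a x1; set p := _ `^ a in p0 E *.
rewrite -(ler_pM2r x1) -[leLHS]mulrC -{1}E.
set v := _ `^ (1 - a) in h E *.
have a0 : 0 <= a by lra.
apply: (@le_trans _ _ (p * (1 + (1 - a) * x) * (1 + a * x))).
  by apply: ler_wpM2r; [nra|apply: ler_wpM2l; [exact: ltW|exact: h]].
rewrite -subr_ge0.
rewrite (_ : _ - _ = p * (x ^+ 2 * (1 - a * (1 - a) + x))); last by ring.
apply: mulr_ge0; first exact: ltW.
by apply: mulr_ge0; [exact: sqr_ge0|nra].
Qed.

Lemma powRN_bernoulli d x : 0 <= d -> 0 <= x -> 1 - d * x <= (1 + x) `^ (- d).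
Proof.
move=> d0 x0; rewrite /powR gt_eqF ?ltr_pwDl//.
apply: le_trans (expR_ge1Dx _); rewrite mulNr lerD2l lerN2.
by rewrite ler_wpM2l// le_ln1Dx// (lt_le_trans _ x0).
Qed.

Lemma powRN_bernoulli_ge d x : 0 <= d -> 0 <= x ->
  d * x / ((1 + x) * (1 + d * x)) <= 1 - (1 + x) `^ (- d).
Proof.
move=> d0 x0; have x1 : 0 < 1 + x by lra.
have dx0 : 0 <= d * x by rewrite mulr_ge0.
have lnlb : x / (1 + x) <= ln (1 + x).
  have := @le_ln1Dx R ((1 + x)^-1 - 1).
  rewrite addrCA subrr addr0 lnV// => /(_ _).
  rewrite ltrBrDl subrr invr_gt0 => /(_ x1).
  rewrite lerNl; apply: le_trans; rewrite le_eqVlt; apply/orP; left; apply/eqP.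
  by field; rewrite gt_eqF.
have h : (1 + x) `^ (- d) <= (1 + d * (x / (1 + x)))^-1.
  rewrite powRN lef_pV2 ?posrE ?powR_gt0//; last first.
    by rewrite ltr_pwDl// mulr_ge0// divr_ge0// ltW.
  rewrite /powR gt_eqF//; apply: le_trans (expR_ge1Dx _).
  by rewrite lerD2l ler_wpM2l.
apply: (@le_trans _ _ (1 - (1 + d * (x / (1 + x)))^-1)); last by rewrite lerD2l lerN2.
have y0 : 0 < 1 + x + d * x by lra.
have -> : 1 - (1 + d * (x / (1 + x)))^-1 = d * x / (1 + x + d * x).
  by field; rewrite !gt_eqF//=; lra.
rewrite ler_wpM2l// lef_pV2 ?posrE ?mulr_gt0//; last by lra.
by nra.
Qed.

End power_inequalities.

Section power_sums.
Context {R : realType}.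
Implicit Types (a b d : R) (k n N : nat).

Lemma powR_natS k (e : R) : (0 < k)%N ->
  k.+1%:R `^ e = k%:R `^ e * (1 + k%:R^-1) `^ e :> R.
Proof.
move=> k0; have kp : 0 < k%:R :> R by rewrite ltr0n.
rewrite -powRM ?ltW// ?addr_gt0 ?invr_gt0// mulrDr mulr1 divff ?gt_eqF//.
by rewrite natr1.
Qed.

Lemma powR_nat_diff_ge d : 0 < d -> exists2 c : R, 0 < c & forall k, (0 < k)%N ->
  c * k%:R `^ (- 1 - d) <= k%:R `^ (- d) - k.+1%:R `^ (- d).
Proof.
move=> d0; exists (d / (2 * (1 + d))); first by rewrite divr_gt0//; lra.
move=> k k0; have kp : 0 < k%:R :> R by rewrite ltr0n.
rewrite powR_natS// -[X in _ <= X - _]mulr1 -mulrBr.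
have x0 : 0 < k%:R^-1 :> R by rewrite invr_gt0.
have x1 : k%:R^-1 <= 1 :> R by rewrite invf_le1// ler1n.
have h := powRN_bernoulli_ge (ltW d0) (ltW x0).
apply: le_trans (ler_wpM2l (powR_ge0 k%:R (- d)) h).
rewrite powR_pD//.
rewrite (powR_inv1 (ltW kp)); set x := k%:R^-1 in x0 x1 *.
set P := _ `^ _; rewrite [X in X <= _](_ : _ = P * (d * x / (2 * (1 + d)))).
  2: by field; lra.
apply: ler_wpM2l; first exact: powR_ge0.
apply: ler_wpM2l; first by rewrite mulr_ge0// ltW.
have dx0 : 0 <= d * x by rewrite mulr_ge0// ltW.
have dx1 : d * x <= d by rewrite -[leRHS]mulr1 ler_pM2l.
rewrite lef_pV2 ?posrE ?mulr_gt0//; [|lra|lra|lra].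
by apply: ler_pM; lra.
Qed.

Lemma powR_nat_diff_le d k : 0 <= d -> (0 < k)%N ->
  0 <= k%:R `^ (- d) - k.+1%:R `^ (- d) <= d * (k%:R : R) `^ (- 1 - d).
Proof.
move=> d0 k0; have kp : 0 < k%:R :> R by rewrite ltr0n.
have x0 : 0 <= k%:R^-1 :> R by rewrite invr_ge0 ltW.
apply/andP; split.
  rewrite subr_ge0 !powRN lef_pV2 ?posrE ?powR_gt0 ?ltr0n//.
  by rewrite ge0_ler_powR ?nnegrE// ler_nat.
rewrite powR_natS// -[X in X - _]mulr1 -mulrBr.
rewrite [X in d * X]powR_pD//.
rewrite (powR_inv1 (ltW kp)) mulrA (mulrC (d / _)).
apply: ler_wpM2l; first exact: powR_ge0.
by have := powRN_bernoulli d0 x0; lra.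
Qed.

(** Comparison with the telescoping increments of [k `^ (- d)]. *)
Lemma powR_tail_sum d : 0 < d -> exists2 C : R, 0 <= C & forall n N, (0 < n)%N ->
  \sum_(n <= k < N) k%:R `^ (- 1 - d) <= C * n%:R `^ (- d).
Proof.
move=> d0; have [c c0 h] := powR_nat_diff_ge d0.
exists c^-1; first by rewrite invr_ge0 ltW.
move=> n N n0; have [nN|Nn] := leqP n N; last first.
  by rewrite big_geq 1?ltnW// mulr_ge0 ?powR_ge0// invr_ge0 ltW.
rewrite ler_pdivlMl// mulr_sumr.
apply: (@le_trans _ _ (\sum_(n <= k < N) (k%:R `^ (- d) - k.+1%:R `^ (- d)))).
  by rewrite !big_nat; apply: ler_sum => k /andP[nk _]; apply: h; apply: leq_trans nk.
under eq_bigr do rewrite -opprB.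
by rewrite sumrN telescope_sumr// opprB gerBl powR_ge0.
Qed.

(** The increments of [k `^ (- d)], times [b / d], match those of the
conditional variance up to a relative error [O(1/k)]. *)
Lemma variance_increment a b d k : 0 <= a -> 0 <= b -> 0 < d -> (0 < k)%N ->
  `|b * (1 + k%:R^-1) `^ (- (2 * a))
    - b / d * (k%:R * (1 - (1 + k%:R^-1) `^ (- d)))|
    <= b * (2 * a + 1 + d) / k%:R.
Proof.
move=> a0 b0 d0 k0; have kp : 0 < k%:R :> R by rewrite ltr0n.
have x0 : 0 < k%:R^-1 :> R by rewrite invr_gt0.
have -> : k%:R = k%:R^-1^-1 :> R by rewrite invrK.
rewrite invrK; set x := k%:R^-1 in x0 *.
have a20 : 0 <= 2 * a by rewrite mulr_ge0.
have h1 := powRN_bernoulli a20 (ltW x0).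
have h2 : (1 + x) `^ (- (2 * a)) <= 1.
  rewrite powRN invf_le1 ?powR_gt0 ?addr_gt0//.
  by rewrite -[leLHS](powRr0 (1 + x)) ler_powR// lerDl ltW.
have h3 := powRN_bernoulli (ltW d0) (ltW x0).
have h4 := powRN_bernoulli_ge (ltW d0) (ltW x0).
set A := _ `^ _ in h1 h2 *; set B := _ `^ _ in h3 h4 *.
set D := x^-1 * (1 - B) / d.
rewrite (_ : b * A - _ = b * (A - D)); last by rewrite /D; field; rewrite !gt_eqF.
rewrite normrM ger0_norm// -mulrA ler_wpM2l//.
have D1 : D <= 1.
  by rewrite /D ler_pdivrMr// mul1r ler_pdivrMl// mulrC; lra.
have D2 : 1 - (1 + d) * x <= D.
  apply: (@le_trans _ _ (((1 + x) * (1 + d * x))^-1)).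
    rewrite -[leRHS]mul1r ler_pdivlMr; last by rewrite mulr_gt0//; nra.
    rewrite -subr_ge0 [X in 0 <= X](_ : _ =
      x ^+ 2 * ((1 + d) ^+ 2 - d + (1 + d) * d * x)); last by ring.
    by rewrite mulr_ge0 ?sqr_ge0//; nra.
  rewrite /D ler_pdivlMr// ler_pdivlMl// mulrC; apply: le_trans h4.
  by rewrite le_eqVlt mulrAC (mulrC _ d) -mulrA (mulrC _ x) !mulrA eqxx.
by rewrite ler_norml; apply/andP; split; nra.
Qed.

End power_sums.

(** * The Gamma function *)

Lemma integrable_EFinZ d (T : measurableType d) (R : realType)
    (mu : {measure set T -> \bar R}) (D : set T) (f : T -> R) (k : R) :
  measurable D -> mu.-integrable D (fun x => (f x)%:E) ->
  mu.-integrable D (fun x => (k * f x)%:E).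
Proof. by move=> mD; exact: (@integrableZl _ _ _ mu D mD k (fun x => (f x)%:E)). Qed.

Lemma integrable_EFinD d (T : measurableType d) (R : realType)
    (mu : {measure set T -> \bar R}) (D : set T) (f g : T -> R) :
  measurable D -> mu.-integrable D (fun x => (f x)%:E) ->
  mu.-integrable D (fun x => (g x)%:E) ->
  mu.-integrable D (fun x => (f x + g x)%:E).
Proof. by move=> mD i1 i2; exact: (integrableD mD i1 i2). Qed.

Lemma integrable_EFinB d (T : measurableType d) (R : realType)
    (mu : {measure set T -> \bar R}) (D : set T) (f g : T -> R) :
  measurable D -> mu.-integrable D (fun x => (f x)%:E) ->
  mu.-integrable D (fun x => (g x)%:E) ->
  mu.-integrable D (fun x => (f x - g x)%:E).
Proof. by move=> mD i1 i2; exact: (integrableB mD i1 i2). Qed.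

Section gamma.
Context {R : realType}.
Notation mu := (@lebesgue_measure R).
Implicit Types e x y t c : R.

Lemma powR_le_expR e : 0 <= e ->
  exists2 C : R, 0 <= C & forall t, 0 <= t -> t `^ e <= C * expR (t / 2).
Proof.
rewrite le_eqVlt => /predU1P[<-|e0].
  exists 1 => // t t0; rewrite powRr0 mul1r -[leLHS](expR0 R) ler_expR.
  by rewrite divr_ge0.
exists (expR (e * ln (2 * e))); first exact: expR_ge0.
move=> t; rewrite le_eqVlt => /predU1P[<-|t0].
  by rewrite powR0 ?gt_eqF// mulr_ge0 ?expR_ge0.
rewrite /powR gt_eqF// -expRD ler_expR.
have e20 : 0 < 2 * e by rewrite mulr_gt0.
have := ln_sublinear (divr_gt0 t0 e20).
rewrite ln_div ?posrE// => /ltW h.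
have := ler_wpM2l (ltW e0) h.
rewrite (_ : e * (t / _) = t / 2); first by lra.
by field; rewrite gt_eqF.
Qed.

Lemma cvg_expRN_half (K : R) : K * expR (- (t / 2)) @[t --> +oo] --> (0 : R).
Proof.
rewrite -[X in _ --> X](mulr0 K); apply: cvgM; first exact: cvg_cst.
apply: (@cvg_comp _ _ _ (fun t : R => t / 2) (fun t : R => expR (- t)) _ (pinfty_nbhs R)).
  exact: gt0_cvgMly.
exact: cvgr_expR.
Qed.

Lemma cvg_powR_right0 e : 0 <= e -> t `^ e @[t --> (0:R)^'+] --> (0:R) `^ e.
Proof.
rewrite le_eqVlt => /predU1P[<-|e0].
  under eq_cvg do rewrite powRr0.
  by rewrite powRr0; exact: cvg_cst.
by rewrite powR0 ?gt_eqF//; exact: powR_cvg0.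
Qed.

Lemma is_derive_powR e t : 0 < t ->
  is_derive t 1 (fun t : R => t `^ e) (e * t `^ (e - 1)).
Proof.
move=> t0; have ti : t \in `]0, +oo[ by rewrite in_itv/= t0.
rewrite -(powR_derive1 e ti) derive1E; apply/derivableP.
exact: derivable_powR.
Qed.

Lemma continuous_powR_gt0 e t : 0 < t -> {for t, continuous (fun t : R => t `^ e)}.
Proof.
move=> t0; apply: differentiable_continuous; apply/derivable1_diffP.
by have [] := is_derive_powR e t0.
Qed.

Lemma continuous_expRZ c : continuous (fun t : R => expR (c * t)).
Proof.
move=> t; apply: continuous_comp; last exact: continuous_expR.
by apply: cvgM; [exact: cvg_cst|exact: cvg_id].
Qed.

Lemma is_derive_expRZ c t :
  is_derive t 1 (fun t : R => expR (c * t)) (expR (c * t) * c).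
Proof.
have -> : (fun t : R => expR (c * t)) = expR \o (fun t => c * t) by [].
apply: is_derive1_comp.
rewrite -[X in is_derive _ _ _ X]mulr1.
exact: is_deriveZ.
Qed.

Lemma integral_exp_tail c : 0 <= c ->
  (\int[mu]_(t in `[c, +oo[) (expR (- t))%:E)%E = (expR (- c))%:E.
Proof.
move=> c0; have E t : expR (- t) = expR (-1 * t) by rewrite mulN1r.
under eq_integral do rewrite E.
rewrite (@ge0_continuous_FTC2y _ _ (fun t => - expR (-1 * t)) c 0).
- by rewrite mulN1r sub0e EFinN oppeK.
- by move=> x _; exact: expR_ge0.
- apply: continuous_subspaceT; exact: continuous_expRZ.
- rewrite -oppr0; apply: cvgN; under eq_cvg do rewrite mulN1r.
  exact: cvgr_expR.
- move=> x _; have := is_derive_expRZ (-1) x; move=> [h _].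
  exact: derivableN.
- by apply/cvg_at_right_filter; apply: cvgN; exact: continuous_expRZ.
- move=> x _; rewrite derive1E; have h := is_derive_expRZ (-1) x.
  have h2 : is_derive x 1 (- (fun t : R => expR (-1 * t))) (- (expR (-1 * x) * -1)).
    exact: is_deriveN.
  by case: h2 => _; rewrite mulrN1 opprK.
Qed.

Lemma integral_exp_half (K : R) : 0 <= K ->
  (\int[mu]_(t in `[0%R, +oo[) (K / 2 * expR (- (t / 2)))%:E)%E = K%:E.
Proof.
move=> K0; have E t : expR (- (t / 2)) = expR (- 2^-1 * t) by rewrite mulNr mulrC.
under eq_integral do rewrite E.
have D x := @is_derive_expRZ (- 2^-1) x.
have D2 (x : R) : is_derive x 1 (fun t : R => - K * expR (- 2^-1 * t))
    (K / 2 * expR (- 2^-1 * x)).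
  rewrite [X in is_derive _ _ _ X](_ : _ = - K * (expR (- 2^-1 * x) * - 2^-1)).
    exact: is_deriveZ.
  by ring.
rewrite (@ge0_continuous_FTC2y _ _ (fun t => - K * expR (- 2^-1 * t)) 0 0).
- by rewrite mulr0 expR0 mulr1 sub0e EFinN oppeK.
- by move=> x _; rewrite !mulr_ge0 ?expR_ge0.
- apply: continuous_subspaceT => t; apply: cvgM; first exact: cvg_cst.
  exact: continuous_expRZ.
- under eq_cvg do rewrite -E; exact: cvg_expRN_half.
- by move=> x _; have [] := D2 x.
- apply/cvg_at_right_filter; apply: cvgM; first exact: cvg_cst.
  exact: continuous_expRZ.
- by move=> x _; rewrite derive1E; have [] := D2 x.
Qed.

Lemma measurable_powR_expR e (D : set R) :
  measurable_fun D (fun t : R => t `^ e * expR (- t)).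
Proof.
apply: measurable_funM; first by apply: measurable_funTS; exact: measurable_powR.
apply: measurable_funTS.
by apply: measurableT_comp => //; exact: measurableT_comp.
Qed.

Lemma integrable_powR_expR e : 0 <= e ->
  mu.-integrable `[0%R, +oo[ (fun t => (t `^ e * expR (- t))%:E).
Proof.
move=> e0; have [C C0 h] := powR_le_expR e0.
have K0 : 0 <= C * 2 by rewrite mulr_ge0.
apply: (@le_integrable _ _ _ mu _ _ _ (fun t => (C * 2 / 2 * expR (- (t / 2)))%:E)) => //.
- apply/measurable_EFinP; exact: measurable_powR_expR.
- move=> t /=; rewrite in_itv/= andbT => t0.
  rewrite lee_fin !ger0_norm ?mulr_ge0 ?powR_ge0 ?expR_ge0 ?invr_ge0//.
  rewrite mulfK// (_ : - (t / 2) = t / 2 - t); last by lra.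
  by rewrite expRD mulrA ler_wpM2r ?expR_ge0// h.
apply/integrableP; split.
  apply/measurable_EFinP; apply: measurable_funM => //.
  apply: measurableT_comp => //; apply: measurableT_comp => //.
  exact: measurable_funM.
under eq_integral do rewrite gee0_abs ?lee_fin ?mulr_ge0 ?expR_ge0 ?invr_ge0//.
by rewrite integral_exp_half// ltry.
Qed.

Lemma GammaE y : 0 <= y -> Gamma (y + 1) = \int[mu]_(t in `[0, +oo[) (t `^ y * expR (- t)).
Proof.
move=> y0; rewrite /Gamma -Rintegral_itv_obnd_cbnd.
  by apply: eq_Rintegral => t _; rewrite addrK.
apply: integrableS (integrable_powR_expR y0) => //.
by apply: subset_itvr; rewrite bnd_simp.
Qed.

Lemma Gamma1 : Gamma (1 : R) = 1.
Proof.
rewrite -[X in Gamma X]add0r GammaE//.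
under eq_Rintegral do rewrite powRr0 mul1r.
by rewrite /Rintegral integral_exp_tail// oppr0 expR0.
Qed.

(** Integration by parts.  The derivative of [- t `^ y * expR (- t)] changes
sign; adding a multiple of [expR (- t / 2)] makes it nonnegative, so that the
fundamental theorem of calculus for nonnegative integrands applies. *)
Lemma GammaS y : 1 <= y -> Gamma (y + 1) = y * Gamma y.
Proof.
move=> y1; have y0 : 0 <= y by apply: le_trans y1.
have ym1 : 0 <= y - 1 by rewrite subr_ge0.
have [C C0 hC] := powR_le_expR ym1.
have [C' C'0 hC'] := powR_le_expR y0.
pose K := 2 * (y * C); have K0 : 0 <= K by rewrite !mulr_ge0.
pose f t := t `^ y * expR (- t) - y * (t `^ (y - 1) * expR (- t))
            + K / 2 * expR (- (t / 2)).
pose F t := - (t `^ y * expR (- t)) - K * expR (- (t / 2)).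
have f0 t : 0 <= t -> 0 <= f t.
  move=> t0; rewrite /f -addrA addr_ge0 ?mulr_ge0 ?powR_ge0 ?expR_ge0//.
  rewrite addrC subr_ge0 /K (mulrC 2) mulfK// -mulrA ler_wpM2l//.
  rewrite (_ : - (t / 2) = t / 2 - t); last by lra.
  by rewrite expRD mulrA ler_wpM2r ?expR_ge0// hC.
have En t : expR (- t) = expR (-1 * t) by rewrite mulN1r.
have Eh t : expR (- (t / 2)) = expR (- 2^-1 * t) by rewrite mulNr mulrC.
have cE1 t : {for t, continuous (fun t : R => expR (- t))}.
  by under [X in {for _, continuous X}]eq_fun do rewrite En; exact: continuous_expRZ.
have cE2 t : {for t, continuous (fun t : R => expR (- (t / 2)))}.
  by under [X in {for _, continuous X}]eq_fun do rewrite Eh; exact: continuous_expRZ.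
have iF t : 0 < t -> is_derive t 1 F (f t).
  move=> t0; have D1 := is_derive_powR y t0.
  have D2 : is_derive t 1 (fun t : R => expR (- t)) (- expR (- t)).
    under [X in is_derive _ _ X _]eq_fun do rewrite En.
    have -> : - expR (- t) = expR (-1 * t) * -1 by rewrite mulN1r mulrN1.
    exact: is_derive_expRZ.
  have D3 : is_derive t 1 (fun t : R => expR (- (t / 2))) (expR (- (t / 2)) * - 2^-1).
    under [X in is_derive _ _ X _]eq_fun do rewrite Eh.
    have -> : - (t / 2) = - 2^-1 * t by rewrite mulNr mulrC.
    exact: is_derive_expRZ.
  have D4 := is_deriveN (is_deriveM D1 D2).
  have D5 := is_deriveN (@is_deriveZ _ _ _ _ K _ _ _ D3).
  have D6 := is_deriveD D4 D5.
  have -> : f t = - (t `^ y *: - expR (- t) + expR (- t) *: (y * t `^ (y - 1))) +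
         - (K *: (expR (- (t / 2)) * - 2^-1)).
    by rewrite /f /GRing.scale/=; ring.
  exact: D6.
have FT : (\int[mu]_(t in `[0%R, +oo[) (f t)%:E)%E = K%:E.
  rewrite (@ge0_continuous_FTC2y _ _ F 0 0)//.
  - rewrite /F mul0r oppr0 expR0 powR0 ?gt_eqF ?(lt_le_trans _ y1)//.
    by rewrite mul0r oppr0 sub0r mulr1 -EFinN -EFinD opprK add0r.
  - apply/continuous_within_itvcyP; split.
      move=> t; rewrite in_itv/= andbT => t0.
      apply: cvgD; last by apply: cvgM; [exact: cvg_cst|exact: cE2].
      apply: cvgB; first by apply: cvgM; [exact: continuous_powR_gt0|exact: cE1].
      apply: cvgM; first exact: cvg_cst.
      by apply: cvgM; [exact: continuous_powR_gt0|exact: cE1].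
    apply: cvgD; last first.
      by apply: cvgM; [exact: cvg_cst|exact: cvg_at_right_filter (cE2 _)].
    apply: cvgB.
      by apply: cvgM; [exact: cvg_powR_right0|exact: cvg_at_right_filter (cE1 _)].
    apply: cvgM; first exact: cvg_cst.
    by apply: cvgM; [exact: cvg_powR_right0|exact: cvg_at_right_filter (cE1 _)].
  - rewrite -[X in _ --> X](subr0 0) -{1}oppr0; apply: cvgB; last exact: cvg_expRN_half.
    apply: cvgN.
    apply: (@squeeze_cvgr _ _ _ _ (cst 0) (fun t => C' * expR (- (t / 2)))).
    + near=> t; have t0 : 0 <= t by near: t; exact: nbhs_pinfty_ge.
      rewrite mulr_ge0 ?powR_ge0 ?expR_ge0//=.
      rewrite (_ : - (t / 2) = t / 2 - t); last by lra.
      by rewrite expRD mulrA ler_wpM2r ?expR_ge0// hC'.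
    + exact: cvg_cst.
    + exact: cvg_expRN_half.
  - by move=> t t0; have [] := iF t t0.
  - apply: cvgB; last by apply: cvgM; [exact: cvg_cst|exact: cvg_at_right_filter (cE2 _)].
    apply: cvgN.
    by apply: cvgM; [exact: cvg_powR_right0|exact: cvg_at_right_filter (cE1 _)].
  - by move=> t; rewrite in_itv/= andbT => t0; rewrite derive1E; have [] := iF t t0.
have iy := integrable_powR_expR y0.
have iy1 := integrable_powR_expR ym1.
have iyZ : mu.-integrable `[0%R, +oo[ (fun t => (y * (t `^ (y - 1) * expR (- t)))%:E).
  exact: integrable_EFinZ.
have iyB : mu.-integrable `[0%R, +oo[
    (fun t => (t `^ y * expR (- t) - y * (t `^ (y - 1) * expR (- t)))%:E).
  exact: integrable_EFinB.
have iK : mu.-integrable `[0%R, +oo[ (fun t => (K / 2 * expR (- (t / 2)))%:E).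
  apply/integrableP; split.
    apply/measurable_EFinP; apply: measurable_funM => //.
    apply: measurableT_comp => //; apply: measurableT_comp => //.
    exact: measurable_funM.
  under eq_integral do rewrite gee0_abs ?lee_fin ?mulr_ge0 ?expR_ge0 ?invr_ge0//.
  by rewrite integral_exp_half// ltry.
rewrite GammaE//; have -> : Gamma y = Gamma (y - 1 + 1) by rewrite subrK.
rewrite GammaE// -RintegralZl//.
apply/eqP; rewrite -subr_eq0 -RintegralB//.
apply/eqP; apply: (@addIr _ K); rewrite add0r.
have -> : K = \int[mu]_(t in `[0, +oo[) (K / 2 * expR (- (t / 2))).
  by rewrite /Rintegral integral_exp_half.
rewrite -RintegralD//.
by rewrite /Rintegral FT integral_exp_half.
Unshelve. all: by end_near. Qed.

(** [Gamma y] is at least the part of its integral beyond [c], where the power is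
replaced by its value at [c]. *)
Lemma Gamma_ge c y : 0 < c -> 1 <= y -> c `^ (y - 1) * expR (- c) <= Gamma y.
Proof.
move=> c0 y1; have ym1 : 0 <= y - 1 by rewrite subr_ge0.
have -> : Gamma y = Gamma (y - 1 + 1) by rewrite subrK.
rewrite GammaE//.
have sub : `[c, +oo[ `<=` `[0%R, +oo[.
  by apply: subset_itvr; rewrite bnd_simp ltW.
have i1 := integrable_powR_expR ym1.
rewrite -lee_fin /Rintegral fineK; last exact: integrable_fin_num.
rewrite EFinM -(integral_exp_tail (ltW c0)) -ge0_integralZl//; last 2 first.
- apply/measurable_EFinP; apply: measurable_funTS.
  by apply: measurableT_comp => //; exact: measurableT_comp.
- by rewrite lee_fin powR_ge0.
apply: (@le_trans _ _ (\int[mu]_(t in `[c, +oo[) (t `^ (y - 1) * expR (- t))%:E)%E); last first.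
  apply: ge0_subset_integral => //.
    apply/measurable_EFinP; exact: measurable_powR_expR.
  by move=> t _; rewrite lee_fin mulr_ge0 ?powR_ge0 ?expR_ge0.
apply: ge0_le_integral => //.
- by move=> t _; rewrite -EFinM lee_fin mulr_ge0 ?powR_ge0 ?expR_ge0.
- apply/measurable_EFinP; apply: measurable_funTS; apply: measurable_funM => //.
  by apply: measurableT_comp => //; exact: measurableT_comp.
- by apply/measurable_EFinP; exact: measurable_powR_expR.
- move=> t /=; rewrite in_itv/= andbT => ct.
  by rewrite -EFinM lee_fin ler_wpM2r ?expR_ge0// ge0_ler_powR// nnegrE ltW// (lt_le_trans c0).
Qed.

Lemma Gamma_gt0 y : 1 <= y -> 0 < Gamma y.
Proof.
move=> y1; apply: lt_le_trans (Gamma_ge ltr01 y1).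
by rewrite mulr_gt0 ?expR_gt0// powR_gt0.
Qed.

(** Log-convexity of Gamma on an interval of length at most one, obtained by
bounding [t `^ th] by its tangent at [y]. *)
Lemma Gamma_addr_le y (th : R) : 1 <= y -> 0 <= th <= 1 ->
  Gamma (y + th) <= y `^ th * Gamma y.
Proof.
move=> y1 th01; have [th0 th1] : 0 <= th /\ th <= 1 by apply/andP.
have y0 : 0 < y by apply: lt_le_trans y1.
have ym1 : 0 <= y - 1 by rewrite subr_ge0.
have e0 : 0 <= y - 1 + th by rewrite addr_ge0.
have i1 := integrable_powR_expR ym1.
have i2 := integrable_powR_expR (ltW y0).
have i3 := integrable_powR_expR e0.
pose A := (1 - th) * y `^ th; pose B := th * y `^ th / y.
have -> : y `^ th * Gamma y = A * Gamma y + B * Gamma (y + 1).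
  by rewrite GammaS// /A /B; field; rewrite gt_eqF.
have -> : Gamma y = Gamma (y - 1 + 1) by rewrite subrK.
have -> : Gamma (y + th) = Gamma (y - 1 + th + 1) by congr Gamma; ring.
rewrite (GammaE ym1) (GammaE (ltW y0)) (GammaE e0) -!RintegralZl//.
have iA : mu.-integrable `[0%R, +oo[ (fun t => (A * (t `^ (y - 1) * expR (- t)))%:E).
  exact: integrable_EFinZ.
have iB : mu.-integrable `[0%R, +oo[ (fun t => (B * (t `^ y * expR (- t)))%:E).
  exact: integrable_EFinZ.
rewrite -RintegralD//; apply: le_Rintegral => //.
  exact: integrable_EFinD.
move=> t /=; rewrite in_itv/= andbT => t0.
rewrite !mulrA -mulrDl ler_wpM2r ?expR_ge0//.
move: t0; rewrite le_eqVlt => /predU1P[<-|t0].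
  have [E|En] := eqVneq (y - 1 + th) 0; last first.
    have th1' : 0 <= 1 - th by rewrite subr_ge0.
    have y0' := ltW y0; rewrite (powR0 En) addr_ge0//.
      by rewrite !mulr_ge0 ?powR_ge0.
    by rewrite !mulr_ge0 ?powR_ge0 ?invr_ge0.
  have [-> ->] : y = 1 /\ th = 0 by split; lra.
  rewrite /A /B; have -> : th = 0 by lra.
  by rewrite subrr addr0 !powRr0 !mul0r; lra.
have -> : t `^ y = t `^ (y - 1) * t by rewrite -mulr_powRB1 ?ltW// mulrC.
rewrite powR_pD// mulrC [leRHS](_ : _ = (A + B * t) * t `^ (y - 1)); last by ring.
rewrite ler_wpM2r ?powR_ge0//.
have ty0 : 0 <= t / y by rewrite divr_ge0 ?ltW.
have := powR_tangent th01 ty0.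
have -> : t `^ th = y `^ th * (t / y) `^ th.
  by rewrite -powRM ?(ltW y0)// mulrC divfK// gt_eqF.
move=> h; apply: le_trans (ler_wpM2l (powR_ge0 _ _) h) _.
by rewrite /A /B le_eqVlt; apply/orP; left; apply/eqP; field; rewrite gt_eqF.
Qed.

(* Unification must not unfold the integral in what follows. *)
#[local] Opaque Gamma.

Lemma Gamma_prod x n : 0 <= x -> (0 < n)%N ->
  Gamma (x + n%:R) = Gamma (x + 1) * \prod_(1 <= k < n) (x + k%:R).
Proof.
move=> x0; case: n => // n _; elim: n => [|n IH]; first by rewrite big_geq// mulr1.
rewrite big_nat_recr//= mulrA -IH -[n.+2%:R]natr1 addrA GammaS 1?mulrC//.
by rewrite -[leLHS]add0r lerD// ler1n.
Qed.

(** Euler's formula amounts to [rho x n --> 1].  For [x] in [[0, 1]] this is a squeeze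
between two uses of log-convexity; larger [x] are reached one unit at a time. *)
Let rho x n := Gamma (x + n%:R) / (Gamma n%:R * n%:R `^ x).

Let natr_ge1 n : 1 <= n.+1%:R :> R. Proof. by rewrite ler1n. Qed.

Let cvg_rho01 x : 0 <= x <= 1 -> rho x n.+1 @[n --> \oo] --> (1 : R).
Proof.
move=> x01; have [x0 x1] : 0 <= x /\ x <= 1 by apply/andP.
apply: (@squeeze_cvgr _ _ _ _ (fun n => 1 - n.+2%:R^-1) (cst 1)).
- near=> n; have n1 := natr_ge1 n; have n0 : 0 < n.+1%:R :> R by rewrite ltr0n.
  have G0 := Gamma_gt0 n1; have p0 := powR_gt0 x n0.
  apply/andP; split; last first.
    by rewrite /rho ler_pdivrMr ?mulr_gt0// mul1r addrC mulrC Gamma_addr_le.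
  rewrite /rho ler_pdivlMr ?mulr_gt0//.
  have nx1 : 1 <= n.+1%:R + x by rewrite -[leLHS]addr0 lerD.
  have nx0 : 0 < n.+1%:R + x by apply: lt_le_trans nx1.
  have x01' : 0 <= 1 - x <= 1 by lra.
  have := Gamma_addr_le nx1 x01'.
  rewrite [X in Gamma X](_ : _ = n.+1%:R + 1); last by ring.
  rewrite GammaS// => h.
  have q0 := powR_gt0 (1 - x) nx0.
  rewrite (addrC x) -(ler_pM2l q0); apply: le_trans h.
  have E : n.+1%:R `^ x * n.+1%:R `^ (1 - x) = n.+1%:R :> R.
    by rewrite -powR_pD// (_ : x + (1 - x) = 1) ?powRr1 ?(ltW n0)//; ring.
  rewrite -{4}E; set p := n.+1%:R `^ x in p0 E *; set g := Gamma _ in G0 *.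
  set w := n.+1%:R `^ (1 - x) in E *.
  rewrite [leLHS](_ : _ = p * g * ((1 - n.+2%:R^-1) * (n.+1%:R + x) `^ (1 - x))); last by ring.
  rewrite (_ : p * w * g = p * g * w); last by ring.
  apply: ler_wpM2l; first by rewrite mulr_ge0 ?ltW.
  have -> : 1 - n.+2%:R^-1 = n.+1%:R / n.+2%:R :> R.
    by rewrite -[n.+2%:R]natr1; field; lra.
  have -> : w = (n.+1%:R / (n.+1%:R + x)) `^ (1 - x) * (n.+1%:R + x) `^ (1 - x).
    by rewrite -powRM ?divr_ge0 ?(ltW nx0)// divfK// gt_eqF.
  apply: ler_wpM2r; first exact: powR_ge0.
  apply: (@le_trans _ _ (n.+1%:R / (n.+1%:R + x))).
    apply: ler_wpM2l; first exact: ltW.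
    by rewrite lef_pV2 ?posrE// -[n.+2%:R]natr1 lerD2l.
  apply: ger1_powR; last by lra.
  rewrite divr_gt0//= ler_pdivrMr// mul1r.
  by rewrite lerDl.
- rewrite -[X in _ --> X]subr0; apply: cvgB; first exact: cvg_cst.
  have := @cvg_harmonic R; rewrite -(cvg_shiftS (harmonic : nat -> R)).
  by [].
- exact: cvg_cst.
Unshelve. all: by end_near. Qed.

Let cvg_rho x : 0 <= x -> rho x n.+1 @[n --> \oo] --> (1 : R).
Proof.
move=> x0; have [m] : exists m : nat, x <= m%:R.
  by exists (Num.bound x); apply: ltW; exact: archi_boundP.
elim: m x x0 => [|m IH] x x0 xm.
  by apply: cvg_rho01; rewrite x0/=; apply: le_trans xm _.
have [x1|x1] := leP x 1; first by apply: cvg_rho01; rewrite x0.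
have xm1 : 0 <= x - 1 by rewrite subr_ge0 ltW.
have xm2 : x - 1 <= m%:R by rewrite lerBlDr natr1.
have h : (fun n : nat => rho (x - 1) n.+1 * (1 + (x - 1) / n.+1%:R)) @ \oo --> (1 : R).
  rewrite -[X in _ --> X]mulr1; apply: cvgM; first exact: IH.
  rewrite -[X in _ --> X]addr0; apply: cvgD; first exact: cvg_cst.
  rewrite -[X in _ --> X](mulr0 (x - 1)); apply: cvgM; first exact: cvg_cst.
  exact: cvg_harmonic.
apply: cvg_trans h; apply: near_eq_cvg; apply: nearW => n.
have n0 : 0 < n.+1%:R :> R by rewrite ltr0n.
rewrite /rho (_ : x + n.+1%:R = x - 1 + n.+1%:R + 1); last by ring.
rewrite GammaS; last by rewrite -[leLHS]add0r lerD// ler1n.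
rewrite (_ : n.+1%:R `^ x = n.+1%:R `^ (x - 1) * n.+1%:R); last first.
  by rewrite -mulr_powRB1 ?(ltW n0) ?(lt_trans _ x1)// mulrC.
field; rewrite !gt_eqF ?powR_gt0 ?Gamma_gt0//.
Qed.

(** Euler's limit formula for Gamma: the growth of all the products that arise as
means of functionals of the walk. *)
Lemma cvg_prod_Gamma x : 0 <= x ->
  \prod_(1 <= k < n.+1) (1 + x / k%:R) / n.+1%:R `^ x @[n --> \oo]
    --> (Gamma (1 + x))^-1.
Proof.
move=> x0; have h : rho x n.+1 / Gamma (1 + x) @[n --> \oo] --> (Gamma (1 + x))^-1.
  rewrite -[X in _ --> X]mul1r; apply: cvgM; last exact: cvg_cst.
  exact: cvg_rho.
apply: cvg_trans h; apply: near_eq_cvg; apply: nearW => n.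
have n0 : 0 < n.+1%:R :> R by rewrite ltr0n.
have -> : \prod_(1 <= k < n.+1) (1 + x / k%:R) =
    \prod_(1 <= k < n.+1) (x + k%:R) / \prod_(1 <= k < n.+1) k%:R.
  rewrite -prodf_div !big_nat; apply: eq_bigr => k /andP[k0 _].
  by rewrite mulrDl divff ?pnatr_eq0 -?lt0n// addrC.
rewrite /rho Gamma_prod//.
have := @Gamma_prod 0 n.+1 (lexx _) isT.
rewrite !add0r Gamma1 mul1r => ->.
have -> : \prod_(1 <= k < n.+1) (0 + k%:R) = \prod_(1 <= k < n.+1) k%:R :> R.
  by apply: eq_bigr => k _; rewrite add0r.
rewrite (addrC x 1); set P := \prod_(1 <= k < n.+1) k%:R; field.
rewrite !gt_eqF ?powR_gt0 ?Gamma_gt0 ?lerDl//.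
by rewrite /P big_nat prodr_gt0// => k /andP[k0 _]; rewrite ltr0n.
Qed.

End gamma.

(** * The heat kernel *)

Section mean_value.
Context {R : realType}.
Implicit Types (f g : R -> R) (x y u : R).

Lemma MVT_on (f df : R -> R) x y : x <= y ->
  (forall u, x <= u <= y -> is_derive u 1 f (df u)) ->
  exists2 c, x <= c <= y & f y - f x = df c * (y - x).
Proof.
move=> xy h; have [] := @MVT_segment R f df x y xy.
- by move=> u; rewrite in_itv/= => /andP[/ltW xu /ltW uy]; apply: h; rewrite xu.
- apply: derivable_within_continuous => u; rewrite in_itv/= => xuy.
  by have [] := h u xuy.
- by move=> c; rewrite in_itv/= => ? ?; exists c.
Qed.

Lemma MVT_from0 (g dg : R -> R) x : (forall u, is_derive u 1 g (dg u)) ->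
  exists2 c, `|c| <= `|x| & g x - g 0 = dg c * x.
Proof.
move=> h; have [x0|x0] := leP 0 x.
  have [c /andP[c0 cx] E] := MVT_on x0 (fun u _ => h u).
  by exists c; [rewrite !ger0_norm|rewrite E subr0].
have [c /andP[c0 cx] E] := MVT_on (ltW x0) (fun u _ => h u).
exists c; first by rewrite !ler0_norm ?(ltW x0)// lerN2.
by rewrite -opprB E; ring.
Qed.

Lemma is_derive_lin (c x : R) : is_derive x 1 (fun v : R => c * v) c.
Proof.
rewrite -[X in is_derive _ _ _ X]mulr1; exact: (@is_deriveZ _ _ _ id).
Qed.

Lemma is_derive_mul (f g : R -> R) (x df dg : R) :
  is_derive x 1 f df -> is_derive x 1 g dg ->
  is_derive x 1 (fun v => f v * g v) (f x * dg + g x * df).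
Proof. exact: is_deriveM. Qed.

Lemma is_derive_sub (f g : R -> R) (x df dg : R) :
  is_derive x 1 f df -> is_derive x 1 g dg ->
  is_derive x 1 (fun v => f v - g v) (df - dg).
Proof. exact: is_deriveB. Qed.

Lemma is_derive_scale (c : R) (f : R -> R) (x df : R) :
  is_derive x 1 f df -> is_derive x 1 (fun v => c * f v) (c * df).
Proof. exact: is_deriveZ. Qed.

Lemma is_derive_sqr (x : R) : is_derive x 1 (fun v : R => v ^+ 2) (2 * x).
Proof.
have h := is_derive_mul (is_derive_id x 1) (is_derive_id x 1).
by rewrite [X in is_derive _ _ _ X](_ : _ = x * 1 + x * 1)//; ring.
Qed.

Lemma is_derive_inv (x : R) : x != 0 ->
  is_derive x 1 (fun v : R => v^-1) (- x ^- 2).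
Proof.
move=> x0; have := @is_deriveV R id x 1 1 x0 _.
by rewrite /GRing.scale/= mulr1; apply; exact: is_derive_id.
Qed.

Lemma taylor_third (f f1 f2 f3 : R -> R) (M : R) : 0 <= M ->
  (forall u, is_derive u 1 f (f1 u)) -> (forall u, is_derive u 1 f1 (f2 u)) ->
  (forall u, is_derive u 1 f2 (f3 u)) -> (forall u, `|f3 u| <= M) ->
  forall y h, `|f (y + h) - f y - f1 y * h - f2 y / 2 * h ^+ 2| <= M * `|h| ^+ 3.
Proof.
move=> M0 d1 d2 d3 hM y h.
have sh (g dg : R -> R) : (forall u, is_derive u 1 g (dg u)) ->
    forall u, is_derive u 1 (fun u => g (y + u)) (dg (y + u)).
  move=> dgu u; rewrite -[X in is_derive _ _ _ X]mulr1.
  apply: (@is_derive1_comp _ g (fun u => y + u)) => //.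
  rewrite -[X in is_derive _ _ _ X]add0r.
  exact: (@is_deriveD _ _ _ (cst y) id).
have b2 u : `|f2 (y + u) - f2 y| <= M * `|u|.
  have [c _ E] := MVT_from0 u (sh _ _ d3); rewrite addr0 in E.
  by rewrite E normrM ler_wpM2r.
have b1 u : `|f1 (y + u) - f1 y - f2 y * u| <= M * `|u| ^+ 2.
  pose g u := f1 (y + u) - f2 y * u.
  have dg (v : R) : is_derive v 1 g (f2 (y + v) - f2 y).
    exact: is_derive_sub (sh _ _ d2 v) (is_derive_lin _ _).
  have [c cu E] := MVT_from0 u dg; rewrite /g addr0 mulr0 subr0 in E.
  rewrite addrAC E normrM expr2 mulrA ler_wpM2r//.
  by apply: le_trans (b2 c) _; rewrite ler_wpM2l.
pose g u := f (y + u) - f1 y * u - f2 y / 2 * u ^+ 2.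
have dg (v : R) : is_derive v 1 g (f1 (y + v) - f1 y - f2 y * v).
  rewrite [X in is_derive _ _ _ X](_ : _ = f1 (y + v) - f1 y - f2 y / 2 * (2 * v)).
    exact: is_derive_sub (is_derive_sub (sh _ _ d1 v) (is_derive_lin _ _))
      (is_derive_scale _ (is_derive_sqr _)).
  by field.
have [c ch E] := MVT_from0 h dg; rewrite /g addr0 mulr0 subr0 expr0n/= mulr0 subr0 in E.
rewrite [X in `|X|](_ : _ = f (y + h) - f1 y * h - f2 y / 2 * h ^+ 2 - f y); last by ring.
rewrite E normrM exprSr mulrA ler_wpM2r//.
by apply: le_trans (b1 c) _; rewrite ler_wpM2l// lerXn2r ?nnegrE.
Qed.

End mean_value.

Section heat_kernel.
Context {R : realType}.
Implicit Types (t y : R).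

(** The heat kernel up to the factor [1 / sqrt (2 * pi)]: density of the centered
Gaussian law of variance [t]. *)
Definition heat t y := expR (- (ln t / 2) - y ^+ 2 / (2 * t)).
Definition heat_y t y := - (y / t) * heat t y.
Definition heat_yy t y := ((y / t) ^+ 2 - t^-1) * heat t y.
Definition heat_yyy t y := (3 * y / t ^+ 2 - (y / t) ^+ 3) * heat t y.
Definition heat_tt t y :=
  ((t ^- 2 / 2 - y ^+ 2 / t ^+ 3) + ((y / t) ^+ 2 - t^-1) ^+ 2 / 4) * heat t y.

Lemma is_derive_heat t y : 0 < t -> is_derive y 1 (heat t) (heat_y t y).
Proof.
move=> t0.
have d : is_derive y 1 (fun y => - (ln t / 2) - (2 * t)^-1 * y ^+ 2) (- (y / t)).
  rewrite [X in is_derive _ _ _ X](_ : _ = 0 - (2 * t)^-1 * (2 * y)); last first.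
    by field; rewrite gt_eqF.
  exact: is_derive_sub (is_derive_cst _ _ _) (is_derive_scale _ (is_derive_sqr _)).
have h := is_derive1_comp (is_derive_expR _) d.
have -> : heat_y t y = expR (- (ln t / 2) - (2 * t)^-1 * y ^+ 2) * - (y / t).
  by rewrite /heat_y /heat mulrC (mulrC (y ^+ 2)).
rewrite [X in is_derive _ _ X _](_ : _ = expR \o (fun y => - (ln t / 2) - (2 * t)^-1 * y ^+ 2))//.
by apply/funext => u; rewrite /heat /= (mulrC (u ^+ 2)).
Qed.

Lemma is_derive_heat_y t y : 0 < t -> is_derive y 1 (heat_y t) (heat_yy t y).
Proof.
move=> t0; have d : is_derive y 1 (fun y => - t^-1 * y) (- t^-1) := is_derive_lin _ _.
have h := is_derive_mul d (is_derive_heat y t0).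
rewrite [X in is_derive _ _ X _](_ : _ = (fun y => - t^-1 * y * heat t y)); last first.
  by apply/funext => u; rewrite /heat_y (mulrC u) !mulNr.
rewrite [X in is_derive _ _ _ X](_ : _ = - t^-1 * y * heat_y t y + heat t y * - t^-1)//.
by rewrite /heat_yy /heat_y; ring.
Qed.

Lemma is_derive_heat_yy t y : 0 < t -> is_derive y 1 (heat_yy t) (heat_yyy t y).
Proof.
move=> t0; have d : is_derive y 1 (fun y => t ^- 2 * y ^+ 2 - t^-1) (t ^- 2 * (2 * y) - 0).
  exact: is_derive_sub (is_derive_scale _ (is_derive_sqr _)) (is_derive_cst _ _ _).
have h := is_derive_mul d (is_derive_heat y t0).
rewrite [X in is_derive _ _ X _](_ : _ = (fun y => (t ^- 2 * y ^+ 2 - t^-1) * heat t y)); last first.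
  by apply/funext => u; rewrite /heat_yy expr_div_n [t ^- 2 * _]mulrC.
rewrite [X in is_derive _ _ _ X](_ : _ = (t ^- 2 * y ^+ 2 - t^-1) * heat_y t y
   + heat t y * (t ^- 2 * (2 * y) - 0))//.
by rewrite /heat_yyy /heat_y; field; rewrite gt_eqF.
Qed.

(** The heat equation. *)
Lemma is_derive_heat_t t y : 0 < t ->
  is_derive t 1 (fun t => heat t y) (heat_yy t y / 2).
Proof.
move=> t0.
have d : is_derive t 1 (fun t => - 2^-1 * ln t - y ^+ 2 / 2 * t^-1)
    (- 2^-1 * t^-1 - y ^+ 2 / 2 * - t ^- 2).
  have t00 : t != 0 by rewrite gt_eqF.
  exact: is_derive_sub (is_derive_scale _ (is_derive1_ln t0))
    (is_derive_scale _ (is_derive_inv t00)).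
have h := is_derive1_comp (is_derive_expR _) d.
have E u : - (ln u / 2) - y ^+ 2 / (2 * u) = - 2^-1 * ln u - y ^+ 2 / 2 * u^-1.
  by rewrite invfM; ring.
rewrite [X in is_derive _ _ X _](_ : _ = expR \o (fun t => - 2^-1 * ln t - y ^+ 2 / 2 * t^-1)); last first.
  by apply/funext => u; rewrite /heat E.
rewrite [X in is_derive _ _ _ X](_ : _ =
  expR (- 2^-1 * ln t - y ^+ 2 / 2 * t^-1) * (- 2^-1 * t^-1 - y ^+ 2 / 2 * - t ^- 2))//.
rewrite /heat_yy /heat E [_ * expR _]mulrC -[expR _ * _ / 2]mulrA; congr (_ * _).
by field; rewrite gt_eqF.
Qed.

Lemma is_derive_heat_tt t y : 0 < t ->
  is_derive t 1 (fun t => heat_yy t y / 2) (heat_tt t y).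
Proof.
move=> t0; have t00 : t != 0 by rewrite gt_eqF.
have d1 := is_derive_inv t00.
have d2 := is_derive_mul d1 d1.
have d3 := is_derive_scale (2^-1) (is_derive_sub (is_derive_scale (y ^+ 2) d2) d1).
have h := is_derive_mul d3 (is_derive_heat_t y t0).
rewrite [X in is_derive _ _ X _](_ : _ =
   (fun u => 2^-1 * (y ^+ 2 * (u^-1 * u^-1) - u^-1) * heat u y)); last first.
  by apply/funext => u; rewrite /heat_yy; ring.
set e := (X in is_derive _ _ _ X) in h; rewrite [X in is_derive _ _ _ X](_ : _ = e)//.
by rewrite /e /heat_tt /heat_yy; field.
Qed.

End heat_kernel.

Section heat_bounds.
Context {R : realType} (t0 : R) (t0_gt0 : 0 < t0).
Implicit Types (t y : R).

(** Uniform bound away from time zero: the Gaussian factor absorbs any polynomial in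
[y ^+ 2 / t], and [ln t] is bounded below. *)
Lemma heat_poly_bound : exists2 C : R, 0 <= C & forall t y, t0 <= t ->
  (1 + y ^+ 2 / t + (y ^+ 2 / t) ^+ 2) * heat t y <= C.
Proof.
exists (11 * expR (- (ln t0 / 2))); first by rewrite mulr_ge0 ?expR_ge0.
move=> t y t0t; have tp : 0 < t by apply: lt_le_trans t0t.
rewrite /heat expRD mulrCA mulrC; apply: ler_pM; rewrite ?expR_ge0//.
- by rewrite mulr_ge0 ?expR_ge0// !addr_ge0 ?sqr_ge0// divr_ge0 ?sqr_ge0 ?(ltW tp).
- set z := y ^+ 2 / t; have z0 : 0 <= z by rewrite divr_ge0 ?sqr_ge0 ?(ltW tp).
  have -> : y ^+ 2 / (2 * t) = z / 2 by rewrite invfM /z; ring.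
  have z20 : 0 <= z / 2 by rewrite divr_ge0.
  have h0 := expR_ge1Dxn 0 z20; have h1 := expR_ge1Dxn 1 z20.
  rewrite expRN ler_pdivrMr ?expR_gt0//.
  move: h0 h1; rewrite expr1 expr_div_n !factS fact0 !muln1 divr1.
  by set e := expR _; lra.
- by rewrite ler_expR lerN2 ler_wpM2r ?invr_ge0// ler_ln.
Qed.

Let D := 4 * (1 + t0^-1) ^+ 3.

(** Every derivative of the kernel in use is a coefficient times the kernel; the
coefficients are dominated by the polynomial of [heat_poly_bound]. *)
Let coef_bounds t y : t0 <= t ->
  [/\ 1 <= D * (1 + y ^+ 2 / t + (y ^+ 2 / t) ^+ 2),
      `|y / t| <= D * (1 + y ^+ 2 / t + (y ^+ 2 / t) ^+ 2),
      `|(y / t) ^+ 2 - t^-1| <= D * (1 + y ^+ 2 / t + (y ^+ 2 / t) ^+ 2),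
      `|3 * y / t ^+ 2 - (y / t) ^+ 3| <= D * (1 + y ^+ 2 / t + (y ^+ 2 / t) ^+ 2)
    & `|(t ^- 2 / 2 - y ^+ 2 / t ^+ 3) + ((y / t) ^+ 2 - t^-1) ^+ 2 / 4|
       <= D * (1 + y ^+ 2 / t + (y ^+ 2 / t) ^+ 2)].
Proof.
move=> t0t; have tp : 0 < t by apply: lt_le_trans t0t.
have k0 : 0 < t^-1 by rewrite invr_gt0.
have kK : t^-1 <= t0^-1 by rewrite lef_pV2 ?posrE.
set z := y ^+ 2 / t; have z0 : 0 <= z by rewrite divr_ge0 ?sqr_ge0 ?(ltW tp).
rewrite /D; set k := t0^-1 in kK *.
have -> : y / t = t^-1 * y by rewrite mulrC.
have -> : 3 * y / t ^+ 2 = 3 * (t^-1 * (t^-1 * y)) by field; rewrite gt_eqF.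
have -> : y ^+ 2 / t ^+ 3 = z * t^-1 * t^-1 by rewrite /z; field; rewrite gt_eqF.
have -> : (t^-1 * y) ^+ 2 = z * t^-1 by rewrite /z; field; rewrite gt_eqF.
have -> : t ^- 2 = t^-1 * t^-1 by field; rewrite gt_eqF.
have -> : (t^-1 * y) ^+ 3 = t^-1 * y * (z * t^-1) by rewrite /z; field; rewrite gt_eqF.
have ky : `|t^-1 * y| <= t^-1 + z.
  rewrite normrM gtr0_norm// (_ : z = t^-1 * `|y| ^+ 2); last first.
    by rewrite /z real_normK ?num_real// mulrC.
  rewrite -[X in _ <= X + _]mulr1 -mulrDr ler_pM2l//.
  by have := normr_ge0 y; have := sqr_ge0 (`|y| - 1); nra.
have K1 : 1 <= 1 + k by lra.
have K2 : 1 + k <= (1 + k) ^+ 2 by nra.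
have K3 : (1 + k) ^+ 2 <= (1 + k) ^+ 3 by rewrite [leRHS]exprS; nra.
set W := 1 + z + z ^+ 2.
have W1 : 1 + z <= W by rewrite lerDl sqr_ge0.
have W0 : 0 <= W by apply: le_trans W1; lra.
have up (c : R) e : c <= e -> 0 <= e -> e <= 4 * (1 + k) ^+ 3 -> c * W <= 4 * (1 + k) ^+ 3 * W.
  by move=> ce e0 eD; rewrite ler_wpM2r//; apply: le_trans eD.
have kk : t^-1 * t^-1 <= (1 + k) ^+ 2 by nra.
split.
- by apply: le_trans (up 1 1 _ _ _); lra.
- apply: le_trans (up (1 + k) (1 + k) _ _ _); [|lra|lra|lra].
  by apply: le_trans ky _; nra.
- apply: le_trans (up (1 + k) (1 + k) _ _ _); [|lra|lra|lra].
  rewrite ler_norml; apply/andP; split; nra.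
- apply: le_trans (up (4 * (1 + k) ^+ 3) _ (lexx _) _ _) ; [|lra|lra].
  set u := t^-1 * y in ky *; set v := t^-1 in k0 kK kk ky *.
  have -> : 3 * (v * u) - u * (z * v) = u * (v * (3 - z)) by ring.
  rewrite normrM [`|v * (3 - z)|]normrM (gtr0_norm k0).
  have h3 : `|3 - z| <= 3 + z by rewrite ler_norml; lra.
  apply: (@le_trans _ _ ((v + z) * (v * (3 + z)))).
    apply: ler_pM => //; first by rewrite mulr_ge0 ?(ltW k0).
    by apply: ler_wpM2l; first exact: ltW.
  apply: (@le_trans _ _ ((1 + k) * (1 + z) * ((1 + k) * (3 + z)))); first by nra.
  have : (1 + z) * (3 + z) <= 4 * W by rewrite /W; nra.
  have : 0 <= (1 + z) * (3 + z) by nra.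
  nra.
- apply: le_trans (up (4 * (1 + k) ^+ 3) _ (lexx _) _ _) ; [|lra|lra].
  set v := t^-1 in k0 kK kk ky *.
  have -> : v * v / 2 - z * v * v + (z * v - v) ^+ 2 / 4 =
    v * v * (1 / 2 - z + (z - 1) ^+ 2 / 4) by field.
  rewrite normrM ger0_norm ?mulr_ge0 ?(ltW k0)//.
  apply: (@le_trans _ _ ((1 + k) ^+ 2 * (2 * W))); last by nra.
  apply: ler_pM => //; first by rewrite mulr_ge0 ?(ltW k0).
  by rewrite /W ler_norml; apply/andP; split; nra.
Qed.

(** Spatial third-order and temporal second-order expansions of the heat kernel,
uniform away from time zero. *)
Definition heat_controlled (C : R) :=
  [/\ forall t y, t0 <= t -> `|heat_y t y| <= C,
      forall t y, t0 <= t -> `|heat_yy t y| <= C,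
      forall t y h, t0 <= t -> `|heat t (y + h) - heat t y
         - heat_y t y * h - heat_yy t y / 2 * h ^+ 2| <= C * `|h| ^+ 3
    & forall t y u, t0 <= t -> 0 <= u ->
       `|heat (t + u) y - heat t y - heat_yy t y / 2 * u| <= C * u ^+ 2].

Lemma heat_expansion : exists2 C : R, 0 <= C & heat_controlled C.
Proof.
have [C0 C00 hC] := heat_poly_bound.
have D0 : 0 <= D by rewrite mulr_ge0 ?exprn_ge0 ?addr_ge0 ?invr_ge0 ?(ltW t0_gt0).
have bd t y c : t0 <= t -> `|c| <= D * (1 + y ^+ 2 / t + (y ^+ 2 / t) ^+ 2) ->
    `|c * heat t y| <= D * C0.
  move=> t0t h; rewrite normrM [`|heat t y|]ger0_norm ?expR_ge0//.
  apply: le_trans (ler_wpM2r (expR_ge0 _) h) _.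
  by rewrite -mulrA ler_wpM2l// hC.
exists (D * C0); first by rewrite mulr_ge0.
have b1 t y : t0 <= t -> `|heat_y t y| <= D * C0.
  by move=> t0t; have [_ h _ _ _] := coef_bounds y t0t; apply: bd => //; rewrite normrN.
have b2 t y : t0 <= t -> `|heat_yy t y| <= D * C0.
  by move=> t0t; have [_ _ h _ _] := coef_bounds y t0t; exact: bd.
have b3 t y : t0 <= t -> `|heat_yyy t y| <= D * C0.
  by move=> t0t; have [_ _ _ h _] := coef_bounds y t0t; exact: bd.
have b4 t y : t0 <= t -> `|heat_tt t y| <= D * C0.
  by move=> t0t; have [_ _ _ _ h] := coef_bounds y t0t; exact: bd.
split => //.
- move=> t y h t0t; have tp : 0 < t by apply: lt_le_trans t0t.
  apply: (@taylor_third _ (heat t) (heat_y t) (heat_yy t) (heat_yyy t)).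
  + by rewrite mulr_ge0.
  + by move=> u; exact: is_derive_heat.
  + by move=> u; exact: is_derive_heat_y.
  + by move=> u; exact: is_derive_heat_yy.
  + by move=> u; exact: b3.
- move=> t y u t0t u0; have tu : t <= t + u by rewrite lerDl.
  have dt v : t <= v <= t + u -> is_derive v 1 (fun t => heat t y) (heat_yy v y / 2).
    by move=> /andP[tv _]; apply: is_derive_heat_t; apply: lt_le_trans t0_gt0 _; exact: le_trans tv.
  have [c /andP[tc cu] E] := MVT_on tu dt.
  have dtt v : t <= v <= c -> is_derive v 1 (fun t => heat_yy t y / 2) (heat_tt v y).
    by move=> /andP[tv _]; apply: is_derive_heat_tt; apply: lt_le_trans t0_gt0 _; exact: le_trans tv.
  have [c' /andP[tc' cc'] E'] := MVT_on tc dtt.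
  have tuu : t + u - t = u by ring.
  rewrite E tuu -mulrBl E' normrM normrM expr2 mulrA.
  have := b4 c' y (le_trans t0t tc').
  rewrite (ger0_norm u0) => h; rewrite ler_wpM2r//.
  apply: ler_pM => //.
  by rewrite ger0_norm ?subr_ge0//; lra.
Qed.

End heat_bounds.

(** * Means over the steps of the walk *)

Section words.
Context {R : realType}.
Implicit Types (x : seq R) (y u : R) (F G : seq R -> R) (k n m N : nat).

Definition endpoint x := \sum_(y <- x) y.
Definition weight x := \sum_(y <- x) y ^+ 2.

Definition is_step y := y \in [:: 1; -1; 0].

(** The first step is never a stop; in particular the weight is at least one. *)
Definition walk x := all is_step x && (head 1 x != 0).

Lemma endpoint_rcons x y : endpoint (rcons x y) = endpoint x + y.
Proof. by rewrite /endpoint -cats1 big_cat/= big_seq1. Qed.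

Lemma weight_rcons x y : weight (rcons x y) = weight x + y ^+ 2.
Proof. by rewrite /weight -cats1 big_cat/= big_seq1. Qed.

Lemma is_stepP y : is_step y -> [\/ y = 1, y = -1 | y = 0].
Proof.
by rewrite /is_step !inE => /or3P[] /eqP ->; [apply: Or31|apply: Or32|apply: Or33].
Qed.

Lemma is_stepN y : is_step y -> is_step (- y).
Proof.
by move/is_stepP=> [] ->; rewrite /is_step !inE ?opprK ?oppr0 eqxx ?orbT.
Qed.

Lemma is_step0 : is_step 0. Proof. by rewrite /is_step !inE eqxx !orbT. Qed.

Lemma walk_rcons x y : walk x -> x != [::] -> is_step y -> walk (rcons x y).
Proof.
case: x => // z x /andP[/= /andP[z1 xs] z0] _ y1.
by rewrite /walk/= z1 z0 all_rcons y1 xs.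
Qed.

Lemma walk_rcons1 y : (y == 1) || (y == -1) -> walk (rcons [::] y).
Proof.
move=> /orP[] /eqP ->; rewrite /walk/= /is_step !inE eqxx ?orbT/=.
  by rewrite oner_eq0.
by rewrite oppr_eq0 oner_eq0.
Qed.

Lemma norm_endpoint_le x : walk x -> `|endpoint x| <= weight x.
Proof.
move=> /andP[/allP xs _]; apply: le_trans (ler_norm_sum _ _ _) _.
rewrite /weight big_seq [leRHS]big_seq; apply: ler_sum => y /xs/is_stepP[] ->.
- by rewrite normr1 expr1n.
- by rewrite normrN normr1 sqrrN expr1n.
- by rewrite normr0 expr0n.
Qed.

Lemma weight_ge0 x : 0 <= weight x.
Proof. by apply: sumr_ge0 => y _; exact: sqr_ge0. Qed.

Lemma weight_ge1 x : walk x -> x != [::] -> 1 <= weight x.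
Proof.
case: x => // y x /andP[/= /andP[ys _] y0] _.
rewrite /weight big_cons -[leLHS]addr0; apply: lerD; last exact: weight_ge0.
move: ys y0 => /is_stepP[] ->; rewrite ?eqxx// => _.
  by rewrite expr1n.
by rewrite sqrrN expr1n.
Qed.

Lemma weight_le_size x : walk x -> weight x <= (size x)%:R.
Proof.
move=> /andP[/allP xs _]; rewrite /weight -sum1_size natr_sum.
rewrite big_seq [leRHS]big_seq; apply: ler_sum => y /xs/is_stepP[] ->.
- by rewrite expr1n.
- by rewrite sqrrN expr1n.
- by rewrite expr0n.
Qed.

Section mean.
Context (p q r s : R).

(** Mean of [G] over the next step of the walk, given its past steps [x]. *)
Definition avg x (G : R -> R) : R :=
  if x is [::] then s * G 1 + (1 - s) * G (-1)
  else (size x)%:R^-1 * \sum_(y <- x) (p * G y + q * G (- y) + r * G 0).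

(** Mean of [F] over the first [n] steps of the walk: one step at a time, the last
step is averaged out. *)
Fixpoint Ex n F : R :=
  if n is m.+1 then Ex m (fun x => avg x (fun y => F (rcons x y))) else F [::].

Context (hp : 0 <= p) (hq : 0 <= q) (hr : 0 <= r) (hpqr : p + q + r = 1).
Context (hs : 0 <= s <= 1).

Lemma avgD x (G H : R -> R) : avg x (fun y => G y + H y) = avg x G + avg x H.
Proof.
case: x => [|z x]; rewrite /avg; first by ring.
rewrite -mulrDr -big_split/=; congr (_ * _).
by apply: eq_bigr => y _; ring.
Qed.

Lemma avgZ x (c : R) (G : R -> R) : avg x (fun y => c * G y) = c * avg x G.
Proof.
case: x => [|z x]; rewrite /avg; first by ring.
rewrite [RHS]mulrCA; congr (_ * _); rewrite mulr_sumr.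
by apply: eq_bigr => y _; ring.
Qed.

Lemma avg_cst x (c : R) : avg x (fun=> c) = c.
Proof.
case: x => [|z x]; rewrite /avg; first by ring.
under eq_bigr do rewrite -!mulrDl hpqr mul1r.
rewrite big_const_seq count_predT (iter_addr_0 _ c) -[c *+ _]mulr_natl mulrA mulVf ?mul1r//.
by rewrite pnatr_eq0.
Qed.

Lemma le_avg x (G H : R -> R) : walk x ->
  (forall y, is_step y -> walk (rcons x y) -> G y <= H y) -> avg x G <= avg x H.
Proof.
case: x => [|z x] wx h; rewrite /avg.
  have /andP[s0 s1'] := hs; have s1 : 0 <= 1 - s by rewrite subr_ge0.
  apply: lerD; apply: ler_wpM2l => //; apply: h; try (by rewrite /is_step !inE eqxx ?orbT);
    by apply: walk_rcons1; rewrite eqxx ?orbT.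
have h' y : is_step y -> G y <= H y by move=> ys; apply: h => //; exact: walk_rcons.
apply: ler_wpM2l; first by rewrite invr_ge0.
rewrite big_seq [leRHS]big_seq; apply: ler_sum => y yx.
have ys : is_step y by move: wx => /andP[/allP/(_ _ yx)].
by rewrite !lerD// ler_wpM2l// h'// ?is_stepN// is_step0.
Qed.

Lemma eq_avg x (G H : R -> R) : walk x ->
  (forall y, is_step y -> walk (rcons x y) -> G y = H y) -> avg x G = avg x H.
Proof.
move=> wx h; apply/eqP; rewrite eq_le; apply/andP; split;
  by apply: le_avg => // y ys wy; rewrite h.
Qed.

Lemma avgB x (G H : R -> R) : avg x (fun y => G y - H y) = avg x G - avg x H.
Proof.
rewrite avgD -[- avg x H]mulN1r -avgZ; congr (_ + _).
by congr (avg x _); apply/funext => y; rewrite mulN1r.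
Qed.

Lemma norm_avg_le x (G : R -> R) : walk x -> `|avg x G| <= avg x (fun y => `|G y|).
Proof.
move=> wx; rewrite ler_norml; apply/andP; split; last first.
  by apply: le_avg => // y _ _; exact: ler_norm.
rewrite lerNl -[leLHS]mulN1r -avgZ; apply: le_avg => // y _ _.
by rewrite mulN1r -normrN ler_norm.
Qed.

Lemma le_Ex n F G : (forall x, size x = n -> walk x -> F x <= G x) ->
  Ex n F <= Ex n G.
Proof.
elim: n F G => [|n IH] F G h /=; first by apply: h; rewrite ?/walk//= oner_eq0.
apply: IH => x xn wx; apply: le_avg => // y ys wy; apply: h => //.
by rewrite size_rcons xn.
Qed.

Lemma eq_Ex n F G : (forall x, size x = n -> walk x -> F x = G x) -> Ex n F = Ex n G.
Proof.
move=> h; apply/eqP; rewrite eq_le; apply/andP; split;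
  by apply: le_Ex => x xn wx; rewrite h.
Qed.

Lemma ExD n F G : Ex n (fun x => F x + G x) = Ex n F + Ex n G.
Proof.
elim: n F G => [|n IH] F G //=; rewrite -IH; congr Ex.
by apply/funext => x; exact: avgD.
Qed.

Lemma ExZ n (c : R) F : Ex n (fun x => c * F x) = c * Ex n F.
Proof.
elim: n F => [|n IH] F //=; rewrite -IH; congr Ex.
by apply/funext => x; exact: avgZ.
Qed.

Lemma ExB n F G : Ex n (fun x => F x - G x) = Ex n F - Ex n G.
Proof.
rewrite ExD -[- Ex n G]mulN1r -ExZ; congr (_ + _).
by congr (Ex n _); apply/funext => x; rewrite mulN1r.
Qed.

Lemma Ex_cst n (c : R) : Ex n (fun=> c) = c.
Proof.
elim: n => // n IH /=; rewrite -[RHS]IH; congr Ex.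
by apply/funext => x; exact: avg_cst.
Qed.

Lemma Ex_ge0 n F : (forall x, size x = n -> walk x -> 0 <= F x) -> 0 <= Ex n F.
Proof. by move=> h; rewrite -(Ex_cst n 0); exact: le_Ex. Qed.

Lemma norm_Ex_le n F : `|Ex n F| <= Ex n (fun x => `|F x|).
Proof.
rewrite ler_norml; apply/andP; split.
  rewrite lerNl -[leLHS]mulN1r -ExZ; apply: le_Ex => x _ _.
  by rewrite mulN1r -normrN ler_norm.
by apply: le_Ex => x _ _; exact: ler_norm.
Qed.

Lemma Ex_take n N F : (n <= N)%N -> Ex N (fun x => F (take n x)) = Ex n F.
Proof.
elim: N => [|N IH]; first by rewrite leqn0 => /eqP ->.
rewrite leq_eqVlt => /predU1P[->|nN].
  by apply: eq_Ex => x xn _; rewrite -xn take_size.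
rewrite -IH//=; apply: eq_Ex => x xN wx; rewrite -[RHS](avg_cst x).
by apply: eq_avg => // y _ _; rewrite -cats1 takel_cat// xN.
Qed.

(** Lindeberg telescoping: the functional [H k] is changed at each time to the next one,
while one more step is averaged out. *)
Lemma Ex_telescope n N (H : nat -> seq R -> R) : (n <= N)%N ->
  `|Ex N (H N) - Ex n (H n)| <=
  \sum_(n <= k < N) Ex k (fun x => `|avg x (fun y => H k.+1 (rcons x y)) - H k x|).
Proof.
elim: N => [|N IH]; first by rewrite leqn0 => /eqP ->; rewrite subrr normr0 big_geq.
rewrite leq_eqVlt => /predU1P[->|nN]; first by rewrite subrr normr0 big_geq.
rewrite big_nat_recr//=; rewrite -(subrKA (Ex N (H N))) addrC.
apply: le_trans (ler_normD _ _) _; rewrite lerD ?IH//.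
by rewrite -ExB; exact: norm_Ex_le.
Qed.

Lemma avg_endpoint x : x != [::] ->
  avg x (fun y => y) = (p - q) * endpoint x / (size x)%:R.
Proof.
case: x => // z x _; rewrite /avg mulrC; congr (_ / _).
rewrite mulr_sumr; apply: eq_bigr => y _; ring.
Qed.

(** The weight grows by zero or one, and by one with probability
[(p + q) * weight x / size x]: every function of the next weight is affine in the
square of the next step. *)
Lemma avg_weight x (h : R -> R) : walk x -> x != [::] ->
  avg x (fun y => h (y ^+ 2)) =
  h 0 + (p + q) * weight x / (size x)%:R * (h 1 - h 0).
Proof.
case: x => // z x wx _.
rewrite (@eq_avg _ _ (fun y => h 0 + (h 1 - h 0) * y ^+ 2))//; last first.
  by move=> y /is_stepP[] -> _; rewrite ?sqrrN ?expr1n ?expr0n/=; ring.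
rewrite avgD avg_cst avgZ (mulrC _ (h 1 - h 0)); congr (_ + _ * _).
rewrite /avg mulrC; congr (_ / _).
by rewrite mulr_sumr; apply: eq_bigr => y _; ring.
Qed.

Lemma ExS n F : Ex n.+1 F = Ex n (fun x => avg x (fun y => F (rcons x y))).
Proof. by []. Qed.

(** Rising factorial: these are the eigenfunctions of the weight process. *)
Definition rising m u : R := \prod_(i < m) (u + i%:R).

Lemma rising_succ m u : u * rising m (u + 1) = rising m u * (u + m%:R).
Proof.
have -> : rising m u * (u + m%:R) = rising m.+1 u by rewrite /rising big_ord_recr.
rewrite /rising big_ord_recl/= addr0; congr (_ * _).
by apply: eq_bigr => i _; rewrite /bump/= add1n -natr1; ring.
Qed.

Lemma Ex_rising m n : (0 < n)%N ->
  Ex n (fun x => rising m (weight x)) =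
  m`!%:R * \prod_(1 <= k < n) (1 + m%:R * (p + q) / k%:R).
Proof.
case: n => // n _; elim: n => [|n IH].
  rewrite big_geq// mulr1 /Ex /avg /= /weight !big_seq1 sqrrN expr1n.
  rewrite -mulrDl addrC subrK mul1r /rising.
  elim: m => [|m IH]; first by rewrite big_ord0 fact0.
  by rewrite big_ord_recr/= IH factS natrM mulrC -natr1 (addrC 1).
have -> : \prod_(1 <= k < n.+2) (1 + m%:R * (p + q) / k%:R) =
    \prod_(1 <= k < n.+1) (1 + m%:R * (p + q) / k%:R) *
    (1 + m%:R * (p + q) / n.+1%:R) by rewrite big_nat_recr.
rewrite mulrA -IH mulrC -ExZ ExS.
apply: eq_Ex => x xn wx; have x0 : x != [::] by rewrite -size_eq0 xn.
under [X in avg x X]funext do rewrite weight_rcons.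
rewrite (@avg_weight x (fun v => rising m (weight x + v)))// addr0.
have := rising_succ m (weight x); rewrite xn.
have n0 : n.+1%:R != 0 :> R by rewrite pnatr_eq0.
move=> E; rewrite mulrBr -[_ * _ / _ * rising m (weight x + 1)]mulrAC.
rewrite -[(p + q) * _ * rising _ _]mulrA E; field.
by rewrite nat1r.
Qed.

Let b := p + q.

Context (hb : 0 < p + q).

Lemma prod_bound (e : R) : 0 <= e -> exists2 C : R, 0 <= C & forall n, (0 < n)%N ->
  \prod_(1 <= k < n) (1 + e / k%:R) <= C * n%:R `^ e.
Proof.
move=> e0; have /cvg_ex/cvg_seq_bounded[M [Mr hM]] :=
  ex_intro (fun l : R => _ --> l) _ (cvg_prod_Gamma e0).
pose C := Num.max 0 (M + 1).
exists C; first by rewrite le_max lexx.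
case=> // n _; have := hM C _; rewrite lt_max ltrDl ltr01 orbT => /(_ isT n I)/=.
rewrite ger0_norm; last first.
  rewrite mulr_ge0 ?invr_ge0 ?powR_ge0//.
  by apply: prodr_ge0 => k _; rewrite addr_ge0// divr_ge0.
by rewrite ler_pdivrMr// powR_gt0.
Qed.

Lemma rising_ge m u : 0 <= u -> u ^+ m <= rising m u.
Proof.
move=> u0; rewrite /rising -[in leLHS](card_ord m) -prodr_const.
by apply: ler_prod => i _; rewrite u0/= lerDl.
Qed.

Lemma rising_le m : exists2 C : R, 0 <= C &
  forall u, 1 <= u -> u * rising m u <= u ^+ m.+1 + C * u ^+ m.
Proof.
elim: m => [|m [C C0 IH]].
  by exists 0 => // u u1; rewrite /rising big_ord0 mul0r addr0 mulr1 expr1.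
exists (m%:R + C + m%:R * C); first by rewrite !addr_ge0// mulr_ge0.
move=> u u1; have u0 : 0 <= u by apply: le_trans u1.
have -> : rising m.+1 u = rising m u * (u + m%:R) by rewrite /rising big_ord_recr.
rewrite mulrA; apply: (@le_trans _ _ ((u ^+ m.+1 + C * u ^+ m) * (u + m%:R))).
  by apply: ler_wpM2r; [rewrite addr_ge0|exact: IH].
rewrite !exprS; set v := u ^+ m.
have v0 : 0 <= v by rewrite exprn_ge0.
have mC : 0 <= m%:R * C by rewrite mulr_ge0.
rewrite -subr_ge0 [X in 0 <= X](_ : _ = m%:R * C * v * (u - 1)); last by ring.
by rewrite !mulr_ge0// subr_ge0.
Qed.

Lemma powR_mulnr n m : (n%:R : R) `^ (m%:R * b) = (n%:R `^ b) ^+ m.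
Proof. by rewrite mulrC powRrM powR_mulrn// powR_ge0. Qed.

Let b0 : 0 <= b. Proof. exact: ltW. Qed.

Lemma Ex_weightX_le m : exists2 C : R, 0 <= C & forall n, (0 < n)%N ->
  Ex n (fun x => weight x ^+ m) <= C * (n%:R `^ b) ^+ m.
Proof.
have [C C0 hC] := prod_bound (mulr_ge0 (ler0n R m) b0).
exists (m`!%:R * C); first by rewrite mulr_ge0.
move=> n n0; apply: (@le_trans _ _ (Ex n (fun x => rising m (weight x)))).
  by apply: le_Ex => x _ _; apply: rising_ge; exact: weight_ge0.
by rewrite Ex_rising// -mulrA ler_wpM2l// -powR_mulnr hC.
Qed.

Lemma cvg_powRN (e : R) : 0 < e -> n.+1%:R `^ (- e) @[n --> \oo] --> (0 : R).
Proof.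
move=> e0; apply/cvgrPdist_le => eps eps0; near=> n.
have n0 : 0 < n.+1%:R :> R by rewrite ltr0n.
rewrite sub0r normrN ger0_norm ?powR_ge0//.
have nE : eps^-1 `^ e^-1 <= n.+1%:R.
  near: n; exists (Num.bound (eps^-1 `^ e^-1)) => // n /= h.
  apply: ltW; apply: lt_le_trans (archi_boundP (powR_ge0 _ _)) _.
  by rewrite ler_nat ltnW.
have := @ge0_ler_powR R e (ltW e0) _ _ _ _ nE.
rewrite !nnegrE powR_ge0 (ltW n0) => /(_ isT isT).
rewrite -powRrM mulVf ?gt_eqF// powRr1 ?invr_ge0 ?(ltW eps0)// => h.
by rewrite powRN -[leRHS]invrK lef_pV2 ?posrE ?invr_gt0 ?powR_gt0.
Unshelve. all: by end_near. Qed.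

(** [weight x ^+ m] and the rising factorial differ by terms of lower order. *)
Lemma Ex_weightX_cvg m :
  Ex n.+1 (fun x => (weight x / n.+1%:R `^ b) ^+ m) @[n --> \oo]
    --> m`!%:R / Gamma (1 + m%:R * b).
Proof.
have mb0 : 0 <= m%:R * b by rewrite mulr_ge0.
have P n : 0 < n.+1%:R `^ b :> R by rewrite powR_gt0// ltr0n.
have E n : Ex n.+1 (fun x => (weight x / n.+1%:R `^ b) ^+ m) =
    Ex n.+1 (fun x => weight x ^+ m) / (n.+1%:R `^ b) ^+ m.
  rewrite mulrC -ExZ; apply: eq_Ex => x _ _.
  by rewrite expr_div_n mulrC.
have E1 n : Ex n.+1 (fun x => rising m (weight x)) / (n.+1%:R `^ b) ^+ m =
    m`!%:R * (\prod_(1 <= k < n.+1) (1 + m%:R * b / k%:R) / n.+1%:R `^ (m%:R * b)).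
  by rewrite Ex_rising// powR_mulnr mulrA.
have cv : Ex n.+1 (fun x => rising m (weight x)) / (n.+1%:R `^ b) ^+ m @[n --> \oo]
    --> m`!%:R / Gamma (1 + m%:R * b).
  under eq_cvg do rewrite E1.
  by apply: cvgM; [exact: cvg_cst|exact: cvg_prod_Gamma].
under eq_cvg do rewrite E.
case: m mb0 E E1 cv => [|m] mb0 E E1 cv.
  by move: cv; under eq_cvg do rewrite /rising; under eq_cvg do under eq_fun do rewrite big_ord0.
have [C C0 hC] := rising_le m.+1.
have [C' C'0 hC'] := Ex_weightX_le m.
have cvl : Ex n.+1 (fun x => rising m.+1 (weight x)) / (n.+1%:R `^ b) ^+ m.+1
     - C * C' * n.+1%:R `^ (- b) @[n --> \oo] --> m.+1`!%:R / Gamma (1 + m.+1%:R * b).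
  rewrite -[X in _ --> X]subr0; apply: cvgB => //.
  rewrite -[X in _ --> X](mulr0 (C * C')); apply: cvgM; first exact: cvg_cst.
  exact: cvg_powRN.
apply: (squeeze_cvgr _ cvl cv); apply: nearW => n.
apply/andP; split; last first.
  rewrite ler_wpM2r ?invr_ge0 ?exprn_ge0 ?powR_ge0//.
  by apply: le_Ex => x _ _; apply: rising_ge; exact: weight_ge0.
rewrite lerBlDr.
have -> : C * C' * n.+1%:R `^ (- b) = (C * (C' * (n.+1%:R `^ b) ^+ m)) / (n.+1%:R `^ b) ^+ m.+1.
  by rewrite powRN exprS; field; rewrite expf_neq0 ?gt_eqF.
rewrite -mulrDl ler_wpM2r ?invr_ge0 ?exprn_ge0 ?powR_ge0//.
apply: le_trans (lerD (lexx _) (ler_wpM2l C0 (hC' n.+1 isT))).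
rewrite -ExZ -ExD; apply: le_Ex => x xn wx.
have w1 : 1 <= weight x by apply: weight_ge1 => //; rewrite -size_eq0 xn.
rewrite -(ler_pM2l (lt_le_trans ltr01 w1)); apply: le_trans (hC _ w1) _.
by rewrite mulrDr -exprS mulrCA -exprS.
Qed.

(** Divided by the product, the weight is a martingale. *)
Lemma Ex_weight_take n N (G : seq R -> R) : (0 < n)%N -> (n <= N)%N ->
  Ex N (fun x => weight x * G (take n x)) =
  \prod_(n <= k < N) (1 + b / k%:R) * Ex n (fun x => weight x * G x).
Proof.
move=> n0; elim: N => [|N IH]; first by case: n n0.
rewrite leq_eqVlt => /predU1P[->|nN].
  rewrite big_geq// mul1r; apply: eq_Ex => x xn _.
  by rewrite -xn take_size.
rewrite big_nat_recr//= mulrAC -IH// mulrC -ExZ.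
apply: eq_Ex => x xN wx.
have x0 : x != [::] by rewrite -size_eq0 xN -lt0n (leq_trans n0).
have N0 : N%:R != 0 :> R by rewrite pnatr_eq0 -lt0n (leq_trans n0).
rewrite (@eq_avg x _ (fun y => G (take n x) * (weight x + y ^+ 2)))//; last first.
  by move=> y _ _; rewrite weight_rcons -cats1 takel_cat ?xN// mulrC.
rewrite avgZ (avg_weight (fun v => weight x + v))// addr0 xN /b; field.
exact: N0.
Qed.

(** The second moments converge, and the martingale property expresses the covariances
by them. *)
Lemma Ex_ratio_cauchy (eps : R) : 0 < eps -> exists n0, forall n N,
  (n0 <= n)%N -> (n <= N)%N ->
  Ex N.+1 (fun x => (weight x / N.+1%:R `^ b
     - weight (take n.+1 x) / n.+1%:R `^ b) ^+ 2) <= eps.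
Proof.
move=> eps0.
pose A n := Ex n.+1 (fun x => (weight x / n.+1%:R `^ b) ^+ 2).
pose B n : R := \prod_(1 <= k < n.+1) (1 + b / k%:R) / n.+1%:R `^ b.
have P n : 0 < n.+1%:R `^ b :> R by rewrite powR_gt0// ltr0n.
have Pi n : 0 < \prod_(1 <= k < n.+1) (1 + b / k%:R) :> R.
  by rewrite big_nat prodr_gt0// => k _; rewrite ltr_pwDl// divr_ge0.
have E n N : (n <= N)%N -> Ex N.+1 (fun x => (weight x / N.+1%:R `^ b
     - weight (take n.+1 x) / n.+1%:R `^ b) ^+ 2) = A N + A n - 2 * A n * (B N / B n).
  move=> nN.
  rewrite (@eq_Ex _ _ (fun x => (weight x / N.+1%:R `^ b) ^+ 2 +
     (weight (take n.+1 x) / n.+1%:R `^ b) ^+ 2 -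
     2 / N.+1%:R `^ b * (weight x * (weight (take n.+1 x) / n.+1%:R `^ b)))); last first.
    by move=> x _ _; ring.
  rewrite ExB ExD ExZ (Ex_take (fun x => (weight x / n.+1%:R `^ b) ^+ 2))//.
  rewrite (Ex_weight_take (fun x => weight x / n.+1%:R `^ b))//.
  congr (_ - _); rewrite -[2 * A n * _]mulrA -mulrA; congr (2 * _).
  rewrite mulrA mulrC [in LHS](_ : Ex _ _ = A n * n.+1%:R `^ b); last first.
    rewrite mulrC -ExZ; apply: eq_Ex => x _ _.
    by field; rewrite gt_eqF.
  rewrite -mulrA; congr (_ * _); rewrite /B.
  rewrite [in RHS](@big_cat_nat _ _ _ n.+1)//=.
  by field; rewrite !gt_eqF//.
have [lA cA] : exists l : R, A @ \oo --> l by eexists; exact: Ex_weightX_cvg.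
have [lB lB0 cB] : exists2 l : R, 0 < l & B @ \oo --> l.
  exists (Gamma (1 + b))^-1; last exact: cvg_prod_Gamma.
  by rewrite invr_gt0 Gamma_gt0// lerDl.
have [M M0 hM] : exists2 M : R, 0 < M & forall n, `|A n| <= M.
  have /cvg_ex/cvg_seq_bounded[M [Mr hM]] := ex_intro (fun l : R => _ --> l) _ cA.
  exists (Num.max 1 (M + 1)); first by rewrite lt_max ltr01.
  by move=> n; apply: hM => //; rewrite lt_max ltrDl ltr01 orbT.
pose dl := eps * lB / (16 * M).
have dl0 : 0 < dl by rewrite divr_gt0 ?mulr_gt0.
have [n1 _ h1] : \forall n \near \oo, `|lA - A n| <= eps / 4.
  by move/cvgrPdist_le: cA; apply; rewrite divr_gt0.
have [n2 _ h2] : \forall n \near \oo, `|lB - B n| <= dl.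
  by move/cvgrPdist_le: cB; apply.
have [n3 _ h3] : \forall n \near \oo, `|lB - B n| <= lB / 2.
  by move/cvgrPdist_le: cB; apply; rewrite divr_gt0.
exists (maxn n1 (maxn n2 n3)) => n N; rewrite !geq_max => /and3P[nn1 nn2 nn3] nN.
rewrite E//.
have a1 := h1 _ nn1; have a2 := h1 N (leq_trans nn1 nN).
have b1 := h2 _ nn2; have b2 := h2 N (leq_trans nn2 nN).
have b3 := h3 _ nn3.
rewrite /= in a1 a2 b1 b2 b3.
have Bn : lB / 2 <= B n by move: b3; rewrite ler_norml; lra.
have Bn0 : 0 < B n by apply: lt_le_trans Bn; rewrite divr_gt0.
rewrite (_ : _ - _ = (A N - A n) + 2 * A n * ((B n - B N) / B n)); last first.
  by field; rewrite gt_eqF.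
have u1 : A N - A n <= eps / 2 by move: a1 a2; rewrite !ler_norml; lra.
have u2 : `|(B n - B N) / B n| <= eps / (4 * M).
  rewrite normrM normfV (gtr0_norm Bn0) ler_pdivrMr//.
  apply: (@le_trans _ _ (2 * dl)); first by move: b1 b2; rewrite !ler_norml; lra.
  apply: (@le_trans _ _ (eps / (4 * M) * (lB / 2))); last first.
    by rewrite ler_wpM2l// divr_ge0 ?mulr_ge0 ?ltW.
  by rewrite /dl le_eqVlt; apply/orP; left; apply/eqP; field; rewrite gt_eqF.
have u3 : 2 * A n * ((B n - B N) / B n) <= 2 * M * (eps / (4 * M)).
  apply: le_trans (ler_norm _) _; rewrite normrM; apply: ler_pM => //.
  by rewrite normrM ger0_norm// ler_wpM2l.
have u4 : 2 * M * (eps / (4 * M)) = eps / 2 by field; rewrite gt_eqF.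
by rewrite u4 in u3; lra.
Qed.

(** A negative moment.  The weight gains one with probability [b Q / n], and
[1 / sqrt (4 Q - 3)] then decreases by a factor at least [1 - 1 / (2 Q)]; the
shift by [3 / 4] is what makes this true for every [Q >= 1]. *)
Lemma Ex_inv_sqrt n : (0 < n)%N ->
  Ex n (fun x => (Num.sqrt (4 * weight x - 3))^-1) <= n%:R `^ (- (b / 2)).
Proof.
case: n => // n _; elim: n => [|n IH].
  rewrite powR1 /Ex /avg/= /weight !big_seq1 sqrrN expr1n.
  by rewrite (_ : 4 * 1 - 3 = 1 :> R) ?sqrtr1 ?invr1; [lra|ring].
have n0 : 0 < n.+1%:R :> R by rewrite ltr0n.
have b21 : 0 <= b / 2 by rewrite divr_ge0.
apply: (@le_trans _ _ ((1 - b / 2 / n.+1%:R) * n.+1%:R `^ (- (b / 2)))); last first.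
  rewrite (@powR_natS _ n.+1)// mulrC ler_wpM2l ?powR_ge0//.
  by rewrite powRN_bernoulli// invr_ge0 ltW.
have hp2 : 0 <= 1 - b / 2 / n.+1%:R.
  rewrite subr_ge0 ler_pdivrMr// mul1r; apply: (@le_trans _ _ 1); last by rewrite ler1n.
  have b1 : b <= 1 by rewrite -hpqr lerDl.
  by lra.
apply: le_trans (ler_wpM2l hp2 IH); rewrite -ExZ ExS; apply: le_Ex => x xn wx.
have x0 : x != [::] by rewrite -size_eq0 xn.
have w1 := weight_ge1 wx x0.
under [X in avg x X]funext do rewrite weight_rcons.
rewrite (avg_weight (fun v => (Num.sqrt (4 * (weight x + v) - 3))^-1))// addr0 xn.
set Q := weight x in w1 *; have Q0 : 0 < Q by lra.
have u0 : 0 < 4 * Q - 3 by lra.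
have v0 : 0 < 4 * (Q + 1) - 3 by lra.
have Q21 : 0 < 1 - (2 * Q)^-1.
  by rewrite subr_gt0 invf_lt1; lra.
have key : (Num.sqrt (4 * (Q + 1) - 3))^-1 <= (1 - (2 * Q)^-1) * (Num.sqrt (4 * Q - 3))^-1.
  have : Num.sqrt (4 * Q - 3) <= (1 - (2 * Q)^-1) * Num.sqrt (4 * (Q + 1) - 3).
    rewrite -[1 - _](ger0_norm (ltW Q21)) -sqrtr_sqr -sqrtrM ?sqr_ge0// ler_sqrt.
      rewrite -subr_ge0 [X in 0 <= X](_ : _ = (2 * Q) ^- 2); last by field; lra.
      by rewrite invr_ge0 sqr_ge0.
    by rewrite mulr_ge0 ?sqr_ge0 ?ltW.
  have su : 0 < Num.sqrt (4 * Q - 3) by rewrite sqrtr_gt0.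
  have sv : 0 < Num.sqrt (4 * (Q + 1) - 3) by rewrite sqrtr_gt0.
  move=> h; rewrite -[leLHS]mul1r ler_pdivrMr// mulrAC ler_pdivlMr// mul1r.
  exact: h.
set g := (Num.sqrt (4 * Q - 3))^-1 in key *.
set g1 := (Num.sqrt _)^-1 in key *.
have c0 : 0 <= b * Q / n.+1%:R by rewrite !mulr_ge0 ?invr_ge0 ?(ltW Q0)// ltW.
rewrite -/b mulrBr addrCA -{1}[g]mul1r; apply: (@le_trans _ _
  (b * Q / n.+1%:R * ((1 - (2 * Q)^-1) * g) + (1 - b * Q / n.+1%:R) * g)).
  by rewrite lerD ?ler_wpM2l// mulrBl.
by rewrite le_eqVlt; apply/orP; left; apply/eqP; field; rewrite !gt_eqF.
Qed.

(** Markov's inequality for the negative moment. *)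
Lemma Ex_weight_small (dl : R) n : (0 < n)%N -> 0 <= dl ->
  Ex n (fun x => (weight x < dl * n%:R `^ b)%R%:R) <= 2 * Num.sqrt dl.
Proof.
move=> n0 dl0; have n0' : 0 < n%:R :> R by rewrite ltr0n.
have pn := powR_gt0 (b / 2) n0'.
apply: (@le_trans _ _ (2 * Num.sqrt dl * n%:R `^ (b / 2) * n%:R `^ (- (b / 2)))).
  apply: le_trans (ler_wpM2l _ (Ex_inv_sqrt n0)); last first.
    by rewrite !mulr_ge0 ?sqrtr_ge0 ?powR_ge0.
  rewrite -ExZ; apply: le_Ex => x xn wx.
  have w1 : 1 <= weight x by apply: weight_ge1 => //; rewrite -size_eq0 xn -lt0n.
  have s0 : 0 < Num.sqrt (4 * weight x - 3) by rewrite sqrtr_gt0; lra.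
  case: ltP => h; last by rewrite !mulr_ge0 ?invr_ge0 ?sqrtr_ge0 ?powR_ge0.
  rewrite ler_pdivlMr// mul1r.
  apply: (@le_trans _ _ (Num.sqrt (2 ^+ 2 * (dl * n%:R `^ b)))).
    by rewrite ler_sqrt; [lra|rewrite !mulr_ge0 ?sqr_ge0 ?powR_ge0].
  rewrite sqrtrM ?sqr_ge0// sqrtr_sqr ger0_norm// sqrtrM// mulrA ler_wpM2l//.
  by rewrite powRrM powR12_sqrt// powR_ge0.
by rewrite powRN -mulrA mulfV ?gt_eqF// mulr1.
Qed.

(** * Lindeberg's replacement argument *)

Ltac nng := repeat first [done | apply: addr_ge0 | apply: mulr_ge0
  | apply: exprn_ge0 | apply: powR_ge0 | rewrite invr_ge0 ].

Lemma powR_expn (u e : R) j : (u `^ e) ^+ j = u `^ (j%:R * e).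
Proof. by rewrite mulrC powRrM powR_mulrn// powR_ge0. Qed.

(** By the heat equation, the second-order term in space of the kernel is its first-order
term in time; only the mismatch between the second moment of the displacement [D] and
the elapsed time [dl] remains. *)
Lemma avg_heat_step (t0 C : R) x (D : R -> R) (t y dl : R) : 0 <= C ->
  heat_controlled t0 C -> walk x -> t0 <= t -> 0 <= dl ->
  `|avg x (fun z => heat t (y + D z)) - heat (t + dl) y| <=
  C * (`|avg x D| + `|avg x (fun z => D z ^+ 2) - dl|
       + avg x (fun z => `|D z| ^+ 3) + dl ^+ 2).
Proof.
move=> C0 [h1 h2 h3 h4] wx tt dl0.
pose rem z := heat t (y + D z) - heat t y - heat_y t y * D z
  - heat_yy t y / 2 * D z ^+ 2.
have Erem : avg x rem = avg x (fun z => heat t (y + D z)) - heat t y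
    - heat_y t y * avg x D - heat_yy t y / 2 * avg x (fun z => D z ^+ 2).
  by rewrite /rem !avgB avg_cst !avgZ.
have hrem : `|avg x rem| <= C * avg x (fun z => `|D z| ^+ 3).
  apply: le_trans (norm_avg_le _ wx) _; rewrite -avgZ.
  by apply: le_avg => // z _ _; exact: h3.
have -> : avg x (fun z => heat t (y + D z)) - heat (t + dl) y =
  avg x rem + heat_y t y * avg x D
  + heat_yy t y / 2 * (avg x (fun z => D z ^+ 2) - dl)
  - (heat (t + dl) y - heat t y - heat_yy t y / 2 * dl).
  by rewrite Erem; ring.
have k1 : `|heat_y t y * avg x D| <= C * `|avg x D|.
  by rewrite normrM ler_wpM2r// h1.
have k2 : `|heat_yy t y / 2 * (avg x (fun z => D z ^+ 2) - dl)|
    <= C * `|avg x (fun z => D z ^+ 2) - dl|.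
  rewrite normrM ler_wpM2r// normrM normfV (ger0_norm (ler0n _ 2)).
  rewrite ler_pdivrMr//; apply: le_trans (h2 _ _ tt) _.
  by rewrite ler_peMr// ler1n.
have k3 := h4 _ y _ tt dl0.
move: k1 k2 k3 hrem; set A := avg x rem; set B := heat_y t y * _.
set E := heat_yy t y / 2 * (_ - _); set F := _ - heat_yy t y / 2 * dl.
move=> k1 k2 k3 hrem.
have n1 := ler_normB (A + B + E) F.
have n2 := ler_normD (A + B) E.
have n3 := ler_normD A B.
rewrite !mulrDr; lra.
Qed.

Let a := p - q.
Let d := 2 * a - b.

Context (hr0 : 0 < r) (hsup : b < 2 * a).

Let a_gt0 : 0 < a. Proof. by move: hb hsup; rewrite -/b => ? ?; lra. Qed.
Let a_leb : a <= b. Proof. by rewrite lerD2l ge0_cp. Qed.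
Let b_lt1 : b < 1. Proof. by rewrite -hpqr ltrDl. Qed.
Let d_gt0 : 0 < d. Proof. by rewrite subr_gt0. Qed.

Let a01 : 0 <= a <= 1.
Proof. by rewrite (ltW a_gt0)/= (le_trans a_leb)// ltW. Qed.

(** Conditional moments of the increment of the walk rescaled by [n `^ a]: up to
a factor, this increment is [z - eta * endpoint x] with [eta] close to [a / k]. *)
Lemma avg_increment x k (eta : R) : walk x -> size x = k -> (0 < k)%N ->
  eta = (1 + k%:R^-1) `^ a - 1 ->
  let Q := weight x in let S := endpoint x in
  [/\ `|avg x (fun z => z - eta * S)| <= 2 * Q / k%:R ^+ 2,
      `|avg x (fun z => (z - eta * S) ^+ 2) - b * Q / k%:R| <= 3 * Q ^+ 2 / k%:R ^+ 2
    & avg x (fun z => `|z - eta * S| ^+ 3) <= 4 * Q / k%:R].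
Proof.
move=> wx xk k0 etaE Q S; have x0 : x != [::] by rewrite -size_eq0 xk -lt0n.
have K0 : 0 < k%:R :> R by rewrite ltr0n.
have i0 : 0 < k%:R^-1 :> R by rewrite invr_gt0.
have i1 : k%:R^-1 <= 1 :> R by rewrite invf_le1// ler1n.
have Q0 : 0 <= Q := weight_ge0 x.
have SQ : `|S| <= Q := norm_endpoint_le wx.
have QK : Q * k%:R^-1 <= 1 by rewrite ler_pdivrMr// mul1r -xk; exact: weight_le_size.
have [a0 a1] := andP a01.
have e1 : eta <= a * k%:R^-1.
  by rewrite etaE lerBlDl; exact: powR_bernoulli_le a01 (ltW i0).
have e2 := powR_bernoulli_second a01 (ltW i0).
have e0 : 0 <= eta.
  by rewrite etaE subr_ge0 -[leLHS](powRr0 (1 + k%:R^-1)) ler_powR// lerDl ltW.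
have {}e2 : a * k%:R^-1 - eta <= 2 * k%:R^-1 ^+ 2.
  move: e2; rewrite (_ : _ `^ a = eta + 1); last by rewrite etaE subrK.
  move: e1; set i := k%:R^-1 in i0 i1 * => e1 e2.
  have ai : a * i <= 1 by rewrite mulr_ile1 ?(ltW i0).
  have h : i ^+ 2 * (eta + 1) <= i ^+ 2 * 2.
    by apply: ler_wpM2l; [exact: sqr_ge0|lra].
  by lra.
have ei : eta <= k%:R^-1 by apply: le_trans e1 _; rewrite ler_piMl// ltW.
have E1 : avg x (fun z => z) = a * S * k%:R^-1 by rewrite avg_endpoint// xk.
have E2 : avg x (fun z => z ^+ 2) = b * Q * k%:R^-1.
  by rewrite (avg_weight (fun v => v))// xk add0r subr0 mulr1.
have F2 : avg x (fun z => (z - eta * S) ^+ 2) =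
    b * Q * k%:R^-1 - 2 * eta * a * (S ^+ 2 * k%:R^-1) + eta ^+ 2 * S ^+ 2.
  rewrite (@eq_avg x _ (fun z => z ^+ 2 - (2 * eta * S) * z + eta ^+ 2 * S ^+ 2))//.
    by rewrite avgD avgB avgZ avg_cst E1 E2; ring.
  by move=> z _ _; ring.
have S2 : S ^+ 2 <= Q ^+ 2 by rewrite -(real_normK (num_real S)) lerXn2r ?nnegrE.
have S20 : 0 <= S ^+ 2 := sqr_ge0 _.
set i := k%:R^-1 in e1 e2 ei E1 E2 F2 QK i0 i1 *.
have ea : 2 * eta * a * (S ^+ 2 * i) <= 2 * Q ^+ 2 * i ^+ 2.
  have -> : 2 * Q ^+ 2 * i ^+ 2 = 2 * i * 1 * (Q ^+ 2 * i) by ring.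
  have Si0 : 0 <= S ^+ 2 * i by apply: mulr_ge0 => //; exact: ltW.
  apply: ler_pM => //; [by rewrite !mulr_ge0| |by rewrite ler_pM2r].
  by apply: ler_pM => //; rewrite ?mulr_ge0// ler_pM2l.
have ee : eta ^+ 2 * S ^+ 2 <= Q ^+ 2 * i ^+ 2.
  rewrite mulrC; apply: ler_pM => //; first exact: exprn_ge0.
  by rewrite lerXn2r ?nnegrE// ltW.
have ea0 : 0 <= 2 * eta * a * (S ^+ 2 * i).
  by apply: mulr_ge0; [rewrite !mulr_ge0|apply: mulr_ge0 => //; exact: ltW].
have ee0 : 0 <= eta ^+ 2 * S ^+ 2 by apply: mulr_ge0 => //; exact: exprn_ge0.
have Qi : Q ^+ 2 * i ^+ 2 <= Q * i.
  by rewrite -exprMn expr2 ler_piMl// mulr_ge0// ltW.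
rewrite -exprVn -/i; split.
- rewrite avgB avg_cst E1 (_ : _ - _ = S * (a * i - eta)); last by ring.
  rewrite normrM [`|a * i - eta|]ger0_norm ?subr_ge0// mulrAC mulrC.
  by rewrite ler_pM// ?subr_ge0.
- rewrite F2 ler_norml; apply/andP; split; lra.
- apply: (@le_trans _ _ (avg x (fun z => 2 * (z - eta * S) ^+ 2))).
    apply: le_avg => // z /is_stepP zs _.
    rewrite exprSr -(real_normK (num_real (z - _))) mulrC ler_wpM2r ?sqr_ge0//.
    apply: le_trans (ler_normB _ _) _.
    have -> : 2 = 1 + 1 :> R by [].
    apply: lerD.
      by case: zs => ->; rewrite ?normrN ?normr1 ?normr0.
    rewrite normrM (ger0_norm e0); apply: le_trans QK.
    by rewrite mulrC ler_pM.
  rewrite avgZ F2.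
  have : b * Q * i <= Q * i by rewrite ler_wpM2r ?(ltW i0)// ler_piMl// ltW.
  lra.
Qed.

Definition ratio n x : R := weight x / n%:R `^ b.

(** Deterministic clock: [n `^ d] times it is the part of the limiting variance
produced by the steps of rank [k] up to [N]. *)
Definition clock N k : R := b / d * (k%:R `^ (- d) - N%:R `^ (- d)).

Lemma clock_step N k : (0 < k)%N ->
  0 <= clock N k - clock N k.+1 <= b * k%:R `^ (- 1 - d).
Proof.
move=> k0; have /andP[h0 h1] := powR_nat_diff_le (ltW d_gt0) k0.
have bd0 : 0 <= b / d by rewrite divr_ge0 ?(ltW d_gt0).
have -> : clock N k - clock N k.+1 = b / d * (k%:R `^ (- d) - k.+1%:R `^ (- d)).
  by rewrite /clock; ring.
rewrite mulr_ge0//=; apply: le_trans (ler_wpM2l bd0 h1) _.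
by rewrite mulrA divfK// gt_eqF.
Qed.

Lemma clock_ge0 N k : (0 < k)%N -> (k <= N)%N -> 0 <= clock N k.
Proof.
move=> k0 kN; rewrite mulr_ge0 ?divr_ge0 ?(ltW d_gt0)// subr_ge0 !powRN.
have N0 : (0 < N)%N by apply: leq_trans kN.
rewrite lef_pV2 ?posrE ?powR_gt0 ?ltr0n//.
by apply: ge0_ler_powR; rewrite ?nnegrE ?(ltW d_gt0)// ler_nat.
Qed.

Lemma clock_variance k : (0 < k)%N ->
  forall N, `|b * k.+1%:R `^ (- (2 * a)) * (k%:R `^ b / k%:R)
     - (clock N k - clock N k.+1)|
  <= b * (2 * a + 1 + d) * k%:R `^ (- 1 - d) / k%:R.
Proof.
move=> k0 N; have K0 : 0 < k%:R :> R by rewrite ltr0n.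
have h := @variance_increment R a b d k (ltW a_gt0) b0 d_gt0 k0.
have p1 : k%:R `^ (- 1 - d) = k%:R `^ (- d) / k%:R :> R.
  by rewrite addrC powR_pD// powR_inv1// ltW.
have p2 : k%:R `^ (- (2 * a)) * k%:R `^ b = k%:R `^ (- d) :> R.
  by rewrite -powR_pD//; congr (_ `^ _); rewrite /d; ring.
rewrite (_ : _ - _ = k%:R `^ (- 1 - d) * (b * (1 + k%:R^-1) `^ (- (2 * a))
    - b / d * (k%:R * (1 - (1 + k%:R^-1) `^ (- d))))).
  rewrite normrM ger0_norm ?powR_ge0// [leRHS](_ : _ = k%:R `^ (- 1 - d) *
    (b * (2 * a + 1 + d) / k%:R)); last by ring.
  by rewrite ler_wpM2l// powR_ge0.
rewrite p1 /clock (powR_natS _ k0) (powR_natS (- d) k0) -p2.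
by field; rewrite !gt_eqF.
Qed.

(** One step of the comparison: the walk moves, the remaining variance is run
down by the clock, and the heat equation cancels the leading terms. *)
Lemma heat_walk_step (t0 C g gam z Sn Rn : R) x n N k : 0 <= C -> heat_controlled t0 C ->
  walk x -> size x = k -> (0 < n)%N -> (n <= k)%N -> (k < N)%N -> 0 <= gam <= g ->
  0 <= Rn ->
  `|avg x (fun y => heat (t0 + gam ^+ 2 * Rn * clock N k.+1)
       (gam * (Sn / n%:R `^ a - endpoint (rcons x y) / k.+1%:R `^ a) - z))
    - heat (t0 + gam ^+ 2 * Rn * clock N k)
       (gam * (Sn / n%:R `^ a - endpoint x / k%:R `^ a) - z)| <=
  C * (2 * g * k%:R `^ (- a) * (weight x / k%:R ^+ 2)
   + g ^+ 2 * (k%:R `^ (- 1 - d) * `|ratio k x - Rn|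
        + b * (2 * a + 1 + d) * k%:R `^ (- 1 - d) / k%:R * Rn
        + 3 * k%:R `^ (- (2 * a)) * (weight x ^+ 2 / k%:R ^+ 2))
   + 4 * g ^+ 3 * k%:R `^ (- (3 * a)) * (weight x / k%:R)
   + g ^+ 4 * Rn ^+ 2 * (k%:R `^ (- 1 - d)) ^+ 2).
Proof.
move=> C0 hC wx xk n0 nk kN /andP[gam0 gamg] Rn0.
have k0 : (0 < k)%N by apply: leq_trans nk.
have K0 : 0 < k%:R :> R by rewrite ltr0n.
have K10 : 0 < k.+1%:R :> R by rewrite ltr0n.
have nR0 : 0 < n%:R :> R by rewrite ltr0n.
have k1p : 0 < 1 + k%:R^-1 :> R by rewrite addr_gt0 ?invr_gt0.
have x0 : x != [::] by rewrite -size_eq0 xk -lt0n.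
have g0 : 0 <= g by apply: le_trans gamg.
have Q0 := weight_ge0 x.
have /andP[dl0 dl1] := clock_step N k0.
set dl := clock N k - clock N k.+1 in dl0 dl1.
pose eta := (1 + k%:R^-1) `^ a - 1.
pose w := - (gam * k.+1%:R `^ (- a)).
have [m1 m2 m3] := avg_increment wx xk k0 (erefl eta).
set t := t0 + gam ^+ 2 * Rn * clock N k.+1.
have tt : t0 <= t.
  have ck := @clock_ge0 N k.+1 isT kN.
  by rewrite lerDl mulr_ge0// mulr_ge0// exprn_ge0.
set y := gam * _ - z.
have E y' : gam * (Sn / n%:R `^ a - endpoint (rcons x y') / k.+1%:R `^ a) - z =
    y + w * (y' - eta * endpoint x).
  rewrite endpoint_rcons /y /w /eta powRN (powR_natS _ k0).
  by field; rewrite !gt_eqF ?powR_gt0.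
under [X in avg x X]funext do rewrite E.
have -> : t0 + gam ^+ 2 * Rn * clock N k = t + gam ^+ 2 * Rn * dl.
  by rewrite /t /dl; ring.
have dlt0 : 0 <= gam ^+ 2 * Rn * dl by rewrite !mulr_ge0 ?exprn_ge0.
apply: le_trans (avg_heat_step _ _ C0 hC wx tt dlt0) _.
have ka : k.+1%:R `^ (- a) <= k%:R `^ (- a) :> R.
  rewrite !powRN lef_pV2 ?posrE ?powR_gt0//.
  by apply: ge0_ler_powR; rewrite ?nnegrE ?(ltW a_gt0)// ler_nat.
have p0 : 0 <= k%:R `^ (- a) :> R := powR_ge0 _ _.
have p10 : 0 <= k.+1%:R `^ (- a) :> R := powR_ge0 _ _.
have nw : `|w| <= g * k%:R `^ (- a).
  by rewrite normrN ger0_norm ?mulr_ge0// ler_pM.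
have w2 : w ^+ 2 = gam ^+ 2 * k.+1%:R `^ (- (2 * a)).
  by rewrite sqrrN exprMn powR_expn mulrN.
have pw j : (k%:R `^ (- a)) ^+ j = k%:R `^ (- (j%:R * a)) :> R.
  by rewrite powR_expn mulrN.
apply: ler_wpM2l => //; apply: lerD; [apply: lerD; [apply: lerD|]|].
- rewrite avgZ normrM -[leRHS](_ : (g * k%:R `^ (- a)) * (2 * weight x / k%:R ^+ 2) = _); last by ring.
  by apply: ler_pM.
- under [X in avg x X]funext do rewrite exprMn.
  rewrite avgZ; set A := avg x _ in m2 *.
  have -> : w ^+ 2 * A - gam ^+ 2 * Rn * dl =
    gam ^+ 2 * (k.+1%:R `^ (- (2 * a)) * (A - b * weight x / k%:R)
      + b * k.+1%:R `^ (- (2 * a)) * (k%:R `^ b / k%:R) * (ratio k x - Rn)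
      + (b * k.+1%:R `^ (- (2 * a)) * (k%:R `^ b / k%:R) - dl) * Rn).
    rewrite w2 /ratio; field; rewrite !gt_eqF ?powR_gt0//.
  rewrite normrM [`|_ ^+ 2|]ger0_norm ?exprn_ge0//.
  apply: ler_pM; rewrite ?exprn_ge0//; first by rewrite lerXn2r ?nnegrE.
  have kb : k.+1%:R `^ (- (2 * a)) <= k%:R `^ (- (2 * a)) :> R.
    rewrite !powRN lef_pV2 ?posrE ?powR_gt0//.
    by apply: ge0_ler_powR; rewrite ?nnegrE ?mulr_ge0 ?(ltW a_gt0)// ler_nat.
  apply: le_trans (ler_normD _ _) _.
  rewrite [leRHS](_ : _ = 3 * k%:R `^ (- (2 * a)) * (weight x ^+ 2 / k%:R ^+ 2)
    + k%:R `^ (- 1 - d) * `|ratio k x - Rn|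
    + b * (2 * a + 1 + d) * k%:R `^ (- 1 - d) / k%:R * Rn); last by ring.
  apply: lerD.
    apply: le_trans (ler_normD _ _) _; apply: lerD.
      rewrite normrM [`|_ `^ _|]ger0_norm ?powR_ge0//.
      rewrite -[leRHS](_ : k%:R `^ (- (2 * a)) * (3 * weight x ^+ 2 / k%:R ^+ 2) = _); last by ring.
      by apply: ler_pM => //; exact: powR_ge0.
    rewrite normrM ler_wpM2r// ger0_norm; last by rewrite !mulr_ge0 ?powR_ge0 ?invr_ge0.
    have -> : k%:R `^ (- 1 - d) = 1 * k%:R `^ (- (2 * a)) * (k%:R `^ b / k%:R) :> R.
      rewrite mul1r -[X in _ / X]powRr1 ?(ltW K0)// -powRN -!powR_pD//.
      by congr (_ `^ _); rewrite /d; ring.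
    rewrite ler_wpM2r ?divr_ge0 ?powR_ge0//.
    by apply: ler_pM; rewrite ?powR_ge0// ltW.
  by rewrite normrM (ger0_norm Rn0) ler_wpM2r// clock_variance.
- under [X in avg x X]funext do rewrite normrM exprMn.
  rewrite avgZ.
  rewrite [leRHS](_ : _ = (g * k%:R `^ (- a)) ^+ 3 * (4 * weight x / k%:R)); last first.
    by rewrite exprMn pw; ring.
  apply: ler_pM; [exact: exprn_ge0| |by rewrite lerXn2r ?nnegrE// mulr_ge0|exact: m3].
    rewrite -(avg_cst x 0); apply: le_avg => // z' _ _; exact: exprn_ge0.
- rewrite [leRHS](_ : _ = (g ^+ 2 * Rn * k%:R `^ (- 1 - d)) ^+ 2); last by ring.
  rewrite lerXn2r ?nnegrE ?mulr_ge0 ?exprn_ge0 ?powR_ge0//.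
  apply: ler_pM; rewrite ?mulr_ge0 ?exprn_ge0//.
    by rewrite ler_wpM2r// lerXn2r ?nnegrE.
  apply: le_trans dl1 _; rewrite ler_piMl ?powR_ge0//; exact: ltW.
Qed.

Lemma Ex_absratio_bounds : exists2 C : R, 0 <= C & forall n, (0 < n)%N ->
  [/\ Ex n (fun x => weight x) <= C * n%:R `^ b,
      Ex n (fun x => weight x ^+ 2) <= C * n%:R `^ (2 * b),
      Ex n (ratio n) <= C & Ex n (fun x => ratio n x ^+ 2) <= C].
Proof.
have [C1 C10 h1] := Ex_weightX_le 1.
have [C2 C20 h2] := Ex_weightX_le 2.
exists (C1 + C2); first exact: addr_ge0.
move=> n n0; have p0 : 0 < n%:R `^ b :> R by rewrite powR_gt0// ltr0n.
have e1 : Ex n (fun x => weight x) <= C1 * n%:R `^ b.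
  have := h1 n n0; rewrite expr1; apply: le_trans.
  by apply: le_Ex => x _ _; rewrite expr1.
have e2 : Ex n (fun x => weight x ^+ 2) <= C2 * n%:R `^ (2 * b).
  by have := h2 n n0; rewrite powR_expn.
split.
- by apply: le_trans e1 _; rewrite ler_wpM2r ?(ltW p0)// lerDl.
- by apply: le_trans e2 _; rewrite ler_wpM2r ?powR_ge0// lerDr.
- have -> : Ex n (ratio n) = (n%:R `^ b)^-1 * Ex n (fun x => weight x).
    by rewrite -ExZ; apply: eq_Ex => x _ _; rewrite /ratio mulrC.
  by rewrite ler_pdivrMl// mulrC; apply: le_trans e1 _; rewrite ler_wpM2r ?(ltW p0)// lerDl.
- have -> : Ex n (fun x => ratio n x ^+ 2) = (n%:R `^ (2 * b))^-1 * Ex n (fun x => weight x ^+ 2).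
    by rewrite -ExZ; apply: eq_Ex => x _ _; rewrite /ratio expr_div_n powR_expn mulrC.
  rewrite ler_pdivrMl ?powR_gt0 ?ltr0n// mulrC; apply: le_trans e2 _.
  by rewrite ler_wpM2r ?powR_ge0// lerDr.
Qed.

(** Lindeberg's replacement argument for the tail of the walk after time [n]: in
the mean, the law of the tail is that of a Gaussian variable whose variance is
proportional to the weight at time [n].  The scale [gam] may depend on the first
[n] steps. *)
Lemma lindeberg (t0 kap : R) : 0 < t0 -> 0 <= kap -> exists2 C : R, 0 <= C &
  forall n N (gam : seq R -> R) (z eps : R), (0 < n)%N -> (n <= N)%N ->
  (forall x, 0 <= gam x <= kap * n%:R `^ (d / 2)) ->
  (forall k, (n <= k)%N -> Ex k (fun x => `|ratio k x - ratio n (take n x)|) <= eps) ->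
  `|Ex N (fun x => heat t0 (gam (take n x) *
        (endpoint (take n x) / n%:R `^ a - endpoint x / N%:R `^ a) - z))
    - Ex n (fun x => heat (t0 + gam x ^+ 2 * ratio n x * clock N n) z)|
  <= C * (eps + n%:R `^ (b - 1) + n%:R `^ (- (b / 2))).
Proof.
move=> t00 kap0; have [C C0 hC] := heat_expansion t00.
have [C1 C10 hC1] := Ex_absratio_bounds.
have e1p : 0 < 1 + a - b by move: b_lt1 a_gt0; lra.
have e2p : 0 < d := d_gt0.
have e3p : 0 < d + 1 - b by move: b_lt1 d_gt0; lra.
have e4p : 0 < 3 * a - b by move: d_gt0 a_gt0; rewrite /d; lra.
have e5p : 0 < 1 + d by move: d_gt0; lra.
have e6p : 0 < 1 + 2 * d by move: d_gt0; lra.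
have x1 : d / 2 + - (1 + a - b) <= b - 1 by rewrite /d; move: b_lt1 b0; lra.
have x3 : - (1 + d) + d <= b - 1 by move: b0; lra.
have x4 : - (d + 1 - b) + d <= b - 1 by lra.
have x6 : 4%:R * (d / 2) + - (1 + 2 * d) <= b - 1 by move: b0; lra.
have [T1 T10 hT1] := powR_tail_sum e1p.
have [T2 T20 hT2] := powR_tail_sum e2p.
have [T3 T30 hT3] := powR_tail_sum e3p.
have [T4 T40 hT4] := powR_tail_sum e4p.
have [T5 T50 hT5] := powR_tail_sum e5p.
have [T6 T60 hT6] := powR_tail_sum e6p.
pose cv := b * (2 * a + 1 + d).
have cv0 : 0 <= cv by apply: mulr_ge0 => //; move: a_gt0 d_gt0; lra.
exists (C * (2 * kap * C1 * T1 + kap ^+ 2 * (T2 + cv * C1 * T5 + 3 * C1 * T3)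
     + 4 * kap ^+ 3 * C1 * T4 + kap ^+ 4 * C1 * T6)).
  nng.
move=> n N gam z eps n0 nN hgam heps.
have nR0 : 0 < n%:R :> R by rewrite ltr0n.
have nR1 : 1 <= n%:R :> R by rewrite ler1n.
pose g := kap * n%:R `^ (d / 2).
have g0 : 0 <= g by rewrite mulr_ge0 ?powR_ge0.
(* At time [k] the walk is known, and the variance of the steps from [k] to [N],
   frozen at time [n], is still to be produced. *)
pose H k x := heat (t0 + gam (take n x) ^+ 2 * ratio n (take n x) * clock N k)
  (gam (take n x) * (endpoint (take n x) / n%:R `^ a - endpoint x / k%:R `^ a) - z).
have HN : Ex N (H N) = Ex N (fun x => heat t0 (gam (take n x) *
        (endpoint (take n x) / n%:R `^ a - endpoint x / N%:R `^ a) - z)).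
  by apply: eq_Ex => x _ _; rewrite /H /clock subrr !mulr0 addr0.
have Hn : Ex n (H n) = Ex n (fun x => heat (t0 + gam x ^+ 2 * ratio n x * clock N n) z).
  apply: eq_Ex => x xn _; have tx : take n x = x by rewrite -xn take_size.
  by rewrite /H tx subrr mulr0 sub0r /heat sqrrN.
rewrite -HN -Hn; apply: le_trans (Ex_telescope H nN) _.
have eps0 : 0 <= eps.
  by apply: le_trans (heps n (leqnn n)); apply: Ex_ge0 => x _ _; exact: normr_ge0.
pose bnd k : R := C * (2 * g * C1 * k%:R `^ (- 1 - (1 + a - b))
   + g ^+ 2 * (eps * k%:R `^ (- 1 - d) + cv * C1 * k%:R `^ (- 1 - (1 + d))
        + 3 * C1 * k%:R `^ (- 1 - (d + 1 - b)))
   + 4 * g ^+ 3 * C1 * k%:R `^ (- 1 - (3 * a - b))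
   + g ^+ 4 * C1 * k%:R `^ (- 1 - (1 + 2 * d))).
apply: (@le_trans _ _ (\sum_(n <= k < N) bnd k)).
  rewrite !big_nat; apply: ler_sum => k /andP[nk kN].
  have k0 : (0 < k)%N by apply: leq_trans nk.
  have K0 : 0 < k%:R :> R by rewrite ltr0n.
  have pX e : k%:R `^ e / k%:R = k%:R `^ (e - 1) :> R.
    by rewrite powR_pD// powR_inv1// ltW.
  have pX2 e : k%:R `^ e / k%:R ^+ 2 = k%:R `^ (e - 2) :> R.
    by rewrite powR_pD// powRN powR_mulrn// ltW.
  apply: (@le_trans _ _ (Ex k (fun x => C * (2 * g * k%:R `^ (- a) * (weight x / k%:R ^+ 2)
   + g ^+ 2 * (k%:R `^ (- 1 - d) * `|ratio k x - ratio n (take n x)|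
        + cv * k%:R `^ (- 1 - d) / k%:R * ratio n (take n x)
        + 3 * k%:R `^ (- (2 * a)) * (weight x ^+ 2 / k%:R ^+ 2))
   + 4 * g ^+ 3 * k%:R `^ (- (3 * a)) * (weight x / k%:R)
   + g ^+ 4 * ratio n (take n x) ^+ 2 * (k%:R `^ (- 1 - d)) ^+ 2)))).
    apply: le_Ex => x xk wx; rewrite /H.
    have tk y : take n (rcons x y) = take n x by rewrite -cats1 takel_cat// xk.
    under [X in avg x X]funext do rewrite tk.
    apply: heat_walk_step => //.
    by rewrite divr_ge0 ?powR_ge0 ?weight_ge0.
  have [w1 w2 _ _] := hC1 k k0.
  have [_ _ r1 r2] := hC1 n n0.
  have Er1 : Ex k (fun x => ratio n (take n x)) <= C1 by rewrite (Ex_take (ratio n)).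
  have Er2 : Ex k (fun x => ratio n (take n x) ^+ 2) <= C1.
    by rewrite (Ex_take (fun x => ratio n x ^+ 2)).
  have he := heps k nk.
  rewrite (@eq_Ex _ _ (fun x => C * ((2 * g * k%:R `^ (- a) / k%:R ^+ 2) * weight x
   + (g ^+ 2 * k%:R `^ (- 1 - d)) * `|ratio k x - ratio n (take n x)|
   + (g ^+ 2 * cv * k%:R `^ (- 1 - d) / k%:R) * ratio n (take n x)
   + (g ^+ 2 * 3 * k%:R `^ (- (2 * a)) / k%:R ^+ 2) * weight x ^+ 2
   + (4 * g ^+ 3 * k%:R `^ (- (3 * a)) / k%:R) * weight x
   + (g ^+ 4 * (k%:R `^ (- 1 - d)) ^+ 2) * ratio n (take n x) ^+ 2))); last first.
    by move=> x _ _; congr (C * _); ring.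
  rewrite ExZ /bnd; apply: ler_wpM2l => //; rewrite !ExD !ExZ.
  have c1 : 2 * g * k%:R `^ (- a) / k%:R ^+ 2 * Ex k (fun x => weight x) <=
      2 * g * C1 * k%:R `^ (- 1 - (1 + a - b)).
    rewrite [leRHS](_ : _ = 2 * g * k%:R `^ (- a) / k%:R ^+ 2 * (C1 * k%:R `^ b)).
      by apply: ler_wpM2l => //; nng.
    rewrite -[2 * g * _ / _]mulrA pX2 (_ : - 1 - (1 + a - b) = - a - 2 + b); last by ring.
    by rewrite (@powR_pD _ _ (- a - 2) b K0); ring.
  have c2 : g ^+ 2 * k%:R `^ (- 1 - d) * Ex k (fun x => `|ratio k x - ratio n (take n x)|)
      <= g ^+ 2 * (eps * k%:R `^ (- 1 - d)).
    by rewrite (mulrC eps) mulrA ler_wpM2l// mulr_ge0 ?powR_ge0 ?exprn_ge0.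
  have c3 : g ^+ 2 * cv * k%:R `^ (- 1 - d) / k%:R * Ex k (fun x => ratio n (take n x))
      <= g ^+ 2 * (cv * C1 * k%:R `^ (- 1 - (1 + d))).
    rewrite (_ : - 1 - (1 + d) = - 1 - d - 1); last by ring.
    rewrite -pX [leRHS](_ : _ = g ^+ 2 * cv * k%:R `^ (- 1 - d) / k%:R * C1); last by ring.
    by apply: ler_wpM2l => //; nng.
  have c4 : g ^+ 2 * 3 * k%:R `^ (- (2 * a)) / k%:R ^+ 2 * Ex k (fun x => weight x ^+ 2)
      <= g ^+ 2 * (3 * C1 * k%:R `^ (- 1 - (d + 1 - b))).
    rewrite [leRHS](_ : _ = g ^+ 2 * 3 * k%:R `^ (- (2 * a)) / k%:R ^+ 2 * (C1 * k%:R `^ (2 * b))).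
      by apply: ler_wpM2l => //; nng.
    rewrite -[g ^+ 2 * 3 * _ / _]mulrA pX2.
    rewrite (_ : - 1 - (d + 1 - b) = - (2 * a) - 2 + 2 * b); last by rewrite /d; ring.
    by rewrite (@powR_pD _ _ (- (2 * a) - 2) (2 * b) K0); ring.
  have c5 : 4 * g ^+ 3 * k%:R `^ (- (3 * a)) / k%:R * Ex k (fun x => weight x)
      <= 4 * g ^+ 3 * C1 * k%:R `^ (- 1 - (3 * a - b)).
    rewrite [leRHS](_ : _ = 4 * g ^+ 3 * k%:R `^ (- (3 * a)) / k%:R * (C1 * k%:R `^ b)).
      by apply: ler_wpM2l => //; nng.
    rewrite -[4 * g ^+ 3 * _ / _]mulrA pX (_ : - 1 - (3 * a - b) = - (3 * a) - 1 + b); last by ring.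
    by rewrite (@powR_pD _ _ (- (3 * a) - 1) b K0); ring.
  have c6 : g ^+ 4 * (k%:R `^ (- 1 - d)) ^+ 2 * Ex k (fun x => ratio n (take n x) ^+ 2)
      <= g ^+ 4 * C1 * k%:R `^ (- 1 - (1 + 2 * d)).
    rewrite powR_expn (_ : 2 * (- 1 - d) = - 1 - (1 + 2 * d)); last by ring.
    rewrite [leRHS]mulrAC; apply: ler_wpM2l => //; nng.
  apply: lerD => //; apply: lerD => //; rewrite -2!addrA; apply: lerD => //.
  rewrite [leRHS]mulrDr [X in _ <= X + _]mulrDr -[leRHS]addrA.
  by apply: lerD => //; apply: lerD.
rewrite /bnd -mulr_sumr -[leRHS]mulrA; apply: ler_wpM2l => //.
rewrite !big_split/= -!mulr_sumr !big_split/= -!mulr_sumr.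
set rn := eps + _ + _.
have pn e1 e2 : n%:R `^ e1 * n%:R `^ e2 = n%:R `^ (e1 + e2) :> R by rewrite powR_pD.
have gX j : g ^+ j = kap ^+ j * n%:R `^ (j%:R * (d / 2)) by rewrite /g exprMn powR_expn.
have q1 := powR_ge0 (n%:R : R) (b - 1).
have q2 := powR_ge0 (n%:R : R) (- (b / 2)).
have r1 : n%:R `^ (b - 1) <= rn by rewrite /rn [leRHS]addrAC lerDr addr_ge0.
have r2 : n%:R `^ (- (b / 2)) <= rn by rewrite /rn lerDr addr_ge0.
have r3 : eps <= rn by rewrite /rn -[leRHS]addrA lerDl addr_ge0.
have mono e : e <= b - 1 -> n%:R `^ e <= rn.
  by move=> eb; apply: le_trans r1; rewrite ler_powR.
have g1 : g = kap * n%:R `^ (d / 2) by [].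
have s1 : 2 * g * C1 * \sum_(n <= k < N) k%:R `^ (- 1 - (1 + a - b)) <= 2 * kap * C1 * T1 * rn.
  apply: le_trans (ler_wpM2l _ (hT1 n N n0)) _; first nng.
  rewrite [leLHS](_ : _ = 2 * kap * C1 * T1 * (n%:R `^ (d / 2) * n%:R `^ (- (1 + a - b)))); last by rewrite g1; ring.
  rewrite pn; apply: ler_wpM2l; first nng.
  exact: mono.
have s2 : g ^+ 2 * (eps * \sum_(n <= k < N) k%:R `^ (- 1 - d)) <= kap ^+ 2 * T2 * rn.
  apply: (@le_trans _ _ (g ^+ 2 * (eps * (T2 * n%:R `^ (- d))))).
    by rewrite ler_wpM2l ?exprn_ge0// ler_wpM2l// hT2.
  rewrite gX (_ : 2%:R * (d / 2) = d); last by field.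
  rewrite [leLHS](_ : _ = kap ^+ 2 * T2 * (eps * (n%:R `^ (- d) * n%:R `^ d))); last by ring.
  by rewrite pn addNr powRr0 mulr1 ler_wpM2l//; nng.
have s3 : g ^+ 2 * (cv * C1 * \sum_(n <= k < N) k%:R `^ (- 1 - (1 + d)))
    <= kap ^+ 2 * (cv * C1 * T5) * rn.
  apply: (@le_trans _ _ (g ^+ 2 * (cv * C1 * (T5 * n%:R `^ (- (1 + d)))))).
    apply: ler_wpM2l; [nng|apply: ler_wpM2l; [nng|exact: hT5]].
  rewrite gX (_ : 2%:R * (d / 2) = d); last by field.
  rewrite [leLHS](_ : _ = kap ^+ 2 * (cv * C1 * T5) * (n%:R `^ (- (1 + d)) * n%:R `^ d)); last by ring.
  rewrite pn; apply: ler_wpM2l; first nng.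
  exact: mono.
have s4 : g ^+ 2 * (3 * C1 * \sum_(n <= k < N) k%:R `^ (- 1 - (d + 1 - b)))
    <= kap ^+ 2 * (3 * C1 * T3) * rn.
  apply: (@le_trans _ _ (g ^+ 2 * (3 * C1 * (T3 * n%:R `^ (- (d + 1 - b)))))).
    apply: ler_wpM2l; [nng|apply: ler_wpM2l; [nng|exact: hT3]].
  rewrite gX (_ : 2%:R * (d / 2) = d); last by field.
  rewrite [leLHS](_ : _ = kap ^+ 2 * (3 * C1 * T3) * (n%:R `^ (- (d + 1 - b)) * n%:R `^ d)); last by ring.
  rewrite pn; apply: ler_wpM2l; [nng|exact: mono].
have s5 : 4 * g ^+ 3 * C1 * \sum_(n <= k < N) k%:R `^ (- 1 - (3 * a - b))
    <= 4 * kap ^+ 3 * C1 * T4 * rn.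
  apply: le_trans (ler_wpM2l _ (hT4 n N n0)) _; first nng.
  rewrite gX [leLHS](_ : _ = 4 * kap ^+ 3 * C1 * T4 *
    (n%:R `^ (3%:R * (d / 2)) * n%:R `^ (- (3 * a - b)))); last by ring.
  rewrite pn; apply: ler_wpM2l; first nng.
  apply: le_trans r2.
  rewrite (_ : _ + _ = - (b / 2)); first by [].
  by rewrite /d; field.
have s6 : g ^+ 4 * C1 * \sum_(n <= k < N) k%:R `^ (- 1 - (1 + 2 * d))
    <= kap ^+ 4 * C1 * T6 * rn.
  apply: le_trans (ler_wpM2l _ (hT6 n N n0)) _; first nng.
  rewrite gX [leLHS](_ : _ = kap ^+ 4 * C1 * T6 *
    (n%:R `^ (4%:R * (d / 2)) * n%:R `^ (- (1 + 2 * d)))); last by ring.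
  rewrite pn; apply: ler_wpM2l; first nng.
  exact: mono.
rewrite [leRHS]mulrDl; apply: lerD => //; rewrite [leRHS]mulrDl; apply: lerD => //.
rewrite [leRHS]mulrDl; apply: lerD => //.
rewrite [leRHS](_ : _ = kap ^+ 2 * T2 * rn + kap ^+ 2 * (cv * C1 * T5) * rn
  + kap ^+ 2 * (3 * C1 * T3) * rn); last by ring.
rewrite [leLHS]mulrDr [X in X + _ <= _]mulrDr.
by apply: lerD => //; apply: lerD.
Qed.

End mean.

End words.

(** * From words of steps to the probability space *)

Section bounded_mean.
Context {R : realType} d {T : measurableType d} (P : probability T R).
Implicit Types (f g : T -> R) (c M : R).

Definition bounded_meas f := measurable_fun setT f /\ exists M, forall w, `|f w| <= M.

Lemma bounded_meas_integrable f : bounded_meas f -> P.-integrable setT (EFin \o f).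
Proof.
move=> [mf [M hM]]; apply: measurable_bounded_integrable => //.
  by rewrite (le_lt_trans (probability_le1 _ _))// ltry.
by exists M; split; [exact: num_real|move=> x Mx w _ /=; exact: le_trans (hM w) (ltW Mx)].
Qed.

Lemma bounded_measD f g : bounded_meas f -> bounded_meas g ->
  bounded_meas (fun w => f w + g w).
Proof.
move=> [mf [M hM]] [mg [M' hM']]; split; first exact: measurable_funD.
by exists (M + M') => w; apply: le_trans (ler_normD _ _) _; exact: lerD.
Qed.

Lemma bounded_measM f g : bounded_meas f -> bounded_meas g ->
  bounded_meas (fun w => f w * g w).
Proof.
move=> [mf [M hM]] [mg [M' hM']]; split; first exact: measurable_funM.
by exists (M * M') => w; rewrite normrM; apply: ler_pM.
Qed.

Lemma bounded_meas_cst c : bounded_meas (fun=> c).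
Proof. by split => //; exists `|c|. Qed.

Lemma bounded_measB f g : bounded_meas f -> bounded_meas g ->
  bounded_meas (fun w => f w - g w).
Proof.
move=> bf bg; apply: bounded_measD => //.
by have := bounded_measM (bounded_meas_cst (-1)) bg; under eq_fun do rewrite mulN1r.
Qed.

Lemma bounded_meas_sum (I : Type) (s : seq I) (f : I -> T -> R) :
  (forall i, bounded_meas (f i)) -> bounded_meas (fun w => \sum_(i <- s) f i w).
Proof.
move=> h; elim: s => [|i s IH].
  by under eq_fun do rewrite big_nil; exact: bounded_meas_cst.
by under eq_fun do rewrite big_cons; exact: bounded_measD.
Qed.

Lemma bounded_meas_indic (A : set T) : measurable A -> bounded_meas (\1_A).
Proof.
move=> mA; split; first exact: measurable_indic.
by exists 1 => w; rewrite indicE; case: (_ \in _); rewrite ?normr1 ?normr0.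
Qed.

Lemma mean_sum (I : Type) (s : seq I) (f : I -> T -> R) :
  (forall i, bounded_meas (f i)) ->
  \int[P]_w (\sum_(i <- s) f i w) = \sum_(i <- s) \int[P]_w f i w.
Proof.
move=> h; elim: s => [|i s IH].
  rewrite big_nil; under eq_Rintegral do rewrite big_nil.
  by rewrite Rintegral_cst//= mul0r.
rewrite big_cons -IH; under eq_Rintegral do rewrite big_cons.
rewrite RintegralD//; first exact: bounded_meas_integrable.
by apply: bounded_meas_integrable; exact: bounded_meas_sum.
Qed.

Lemma meanZ c f : bounded_meas f -> \int[P]_w (c * f w) = c * \int[P]_w f w.
Proof. by move=> h; rewrite RintegralZl//; exact: bounded_meas_integrable. Qed.

Lemma mean_indic (A : set T) : measurable A -> \int[P]_w \1_A w = fine (P A).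
Proof. by move=> mA; rewrite /Rintegral integral_indic// setIT. Qed.

Lemma ae_eq_mean f g : bounded_meas f -> bounded_meas g ->
  {ae P, forall w, f w = g w} -> \int[P]_w f w = \int[P]_w g w.
Proof.
move=> [mf _] [mg _] fg; congr fine; apply: ae_eq_integral => //.
- exact/measurable_EFinP.
- exact/measurable_EFinP.
- by apply: filterS fg => w h _ /=; rewrite h.
Qed.

Lemma expectation_mean f : bounded_meas f -> ('E_P[f])%E = (\int[P]_w f w)%:E.
Proof.
move=> bf; rewrite unlock /Rintegral fineK//.
by apply: integrable_fin_num => //; exact: bounded_meas_integrable.
Qed.

Lemma probability1_ae (A : set T) : measurable A -> P A = 1%E ->
  {ae P, forall w, A w}.
Proof.
move=> mA A1; exists (~` A); split => //; first exact: measurableC.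
by rewrite probability_setC// A1 subee.
Qed.

End bounded_mean.

Section walk_path.
Context {R : realType} d {T : measurableType d} (P : probability T R).
Context (p q r s : R) (X : nat -> {RV P >-> R}) (K : nat -> {RV P >-> nat})
  (e : nat -> {RV P >-> R}).
Context (hp : 0 <= p) (hq : 0 <= q) (hr : 0 <= r) (hpqr : p + q + r = 1)
  (hs : 0 <= s <= 1) (hX : is_ERWS p q r s X K e).

(** The steps are in [{1, -1, 0}] only almost surely; rounding them makes every
function of finitely many steps simple, hence measurable. *)
Definition round_step (v : R) : R := if v == 1 then 1 else if v == -1 then -1 else 0.

Lemma is_step_round v : is_step (round_step v).
Proof.
by rewrite /round_step /is_step !inE; case: ifP => _; rewrite ?eqxx//;
   case: ifP => _; rewrite eqxx ?orbT.
Qed.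

Lemma round_step_id v : is_step v -> round_step v = v.
Proof.
rewrite /round_step => /is_stepP[] ->; rewrite ?eqxx//.
  case: ifPn => // /eqP E; exfalso; move: E; lra.
case: ifPn => [/eqP E|_]; first by exfalso; move: E; lra.
case: ifPn => // /eqP E; exfalso; move: E; lra.
Qed.

Lemma measurable_round_step : measurable_fun setT round_step.
Proof.
apply: measurable_fun_ifT => //; first exact: measurable_fun_eqr.
by apply: measurable_fun_ifT => //; exact: measurable_fun_eqr.
Qed.

Definition path n w : seq R := [seq round_step (X i w) | i <- iota 1 n].

Lemma size_path n w : size (path n w) = n.
Proof. by rewrite size_map size_iota. Qed.

Lemma path_rcons n w : path n.+1 w = rcons (path n w) (round_step (X n.+1 w)).
Proof. by rewrite /path -{1}(addn1 n) iotaD map_cat cats1 add1n. Qed.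

Lemma take_path n N w : (n <= N)%N -> take n (path N w) = path n w.
Proof. by move=> nN; rewrite /path -map_take take_iota (minn_idPl nN). Qed.

Fixpoint words n : seq (seq R) :=
  if n is m.+1 then [seq rcons x y | x <- words m, y <- [:: 1; -1; 0]] else [:: [::]].

Lemma path_in_words n w : path n w \in words n.
Proof.
elim: n => [|n IH]; first by rewrite inE.
rewrite path_rcons; apply/allpairsP; exists (path n w, round_step (X n.+1 w)).
by split => //=; exact: is_step_round.
Qed.

Lemma uniq_words n : uniq (words n).
Proof.
elim: n => // n IH; apply: allpairs_uniq => //.
  rewrite /= !inE !negb_or oner_eq0 oppr_eq0 oner_eq0 !andbT.
  by rewrite -subr_eq0 opprK; apply/eqP; lra.
by move=> [x y] [x' y'] _ _ /rcons_inj[-> ->].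
Qed.

Definition cylinder n (x : seq R) : set T := [set w | path n w = x].

Lemma cylinderE n x : size x = n -> cylinder n x =
  [set w | forall i, (1 <= i <= n)%N -> (round_step @^-1` [set nth 0 x i.-1]) (X i w)].
Proof.
move=> xn; apply/seteqP; split => w /=.
  move=> <- i /andP[i0 iN]; rewrite (nth_map 0%N) ?size_iota ?prednK//.
  by rewrite nth_iota ?prednK// add1n prednK.
move=> h; apply: (@eq_from_nth _ 0); first by rewrite size_path xn.
move=> i; rewrite size_path => iN.
rewrite (nth_map 0%N) ?size_iota// nth_iota// add1n.
by have := h i.+1 iN.
Qed.

Let measurable_round v : measurable (round_step @^-1` [set v] : set R).
Proof. by rewrite -[X in measurable X]setTI; exact: measurable_round_step. Qed.

Lemma measurable_cylinder n x : measurable (cylinder n x).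
Proof.
have [xn|xn] := eqVneq (size x) n; last first.
  rewrite (_ : cylinder n x = set0)//; apply/seteqP; split => // w /= E.
  by move: xn; rewrite -E size_path eqxx.
rewrite cylinderE//.
rewrite (_ : [set _ | _] = \bigcap_(i in [set i | (1 <= i <= n)%N])
    (X i @^-1` (round_step @^-1` [set nth 0 x i.-1]))); last by apply/seteqP; split.
apply: bigcap_measurableType => i _.
by rewrite -[X in measurable X]setTI; exact: (measurable_funP (X i)).
Qed.

Lemma path_sum n (G : seq R -> R) w :
  G (path n w) = \sum_(x <- words n) G x * \1_(cylinder n x) w.
Proof.
rewrite (bigD1_seq (path n w)) ?path_in_words ?uniq_words//= indicE mem_set// mulr1.
rewrite big1 ?addr0// => x xn; rewrite indicE memNset ?mulr0//= => E.
by move: xn; rewrite -E eqxx.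
Qed.

Lemma bounded_meas_path n (G : seq R -> R) : bounded_meas (fun w => G (path n w)).
Proof.
under eq_fun do rewrite path_sum.
apply: bounded_meas_sum => x; apply: bounded_measM; first exact: bounded_meas_cst.
by apply: bounded_meas_indic; exact: measurable_cylinder.
Qed.

(** Independence of the past from the remembered time and from the mark, integrated
against any function of the past. *)
Lemma mean_indep n (B : set nat) (C : set R) (G : seq R -> R) : (1 <= n)%N ->
  measurable C ->
  \int[P]_w (\1_(K n @^-1` B) w * \1_(e n @^-1` C) w * G (path n w)) =
  fine (P (K n @^-1` B)) * fine (P (e n @^-1` C)) * \int[P]_w G (path n w).
Proof.
move=> n1 mC; have mB : measurable B by [].
have mKB : measurable (K n @^-1` B).
  by rewrite -[X in measurable X]setTI; exact: (measurable_funP (K n)).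
have meC : measurable (e n @^-1` C).
  by rewrite -[X in measurable X]setTI; exact: (measurable_funP (e n)).
have bc x : bounded_meas (\1_(cylinder n x) : T -> R).
  by apply: bounded_meas_indic; exact: measurable_cylinder.
have mcKe x : measurable (cylinder n x `&` (K n @^-1` B) `&` (e n @^-1` C)).
  by apply: measurableI => //; apply: measurableI => //; exact: measurable_cylinder.
have E w : \1_(K n @^-1` B) w * \1_(e n @^-1` C) w * G (path n w) =
    \sum_(x <- words n) G x * \1_(cylinder n x `&` (K n @^-1` B) `&` (e n @^-1` C)) w.
  rewrite path_sum mulr_sumr; apply: eq_bigr => x _.
  by rewrite !indicI/=; ring.
under eq_Rintegral do rewrite E.
rewrite mean_sum; last first.
  by move=> x; apply: bounded_measM; [exact: bounded_meas_cst|exact: bounded_meas_indic].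
under [X in _ * X]eq_Rintegral do rewrite path_sum.
rewrite mean_sum; last by move=> x; apply: bounded_measM => //; exact: bounded_meas_cst.
rewrite mulr_sumr big_seq [RHS]big_seq; apply: eq_bigr => x xw.
have xn : size x = n.
  elim: {mC mKB meC bc C n1 mcKe E} n x xw => [|n IH] x; first by rewrite inE => /eqP ->.
  by move/allpairsP => [[x' y] [/IH <- _ ->]] /=; rewrite size_rcons.
rewrite !meanZ//; last exact: bounded_meas_indic.
rewrite !mean_indic//; last exact: measurable_cylinder.
rewrite cylinderE// (erws_indep hX n1 (A := fun i => round_step @^-1` [set nth 0 x i.-1]))//.
rewrite !fineM ?fin_numM ?fin_num_measure//; [by ring| |];
  by rewrite -cylinderE//; exact: measurable_cylinder.
Qed.

Let measurable_preim (Y : {RV P >-> R}) v : measurable (Y @^-1` [set v]).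
Proof. by rewrite -[X in measurable X]setTI; exact: (measurable_funP Y). Qed.

Let measurable_preimK n (B : set nat) : measurable (K n @^-1` B).
Proof. by rewrite -[X in measurable X]setTI; exact: (measurable_funP (K n)). Qed.

(** Disjoint events whose probabilities sum to one cover almost everything. *)
Lemma mean1_ae (A : set T) (I : Type) (l : seq I) (f : I -> set T) :
  measurable A -> (forall i, measurable (f i)) ->
  (forall w, \1_A w = \sum_(i <- l) \1_(f i) w :> R) ->
  \sum_(i <- l) fine (P (f i)) = 1 -> {ae P, forall w, A w}.
Proof.
move=> mA mf E h; apply: probability1_ae => //.
have b i : bounded_meas (\1_(f i) : T -> R) by exact: bounded_meas_indic.
rewrite -[LHS]fineK ?fin_num_measure// -mean_indic//.
under eq_Rintegral do rewrite E.
rewrite mean_sum//; congr (_%:E); rewrite -h; apply: eq_bigr => i _.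
exact: mean_indic.
Qed.

Lemma ae_K n : (1 <= n)%N -> {ae P, forall w, (1 <= K n w <= n)%N}.
Proof.
move=> n1; apply: (@mean1_ae _ _ (iota 1 n) (fun k => K n @^-1` [set k])) => //.
- exact: (measurable_preimK n [set k | (1 <= k <= n)%N]).
- move=> w; rewrite indicE; have [Kw|Kw] := boolP (1 <= K n w <= n)%N.
    rewrite mem_set// (bigD1_seq (K n w)) ?iota_uniq ?mem_iota ?add1n ?ltnS//=.
    rewrite indicE mem_set// big1 ?addr0// => k kK.
    by rewrite indicE memNset//= => E; rewrite E eqxx in kK.
  rewrite memNset/=; last exact/negP.
  rewrite big_seq big1// => k; rewrite mem_iota add1n ltnS => kn.
  by rewrite indicE memNset//= => E; rewrite E kn in Kw.
- rewrite big_seq (eq_bigr (fun=> n%:R^-1)); last first.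
    move=> k; rewrite mem_iota add1n ltnS => kn.
    by have /= := erws_choice hX kn; rewrite /preimage/= => ->.
  rewrite -big_seq big_const_seq count_predT size_iota iter_addr_0 -[_ *+ n]mulr_natl.
  by rewrite divff// pnatr_eq0 -lt0n.
Qed.

Let distinct_steps : [/\ (1 == -1 :> R) = false, (1 == 0 :> R) = false & (-1 == 0 :> R) = false].
Proof.
split; first by apply/eqP; lra.
- exact: oner_eq0.
- by rewrite oppr_eq0 oner_eq0.
Qed.

Let indic_eq (Y : T -> R) v w : \1_(Y @^-1` [set v]) w = (Y w == v)%:R :> R.
Proof.
rewrite indicE; have [E|E] := eqVneq (Y w) v; first by rewrite mem_set.
by rewrite memNset//= => E'; rewrite E' eqxx in E.
Qed.

Lemma ae_e n : (1 <= n)%N -> {ae P, forall w, is_step (e n w)}.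
Proof.
move=> n1; have [d1 d2 d3] := distinct_steps.
apply: (@mean1_ae _ _ [:: 1; -1; 0] (fun v => e n @^-1` [set v])) => //.
- rewrite [X in measurable X](_ : _ = (e n @^-1` [set 1]) `|` (e n @^-1` [set -1]) `|` (e n @^-1` [set 0])).
    by apply: measurableU => //; apply: measurableU.
  apply/seteqP; split => w /=; first by move/is_stepP => [] ->; tauto.
  by rewrite /is_step !inE => -[[] ->|->]; rewrite eqxx ?orbT.
- move=> w; rewrite !big_cons big_nil !indic_eq indicE.
  have [h|h] := boolP (is_step (e n w)).
    rewrite mem_set//; move/is_stepP: h => [] ->; rewrite ?eqxx ?d1 ?d2 ?d3 ?(eq_sym 0) ?(eq_sym (-1) 1) ?d1 ?d2 ?d3 /=; ring.
  rewrite memNset; last exact/negP.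
  by move: h; rewrite /is_step !inE !negb_or => /and3P[/negbTE-> /negbTE-> /negbTE->]; rewrite /= !addr0.
- rewrite !big_cons big_nil addr0 addrA.
  have := erws_repeat hX n1; have := erws_reverse hX n1; have := erws_stop hX n1.
  by rewrite /preimage/= => -> -> ->.
Qed.

Lemma ae_X1 : {ae P, forall w, (X 1%N w == 1) || (X 1%N w == -1)}.
Proof.
have [d1 d2 d3] := distinct_steps.
apply: (@mean1_ae _ _ [:: 1; -1] (fun v => X 1%N @^-1` [set v])) => //.
- rewrite [X in measurable X](_ : _ = (X 1%N @^-1` [set 1]) `|` (X 1%N @^-1` [set -1])).
    exact: measurableU.
  apply/seteqP; split => w /=; first by move=> /orP[] /eqP ->; tauto.
  by move=> [] ->; rewrite eqxx ?orbT.
- move=> w; rewrite !big_cons big_nil !indic_eq indicE.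
  have [h|h] := boolP ((X 1%N w == 1) || (X 1%N w == -1)).
    rewrite mem_set//; move/orP: h => [] /eqP ->; rewrite ?eqxx ?d1 ?(eq_sym (-1) 1) ?d1 /=; ring.
  rewrite memNset; last exact/negP.
  by move: h; rewrite negb_or => /andP[/negbTE-> /negbTE->]; rewrite /= !addr0.
- rewrite !big_cons big_nil addr0.
  have := erws_first_up hX; have := erws_first_down hX.
  by rewrite /preimage/= => -> -> /=; ring.
Qed.

Lemma ae_dynamics : {ae P, forall w, ((X 1%N w == 1) || (X 1%N w == -1)) /\
  forall n, [/\ X n.+2 w = e n.+1 w * X (K n.+1 w) w, (1 <= K n.+1 w <= n.+1)%N
    & is_step (e n.+1 w)]}.
Proof.
have h : {ae P, forall w, forall n, [/\ X n.+2 w = e n.+1 w * X (K n.+1 w) w,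
    (1 <= K n.+1 w <= n.+1)%N & is_step (e n.+1 w)]}.
  apply: ae_foralln => n.
  have h1 := erws_step hX (ltn0Sn n).
  have h2 := ae_K (ltn0Sn n).
  have h3 := ae_e (ltn0Sn n).
  by apply: filterS3 h1 h2 h3 => w ? ? ?; split.
by apply: filterS2 ae_X1 h => w ? ?; split.
Qed.

Lemma is_stepM (u v : R) : is_step u -> is_step v -> is_step (u * v).
Proof.
by move=> /is_stepP[] -> vs; rewrite ?mul1r ?mulN1r ?mul0r ?is_stepN ?is_step0.
Qed.

Lemma ae_is_step : {ae P, forall w, forall n, (1 <= n)%N -> is_step (X n w)}.
Proof.
apply: filterS ae_dynamics => w [h1 h2] n; elim: n {-2}n (leqnn n) => [|m IH] n.
  by rewrite leqn0 => /eqP ->.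
case: n => // -[_ _|n nm _].
  by move: h1; rewrite /is_step !inE => /orP[] ->; rewrite ?orbT.
have [-> /andP[k1 k2] es] := h2 n; apply: is_stepM => //.
by apply: IH => //; apply: leq_trans k2 _.
Qed.

Lemma ae_path_step n : (1 <= n)%N -> {ae P, forall w,
  round_step (X n.+1 w) = e n w * nth 0 (path n w) (K n w).-1}.
Proof.
move=> n1; apply: filterS2 ae_dynamics ae_is_step => w [_ h2] h3.
case: n n1 => // n _; have [h4 /andP[k1 k2] _] := h2 n.
rewrite (nth_map 0%N) ?size_iota ?prednK// nth_iota ?prednK// add1n prednK//.
by rewrite !round_step_id ?h3.
Qed.

Lemma mean_path_step n (F : seq R -> R) :
  \int[P]_w F (path n.+1 w) =
  \int[P]_w avg p q r s (path n w) (fun y => F (rcons (path n w) y)).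
Proof.
have [d1 d2 d3] := distinct_steps.
have bi (Y : {RV P >-> R}) v : bounded_meas (\1_(Y @^-1` [set v]) : T -> R).
  exact: bounded_meas_indic.
have bK n0 k : bounded_meas (\1_(K n0 @^-1` [set k]) : T -> R) by exact: bounded_meas_indic.
case: n => [|n].
  rewrite (@ae_eq_mean _ _ _ P _ (fun w => \sum_(v <- [:: 1; -1]) F [:: v] * \1_(X 1%N @^-1` [set v]) w)).
  - rewrite mean_sum; last by move=> v; apply: bounded_measM => //; exact: bounded_meas_cst.
    have -> : \int[P]_w avg p q r s (path 0 w) (fun y => F (rcons (path 0 w) y)) =
      \int[P]_w (s * F [:: 1] + (1 - s) * F [:: -1]) by [].
    rewrite Rintegral_cst//= probability_setT mulr1 !big_cons big_nil addr0 !meanZ// !mean_indic//.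
    have := erws_first_up hX; have := erws_first_down hX.
    by rewrite /preimage/= => -> -> /=; ring.
  - exact: bounded_meas_path.
  - by apply: bounded_meas_sum => v; apply: bounded_measM => //; exact: bounded_meas_cst.
  - apply: filterS ae_X1 => w h; rewrite !big_cons big_nil addr0 !indic_eq /path/=.
    rewrite /round_step; move: h => /orP[] /eqP ->; rewrite ?eqxx ?d1 ?(eq_sym (-1) 1) ?d1 /=; ring.
pose Fk k v x := F (rcons x (v * nth 0 x k.-1)).
pose W v : R := fine (P (e n.+1 @^-1` [set v])).
have We : W 1 = p /\ W (-1) = q /\ W 0 = r.
  have := erws_repeat hX (ltn0Sn n); have := erws_reverse hX (ltn0Sn n); have := erws_stop hX (ltn0Sn n).
  by rewrite /W /preimage/= => -> -> ->.
have bFk k v : bounded_meas (fun w => \1_(K n.+1 @^-1` [set k]) w *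
    \1_(e n.+1 @^-1` [set v]) w * Fk k v (path n.+1 w)).
  by apply: bounded_measM; [exact: bounded_measM|exact: bounded_meas_path].
rewrite (@ae_eq_mean _ _ _ P _ (fun w => \sum_(k <- iota 1 n.+1) \sum_(v <- [:: 1; -1; 0])
   \1_(K n.+1 @^-1` [set k]) w * \1_(e n.+1 @^-1` [set v]) w * Fk k v (path n.+1 w))).
- rewrite mean_sum; last by move=> k; exact: bounded_meas_sum.
  have -> : \int[P]_w avg p q r s (path n.+1 w) (fun y => F (rcons (path n.+1 w) y)) =
     \sum_(k <- iota 1 n.+1) \sum_(v <- [:: 1; -1; 0])
       n.+1%:R^-1 * W v * \int[P]_w Fk k v (path n.+1 w).
    have E w : avg p q r s (path n.+1 w) (fun y => F (rcons (path n.+1 w) y)) =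
        \sum_(k <- iota 1 n.+1) \sum_(v <- [:: 1; -1; 0]) n.+1%:R^-1 * W v * Fk k v (path n.+1 w).
      have sz := size_path n.+1 w; rewrite /avg; case E : (path n.+1 w) sz => [//|y x] <-.
      rewrite -E mulr_sumr (big_nth 0) size_path.
      have -> : iota 1 n.+1 = [seq k.+1 | k <- iota 0 n.+1] by rewrite -[1%N]addn0 iotaDl.
      rewrite big_map; apply: eq_bigr => k _.
      rewrite !big_cons big_nil addr0 We.1 We.2.1 We.2.2 /Fk/= mul1r mulN1r mul0r.
      by ring.
    under eq_Rintegral do rewrite E.
    have bW k v : bounded_meas (fun w => n.+1%:R^-1 * W v * Fk k v (path n.+1 w)).
      by apply: bounded_measM; [exact: bounded_meas_cst|exact: bounded_meas_path].
    rewrite mean_sum; last by move=> k; exact: bounded_meas_sum.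
    apply: eq_bigr => k _; rewrite mean_sum//; apply: eq_bigr => v _.
    by rewrite meanZ//; exact: bounded_meas_path.
  rewrite big_seq [RHS]big_seq; apply: eq_bigr => k; rewrite mem_iota add1n ltnS => kn.
  rewrite mean_sum//; apply: eq_bigr => v _.
  rewrite mean_indep//; congr (_ * _ * _).
  by have /= := erws_choice hX kn; rewrite /preimage/= => ->.
- exact: bounded_meas_path.
- by apply: bounded_meas_sum => k; exact: bounded_meas_sum.
- have h := ae_path_step (ltn0Sn n).
  apply: filterS3 h (ae_K (ltn0Sn n)) (ae_e (ltn0Sn n)) => w h1 h2 h3.
  rewrite (bigD1_seq (K n.+1 w)) ?iota_uniq ?mem_iota ?add1n ?ltnS//=.
  rewrite [X in _ = _ + X]big1 ?addr0; last first.
    move=> k kK; rewrite big1// => v _.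
    by rewrite indicE memNset ?mul0r//= => E; rewrite E eqxx in kK.
  have es : e n.+1 w \in [:: 1; -1; 0] by [].
  have us : uniq [:: 1; -1; 0 : R].
    by rewrite /= !inE !negb_or d1 d2 d3.
  rewrite (bigD1_seq (e n.+1 w))//= big1 ?addr0; last first.
    by move=> v ve; rewrite indic_eq eq_sym (negbTE ve) mulr0 mul0r.
  rewrite indic_eq eqxx indicE mem_set// !mul1r /Fk path_rcons.
  by rewrite h1.
Qed.

Lemma mean_path n (F : seq R -> R) : \int[P]_w F (path n w) = Ex p q r s n F.
Proof.
elim: n F => [|n IH] F; last first.
  by rewrite mean_path_step (IH (fun x => avg p q r s x (fun y => F (rcons x y)))).
by rewrite /path/= Rintegral_cst//= probability_setT mulr1.
Qed.

Lemma ae_position_path : {ae P, forall w, forall n,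
  position X n w = endpoint (path n w) /\ ones X n w = weight (path n w)}.
Proof.
apply: filterS ae_is_step => w h n; rewrite /position /ones /endpoint /weight /path !big_map.
rewrite /index_iota subn1; split; rewrite big_seq [RHS]big_seq; apply: eq_bigr => k;
  by rewrite mem_iota add1n => /andP[k1 _]; rewrite round_step_id// h.
Qed.

End walk_path.

(** * Mean square limits and their moments *)

Section mean_square_limit.
Context {R : realType} d {T : measurableType d} (P : probability T R).

(** Fatou's lemma along an almost sure limit. *)
Lemma fatou_bound (f : nat -> T -> R) (g : T -> R) (c : \bar R) :
  (forall j, measurable_fun setT (f j)) -> (forall j w, 0 <= f j w) ->
  measurable_fun setT g -> (forall w, 0 <= g w) ->
  {ae P, forall w, f j w @[j --> \oo] --> g w} ->
  (forall j, (\int[P]_w (f j w)%:E <= c)%E) -> (\int[P]_w (g w)%:E <= c)%E.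
Proof.
move=> mf f0 mg g0 [B [mB B0 hB]] hc.
pose f' j w := (f j w * \1_(~` B) w)%:E; pose g' w := (g w * \1_(~` B) w)%:E.
have mI : measurable_fun setT (\1_(~` B) : T -> R) by apply: measurable_indic; exact: measurableC.
have I0 w : 0 <= \1_(~` B) w :> R by rewrite indicE.
have cv w : f' j w @[j --> \oo] --> g' w.
  apply: cvg_EFin; first exact: nearW.
  have [Bw|Bw] := pselect (B w).
    rewrite /g' indicE memNset ?mulr0//=.
    rewrite [X in X @ _ --> _](_ : _ = cst 0); first exact: cvg_cst.
    by apply/funext => j; rewrite /f'/= indicE memNset//= mulr0.
  apply: cvgM; last exact: cvg_cst.
  by apply: contrapT => h; apply: Bw; apply: hB => /= h'; exact: h.
have -> : (\int[P]_w (g w)%:E)%E = (\int[P]_w g' w)%E.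
  apply: ge0_ae_eq_integral => //.
  - exact/measurable_EFinP.
  - by apply/measurable_EFinP; exact: measurable_funM.
  - by move=> w _; rewrite lee_fin.
  - by move=> w _; rewrite lee_fin mulr_ge0.
  - exists B; split => // w /= h; apply: contrapT => Bw; apply: h => _.
    by rewrite /g' indicE mem_set// mulr1.
have -> : (\int[P]_w g' w)%E = (\int[P]_w limn_einf (f'^~ w))%E.
  apply: eq_integral => w _; rewrite is_cvg_limn_einfE; last by apply/cvg_ex; exists (g' w).
  by apply/esym/cvg_lim => //; exact: cv.
apply: (@le_trans _ _ (limn_einf (fun n => \int[P]_w f' n w)%E)).
  apply: fatou => //.
    by move=> j; apply/measurable_EFinP; exact: measurable_funM.
  by move=> j w _; rewrite lee_fin mulr_ge0.
rewrite limn_einf_lim; apply: lime_le; first exact: is_cvg_einfs.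
apply: nearW => j; apply: (@le_trans _ _ (\int[P]_w f' j w)%E).
  by apply: ereal_inf_lbound; exists j => //=.
apply: le_trans (hc j); apply: ge0_le_integral => //.
- by move=> w _; rewrite lee_fin mulr_ge0.
- by apply/measurable_EFinP; exact: measurable_funM.
- exact/measurable_EFinP.
- by move=> w _; rewrite lee_fin ler_piMr// indicE; case: (_ \in _).
Qed.

(** Completeness of L2, with an almost sure subsequence: along [nn] the mean increments
are summable, so almost every path converges.  The limit is an upper limit cut at
zero, which makes it measurable and nonnegative everywhere. *)
Lemma mean_square_limit (Y : nat -> T -> R) :
  (forall n, bounded_meas (Y n)) -> (forall n w, 0 <= Y n w) ->
  (forall eps, 0 < eps -> exists n0, forall n N, (n0 <= n)%N -> (n <= N)%N ->
     \int[P]_w (Y N w - Y n w) ^+ 2 <= eps) ->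
  exists (Z : {RV P >-> R}) (nn : nat -> nat),
  [/\ forall w, 0 <= Z w, {homo nn : i j / (i <= j)%N}, forall j, (j <= nn j)%N
    & {ae P, forall w, Y (nn j) w @[j --> \oo] --> Z w}].
Proof.
move=> bY Y0 hY.
have bYB n m : bounded_meas (fun w => Y n w - Y m w) by exact: bounded_measB.
have bYB2 n m : bounded_meas (fun w => (Y n w - Y m w) ^+ 2).
  by under eq_fun do rewrite expr2; exact: bounded_measM.
have h2 j : 0 < (2 ^- j) ^+ 2 :> R by rewrite exprn_gt0// invr_gt0 exprn_gt0.
have /choice[n0 hn0] : forall j : nat, exists n0, forall n N, (n0 <= n)%N -> (n <= N)%N ->
    \int[P]_w (Y N w - Y n w) ^+ 2 <= (2 ^- j) ^+ 2 by move=> j; exact: hY.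
pose nn := fix nn j := if j is i.+1 then maxn (maxn (nn i) (n0 j)) j else n0 0%N.
have nnS j : (nn j <= nn j.+1)%N by rewrite /= !leq_max leqnn.
have nnn0 j : (n0 j <= nn j)%N by case: j => [|j] //=; rewrite !leq_max leqnn orbT.
have nnj j : (j <= nn j)%N by case: j => [|j] //=; rewrite !leq_max leqnn orbT.
have nnh : {homo nn : i j / (i <= j)%N} by apply: homo_leq => // ? ? ?; exact: leq_trans.
pose D j w : R := `|Y (nn j.+1) w - Y (nn j) w|.
have mD j : measurable_fun setT (D j).
  by apply: measurableT_comp => //; exact: (bYB _ _).1.
have iD j : (\int[P]_w (D j w)%:E <= (2 ^- j)%:E)%E.
  have t0 : 0 < 2 ^- j :> R by rewrite invr_gt0 exprn_gt0.
  apply: (@le_trans _ _ (\int[P]_w ((2 ^- j)^-1 / 2 * (Y (nn j.+1) w - Y (nn j) w) ^+ 2 + 2 ^- j / 2)%:E)%E).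
    apply: ge0_le_integral => //.
    - by move=> w _; rewrite lee_fin /D.
    - exact/measurable_EFinP.
    - apply/measurable_EFinP; apply: measurable_funD => //.
      by apply: measurable_funM => //; exact: (bYB2 _ _).1.
    - move=> w _; rewrite lee_fin /D; set u := Y _ w - _; set t := 2 ^- j in t0 *.
      rewrite -(ler_pM2l t0) -(real_normK (num_real u)).
      rewrite [leRHS](_ : _ = (`|u| ^+ 2 + t ^+ 2) / 2); last by field; rewrite gt_eqF.
      by have := sqr_ge0 (t - `|u|); lra.
  rewrite -[X in (X <= _)%E]fineK; last first.
    apply: integrable_fin_num => //; apply: bounded_meas_integrable.
    apply: bounded_measD; last exact: bounded_meas_cst.
    by apply: bounded_measM => //; exact: bounded_meas_cst.
  rewrite lee_fin -/(Rintegral _ _ _) RintegralD//; last 2 first.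
  - by apply: bounded_meas_integrable; apply: bounded_measM => //; exact: bounded_meas_cst.
  - by apply: bounded_meas_integrable; exact: bounded_meas_cst.
  rewrite meanZ// Rintegral_cst//= probability_setT mulr1.
  have := hn0 j _ _ (nnn0 j) (nnS j); set I := \int[P]_w _; set t := 2 ^- j in t0 *.
  move=> h; have : t^-1 / 2 * I <= t^-1 / 2 * t ^+ 2.
    by rewrite ler_wpM2l// divr_ge0// invr_ge0 ltW.
  rewrite (_ : t^-1 / 2 * t ^+ 2 = t / 2); last by field; rewrite gt_eqF.
  by rewrite /=; lra.
have cvD : {ae P, forall w, cvgn (fun j => Y (nn j) w)}.
  pose S w := (\big[+%E/0%E]_(0 <= j <oo) (D j w)%:E)%E.
  have D0 j w : (0 <= (D j w)%:E)%E by rewrite lee_fin /D.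
  have iS : (\int[P]_w S w <= 2%:E)%E.
    rewrite /S integral_nneseries//; last by move=> j; exact/measurable_EFinP.
    apply: (@le_trans _ _ (\big[+%E/0%E]_(0 <= j <oo) (2 ^- j)%:E)%E).
      by apply: lee_nneseries => // j _ _; exact: integral_ge0.
    have := @cvg_geometric_eseries_half R 2 0.
    rewrite expr0 divr1 => h; rewrite le_eqVlt; apply/orP; left; apply/eqP.
    apply/cvg_lim => //; apply: cvg_trans h; apply: near_eq_cvg; apply: nearW => n.
    apply: eq_bigr => j _; congr (_%:E); rewrite /= addn1 natrX exprS invfM mulrA.
    by rewrite divff// mul1r.
  have mS : measurable_fun setT S.
    by apply: ge0_emeasurable_sum => // j _; exact/measurable_EFinP.
  have S0 w : (0 <= S w)%E by apply: nneseries_ge0.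
  have intS : P.-integrable setT S.
    apply/integrableP; split => //.
    by under eq_integral do rewrite gee0_abs//; apply: le_lt_trans iS _; rewrite ltry.
  have := integrable_ae measurableT intS; apply: filterS => w /(_ I) Sfin.
  have csum : cvgn (series (fun j => D j w)).
    apply: nondecreasing_is_cvgn.
      by apply/nondecreasing_seqP => j; rewrite /series/= big_nat_recr//= lerDl /D.
    exists (fine (S w)) => _ [j _ <-]; rewrite -lee_fin fineK// /series/= -sumEFin.
    by apply: nneseries_lim_ge.
  have := @normed_cvg R R^o (fun j => Y (nn j.+1) w - Y (nn j) w) csum.
  move=> /cvg_ex[l hl]; apply/cvg_ex; exists (l + Y (nn 0%N) w).
  have E j : Y (nn j) w = series (fun j => Y (nn j.+1) w - Y (nn j) w) j + Y (nn 0%N) w.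
    by rewrite /series/= telescope_sumr// subrK.
  under eq_fun do rewrite E.
  by apply: cvgD => //; exact: cvg_cst.
pose Zf w := Num.max 0 (fine (limn_esup (fun j => (Y (nn j) w)%:E))).
have mZ : measurable_fun setT Zf.
  apply: measurable_maxr => //; apply: measurableT_comp; first exact: fine_measurable.
  by apply: measurable_fun_limn_esup => j; apply/measurable_EFinP; exact: (bY _).1.
have [Z ZE] : exists Z : {RV P >-> R}, forall w, Z w = Zf w.
  pose ZZ := @isMeasurableFun.Build _ _ _ _ Zf mZ.
  exists (HB.pack_for {RV P >-> R} Zf ZZ) => w; by [].
exists Z, nn; split => //; first by move=> w; rewrite ZE le_max lexx.
apply: filterS cvD => w /cvg_ex[l hl].
have l0 : 0 <= l.
  rewrite -(cvg_lim (@Rhausdorff R) hl); apply: limr_ge; last exact: nearW.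
  by apply/cvg_ex; exists l.
rewrite ZE /Zf is_cvg_limn_esupE; last first.
  by apply/cvg_ex; exists l%:E; apply: cvg_EFin; [exact: nearW|].
suff -> : limn (fun j => (Y (nn j) w)%:E) = l%:E by rewrite /= (max_idPr l0).
by apply/cvg_lim => //; apply: cvg_EFin; [exact: nearW|].
Qed.

Lemma exprn_diff_le (x y : R) m : 0 <= x -> 0 <= y ->
  `|x ^+ m.+1 - y ^+ m.+1| <= m.+1%:R * `|x - y| * (x + y) ^+ m.
Proof.
move=> x0 y0; elim: m => [|m IH]; first by rewrite !expr1 expr0 mul1r mulr1.
rewrite [x ^+ _]exprS [y ^+ _]exprS.
have -> : x * x ^+ m.+1 - y * y ^+ m.+1 =
  x * (x ^+ m.+1 - y ^+ m.+1) + (x - y) * y ^+ m.+1 by ring.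
apply: le_trans (ler_normD _ _) _; rewrite !normrM.
rewrite -[m.+2%:R]natr1 mulrDl mul1r mulrDl; apply: lerD.
  rewrite (ger0_norm x0) mulrC [leRHS](_ : _ = m.+1%:R * `|x - y| * (x + y) ^+ m * (x + y)).
    by apply: ler_pM => //; rewrite lerDl.
  by rewrite exprSr; ring.
rewrite ler_wpM2l// ger0_norm ?exprn_ge0//.
by rewrite lerXn2r ?nnegrE ?addr_ge0// lerDr.
Qed.

Lemma exprn_add_le (x y : R) m : 0 <= x -> 0 <= y ->
  (x + y) ^+ m <= 2 ^+ m * (x ^+ m + y ^+ m).
Proof.
move=> x0 y0; wlog xy : x y x0 y0 / x <= y.
  by move=> h; case/orP: (le_total x y) => xy; [|rewrite addrC (addrC (x ^+ m))]; exact: h.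
apply: (@le_trans _ _ ((2 * y) ^+ m)).
  by rewrite lerXn2r ?nnegrE ?addr_ge0 ?mulr_ge0//; lra.
by rewrite exprMn ler_wpM2l ?exprn_ge0// lerDr exprn_ge0.
Qed.

Section moments.
Context (Y : nat -> T -> R) (Z : {RV P >-> R}) (nn : nat -> nat) (mom : nat -> R).
Context (bY : forall n, bounded_meas (Y n)) (Y0 : forall n w, 0 <= Y n w)
  (hY : forall eps, 0 < eps -> exists n0, forall n N, (n0 <= n)%N -> (n <= N)%N ->
     \int[P]_w (Y N w - Y n w) ^+ 2 <= eps)
  (Z0 : forall w, 0 <= Z w) (nnj : forall j, (j <= nn j)%N)
  (cZ : {ae P, forall w, Y (nn j) w @[j --> \oo] --> Z w})
  (hmom : forall m, \int[P]_w (Y n w ^+ m) @[n --> \oo] --> mom m).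

Let mZ : measurable_fun setT Z. Proof. exact: measurable_funP. Qed.

Let bYX n m : bounded_meas (fun w => Y n w ^+ m).
Proof.
elim: m => [|m IH]; first by under eq_fun do rewrite expr0; exact: bounded_meas_cst.
by under eq_fun do rewrite exprS; exact: bounded_measM.
Qed.

Let intE f : bounded_meas f -> (\int[P]_w (f w)%:E)%E = (\int[P]_w f w)%:E.
Proof.
move=> bf; rewrite /Rintegral fineK//.
by apply: integrable_fin_num => //; exact: bounded_meas_integrable.
Qed.

Lemma mean_square_cvg eps : 0 < eps -> exists n0, forall n, (n0 <= n)%N ->
  (\int[P]_w ((Y n w - Z w) ^+ 2)%:E <= eps%:E)%E.
Proof.
move=> eps0; have [n0 h] := hY eps0; exists n0 => n nn0.
apply: (@fatou_bound (fun j w => (Y n w - Y (nn (j + n)%N) w) ^+ 2)) => //.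
- move=> j; apply: measurable_funX; apply: measurable_funB; exact: (bY _).1.
- by move=> j w; exact: sqr_ge0.
- by apply: measurable_funX; apply: measurable_funB => //; exact: (bY _).1.
- by move=> w; exact: sqr_ge0.
- apply: filterS cZ => w cw; have cw' : Y (nn (j + n)%N) w @[j --> \oo] --> Z w.
    by rewrite (cvg_shiftn n (fun j => Y (nn j) w)).
  under eq_fun do rewrite expr2; rewrite expr2.
  by apply: cvgM; apply: cvgB => //; exact: cvg_cst.
- move=> j; rewrite intE; last first.
    under eq_fun do rewrite expr2.
    have b : bounded_meas (fun w => Y n w - Y (nn (j + n)%N) w) by exact: bounded_measB.
    exact: bounded_measM.
  rewrite lee_fin; have njn : (n <= nn (j + n))%N by apply: leq_trans (nnj _); rewrite leq_addl.
  have := h n _ nn0 njn; congr (_ <= _); apply: eq_Rintegral => w _.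
  by rewrite -sqrrN opprB.
Qed.

Let mom_bound m : exists2 M : R, 0 <= M & forall n, \int[P]_w (Y n w ^+ m) <= M.
Proof.
have /cvg_seq_bounded[M [Mr hM]] : cvgn (fun n => \int[P]_w (Y n w ^+ m)).
  by apply/cvg_ex; exists (mom m); exact: (@hmom m).
exists (Num.max 0 (M + 1)); first by rewrite le_max lexx.
move=> n; apply: le_trans (ler_norm _) _; apply: hM => //.
by rewrite lt_max ltrDl ltr01 orbT.
Qed.

Let mom_limit m M : (forall n, \int[P]_w (Y n w ^+ m) <= M) ->
  (\int[P]_w (Z w ^+ m)%:E <= M%:E)%E.
Proof.
move=> hM; apply: (@fatou_bound (fun j w => Y (nn j) w ^+ m)) => //.
- by move=> j; exact: (bYX _ _).1.
- by move=> j w; exact: exprn_ge0.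
- exact: measurable_funX.
- by move=> w; exact: exprn_ge0.
- apply: filterS cZ => w cw; apply: (cvg_comp _ (fun x : R => x ^+ m)); first exact: cw.
  exact: exprn_continuous.
- by move=> j; rewrite intE// lee_fin.
Qed.

Lemma limit_moment_integrable m : P.-integrable setT (fun w => (Z w ^+ m)%:E).
Proof.
have [M M0 hM] := mom_bound m; apply/integrableP; split.
  by apply/measurable_EFinP; exact: measurable_funX.
under eq_integral do rewrite gee0_abs ?lee_fin ?exprn_ge0//.
by apply: le_lt_trans (mom_limit hM) _; rewrite ltry.
Qed.

(** [x ^+ m.+1] is Lipschitz up to a factor of degree [m], and the moments of order
[2 * m] are bounded: convergence in mean square passes to all moments. *)
Lemma limit_moment m : \int[P]_w (Z w ^+ m) = mom m.
Proof.
have fP : ProperFilter (nbhs \oo : set_system nat) by exact: _.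
suff : \int[P]_w (Y n w ^+ m) @[n --> \oo] --> \int[P]_w (Z w ^+ m).
  by move=> h; rewrite -(cvg_lim (@Rhausdorff R) h); apply: cvg_lim; [exact: Rhausdorff|exact: (@hmom m)].
case: m => [|m].
  have E (f : T -> R) : \int[P]_w (f w ^+ 0) = \int[P]_w 1.
    by apply: eq_Rintegral => w _; rewrite expr0.
  by under eq_fun do rewrite E; rewrite E; exact: cvg_cst.
have [M M0 hM] := mom_bound (2 * m).
have hZ := mom_limit hM; have iZ := limit_moment_integrable (2 * m).
have hZ' : \int[P]_w (Z w ^+ (2 * m)) <= M.
  by rewrite -lee_fin /Rintegral fineK//; exact: integrable_fin_num.
pose A := 2 ^+ (2 * m) * (M + M); have A0 : 0 <= A by rewrite mulr_ge0 ?exprn_ge0 ?addr_ge0.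
apply/cvgrPdist_le => eps eps0.
(* Weight of the square in the inequality between arithmetic and geometric means;
   a large [lam] makes the moment part small. *)
pose lam := m.+1%:R * A / eps + 1.
have lam0 : 0 < lam by rewrite /lam ltr_wpDl// divr_ge0// ?(ltW eps0)//; apply: mulr_ge0.
have e20 : 0 < eps / (m.+1%:R * lam) by rewrite divr_gt0// mulr_gt0// ltr0n.
have [n0 hn0] := mean_square_cvg e20.
exists n0 => // n /= nn0; have hn := hn0 n nn0.
have iD : P.-integrable setT (fun w => ((Y n w - Z w) ^+ 2)%:E).
  apply/integrableP; split.
    by apply/measurable_EFinP/measurable_funX/measurable_funB => //; exact: (bY _).1.
  under eq_integral do rewrite gee0_abs ?lee_fin ?sqr_ge0//.
  by apply: le_lt_trans hn _; rewrite ltry.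
have hn' : \int[P]_w ((Y n w - Z w) ^+ 2) <= eps / (m.+1%:R * lam).
  by rewrite -lee_fin /Rintegral fineK//; exact: integrable_fin_num.
have iY k : P.-integrable setT (fun w => (Y n w ^+ k)%:E) by exact: bounded_meas_integrable.
have iYZ : P.-integrable setT (fun w => (Y n w ^+ (2 * m) + Z w ^+ (2 * m))%:E).
  exact: integrable_EFinD.
have iS := limit_moment_integrable m.+1.
rewrite -RintegralB//; last exact: iY.
apply: le_trans (le_normr_Rintegral _ _) _ => //; first exact: integrable_EFinB.
pose c1 := m.+1%:R * lam / 2; pose c2 := m.+1%:R / (2 * lam) * 2 ^+ (2 * m).
have i1 : P.-integrable setT (fun w => (c1 * (Y n w - Z w) ^+ 2)%:E) by exact: integrable_EFinZ.
have i2 : P.-integrable setT (fun w => (c2 * (Y n w ^+ (2 * m) + Z w ^+ (2 * m)))%:E).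
  exact: integrable_EFinZ.
apply: (@le_trans _ _ (\int[P]_w (c1 * (Y n w - Z w) ^+ 2 + c2 * (Y n w ^+ (2 * m) + Z w ^+ (2 * m))))).
  apply: le_Rintegral => //.
  - have := integrable_abse (integrable_EFinB measurableT iS (iY m.+1)).
    by congr (integrable _ _ _).
  - exact: integrable_EFinD.
  - move=> w _; rewrite distrC.
    apply: le_trans (exprn_diff_le _ (Y0 n w) (Z0 w)) _.
    apply: (@le_trans _ _ (c1 * (Y n w - Z w) ^+ 2 + m.+1%:R / (2 * lam) * (Y n w + Z w) ^+ (2 * m))).
      rewrite mulnC exprM -(real_normK (num_real (Y n w - Z w))) /c1.
      set u := `|_|; set v := _ ^+ m; rewrite -subr_ge0.
      rewrite [X in 0 <= X](_ : _ = m.+1%:R / (2 * lam) * (lam * u - v) ^+ 2).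
        by rewrite mulr_ge0 ?sqr_ge0// divr_ge0// mulr_ge0// ltW.
      by field; rewrite gt_eqF.
    rewrite lerD2l /c2 -(mulrA (_ / _)) ler_wpM2l//; first by rewrite divr_ge0// mulr_ge0// ltW.
    exact: exprn_add_le.
rewrite (RintegralD measurableT i1 i2) (RintegralZl _ measurableT iD) (RintegralZl _ measurableT iYZ).
rewrite (RintegralD measurableT (iY _) iZ).
have k1 : c1 * (\int[P]_w (Y n w - Z w) ^+ 2) <= eps / 2.
  apply: le_trans (ler_wpM2l _ hn') _; first by rewrite /c1 !mulr_ge0// ltW.
  rewrite le_eqVlt; apply/orP; left; apply/eqP; rewrite /c1; field.
  by rewrite gt_eqF//= pnatr_eq0.
have k2 : c2 * (\int[P]_w (Y n w ^+ (2 * m)) + \int[P]_w (Z w ^+ (2 * m))) <= eps / 2.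
  have c20 : 0 <= c2 by rewrite /c2 mulr_ge0 ?exprn_ge0// divr_ge0// mulr_ge0// ltW.
  apply: (@le_trans _ _ (c2 * (M + M))).
    by rewrite ler_wpM2l// lerD.
  rewrite [leLHS](_ : _ = m.+1%:R * A / lam / 2); last by rewrite /c2 /A; field; rewrite gt_eqF.
  rewrite ler_wpM2r// ler_pdivrMr// /lam mulrDr mulr1 [eps * _]mulrC divfK ?gt_eqF// lerDl ltW//.
by lra.
Qed.

(** The partial sums of the exponential series are dominated by [expR (`|t| * Z)], whose
mean is at most [C] by Fatou's lemma. *)
Lemma mgf_of_moments (t C : R) :
  (forall N, \sum_(0 <= m < N) `|t| ^+ m * mom m / m`!%:R <= C) ->
  (\sum_(0 <= m < N) t ^+ m * mom m / m`!%:R)%:E @[N --> \oo] --> ('M_P Z t)%E.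
Proof.
move=> hC.
pose ps (u : R) N w := \sum_(0 <= m < N) (u * Z w) ^+ m / m`!%:R.
have psE u N w : ps u N w = series (exp_coeff (u * Z w)) N by [].
have ips u N : P.-integrable setT (fun w => (ps u N w)%:E).
  elim: N => [|N IH].
    rewrite (_ : (fun w => (ps u 0%N w)%:E) = (EFin \o cst 0)).
      exact: (bounded_meas_integrable _ (bounded_meas_cst 0)).
    by apply/funext => w; rewrite /ps big_geq.
  rewrite (_ : (fun w => (ps u N.+1 w)%:E) = fun w => (ps u N w + (u * Z w) ^+ N / N`!%:R)%:E); last first.
    by apply/funext => w; rewrite /ps big_nat_recr.
  apply: integrable_EFinD => //.
  have := integrable_EFinZ (u ^+ N / N`!%:R) measurableT (limit_moment_integrable N).
  by congr (integrable _ _ _); apply/funext => w; rewrite exprMn; congr (_%:E); ring.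
have Eps u N : \int[P]_w ps u N w = \sum_(0 <= m < N) u ^+ m * mom m / m`!%:R.
  elim: N => [|N IH].
    rewrite big_geq//; have -> : \int[P]_w ps u 0 w = \int[P]_w 0 by apply: eq_Rintegral => w _; rewrite /ps big_geq.
    by rewrite Rintegral_cst//= mul0r.
  have i1 : P.-integrable setT (fun w => ((u * Z w) ^+ N / N`!%:R)%:E).
    have := integrable_EFinZ (u ^+ N / N`!%:R) measurableT (limit_moment_integrable N).
    by congr (integrable _ _ _); apply/funext => w; rewrite exprMn; congr (_%:E); ring.
  rewrite big_nat_recr//= -IH.
  have -> : \int[P]_w ps u N.+1 w = \int[P]_w (ps u N w + (u * Z w) ^+ N / N`!%:R).
    by apply: eq_Rintegral => w _; rewrite /ps big_nat_recr.
  rewrite (RintegralD measurableT (ips u N) i1); congr (_ + _).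
  rewrite -limit_moment mulrAC -RintegralZl//; last exact: limit_moment_integrable.
  by apply: eq_Rintegral => w _; rewrite exprMn; ring.
have mps u N : measurable_fun setT (ps u N).
  by have /integrableP[/measurable_EFinP] := ips u N.
have cvps u w : ps u N w @[N --> \oo] --> expR (u * Z w).
  exact: is_cvg_series_exp_coeff.
have tZ0 w : 0 <= `|t| * Z w by rewrite mulr_ge0.
have mexp u : measurable_fun setT (fun w => expR (u * Z w)).
  by apply: measurableT_comp => //; exact: measurable_funM.
have iexp : P.-integrable setT (fun w => (expR (`|t| * Z w))%:E).
  apply/integrableP; split; first exact/measurable_EFinP.
  under eq_integral do rewrite gee0_abs ?lee_fin ?expR_ge0//.
  apply: (@le_lt_trans _ _ C%:E); last by rewrite ltry.
  apply: (@fatou_bound (ps `|t|)) => //.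
  - by move=> N w; rewrite sumr_ge0// => m _; rewrite divr_ge0// exprn_ge0.
  - by apply: nearW => w; exact: cvps.
  - move=> N; rewrite -[leLHS]fineK; last exact: integrable_fin_num.
    by rewrite lee_fin -/(Rintegral _ _ _) Eps hC.
have ps_le N w : `|ps t N w| <= expR (`|t| * Z w).
  apply: (@le_trans _ _ (ps `|t| N w)).
    apply: le_trans (ler_norm_sum _ _ _) _; apply: ler_sum => m _.
    by rewrite normrM normrX normrM (ger0_norm (Z0 w)) normfV (ger0_norm (ler0n _ _)).
  rewrite psE; apply: nondecreasing_cvgn_le; last exact: is_cvg_series_exp_coeff.
  apply/nondecreasing_seqP => j; rewrite /series/= big_nat_recr//= lerDl.
  by rewrite divr_ge0// exprn_ge0.
have dom : (\int[P]_w (ps t N w)%:E)%E @[N --> \oo] --> (\int[P]_w (expR (t * Z w))%:E)%E.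
  apply: (@dominated_cvg _ _ _ P setT measurableT (fun N w => (ps t N w)%:E) _
    (fun w => (expR (`|t| * Z w))%:E)) => //.
  - by move=> N; exact/measurable_EFinP.
  - by move=> w _; apply: cvg_EFin; [exact: nearW|exact: cvps].
  - by move=> N w _; rewrite /= lee_fin.
rewrite /mmt_gen_fun.
have -> : ('E_P[expR \o t \o* Z] = \int[P]_w (expR (t * Z w))%:E)%E.
  by rewrite unlock; apply: eq_integral => w _ /=; rewrite mulrC.
apply: cvg_trans dom; apply: near_eq_cvg; apply: nearW => N /=.
rewrite -Eps /Rintegral fineK//; exact: integrable_fin_num.
Qed.

End moments.

End mean_square_limit.

(** * Convergence in law by test functions *)

Section bounded_convergence.
Context {R : realType} d {T : measurableType d} (P : probability T R).

Lemma bounded_convergence (f : nat -> T -> R) (g : T -> R) M :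
  (forall n, measurable_fun setT (f n)) -> measurable_fun setT g ->
  (forall n w, `|f n w| <= M) -> {ae P, forall w, f n w @[n --> \oo] --> g w} ->
  \int[P]_w f n w @[n --> \oo] --> \int[P]_w g w.
Proof.
move=> mf mg fM fg.
have fg' : {ae P, forall w, setT w -> (f n w)%:E @[n --> \oo] --> (g w)%:E}.
  by apply: filterS fg => w h _; apply: cvg_EFin => //; exact: nearW.
have iM := bounded_meas_integrable P (bounded_meas_cst M).
have [ig _ h] := @dominated_convergence _ _ _ P setT measurableT (fun n w => (f n w)%:E)
  (fun w => (g w)%:E) (EFin \o cst M)
  (fun n => (measurable_EFinP _ _).2 (mf n)) ((measurable_EFinP _ _).2 mg)
  fg'
  iM (aeW P (fun w n _ => fM n w)).
apply: fine_cvg; rewrite fineK; first exact: h.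
exact: integrable_fin_num.
Qed.

Lemma abs_mean_le (f g : T -> R) : bounded_meas f -> bounded_meas g ->
  {ae P, forall w, `|f w| <= g w} -> `|\int[P]_w f w| <= \int[P]_w g w.
Proof.
move=> bf bg [B [mB B0 hB]].
have mA : measurable (~` B) by exact: measurableC.
have bI : bounded_meas (\1_(~` B) : T -> R) by exact: bounded_meas_indic.
have E h : bounded_meas h -> \int[P]_w h w = \int[P]_w (h w * \1_(~` B) w).
  move=> bh; apply: ae_eq_mean => //; first exact: bounded_measM.
  exists B; split => // w /= hw; apply: contrapT => Bw; apply: hw.
  by rewrite indicE mem_set ?mulr1.
rewrite (E f bf) (E g bg); apply: le_trans (le_normr_Rintegral _ _) _ => //.
  by apply: bounded_meas_integrable; exact: bounded_measM.
apply: le_Rintegral => //.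
- have := integrable_abse (bounded_meas_integrable P (bounded_measM bf bI)).
  by congr (integrable _ _ _).
- by apply: bounded_meas_integrable; exact: bounded_measM.
- move=> w _; rewrite indicE; have [Bw|Bw] := pselect (B w).
    by rewrite memNset// !mulr0 normr0.
  by rewrite mem_set// !mulr1; apply: contrapT => h; apply: Bw; apply: hB.
Qed.

End bounded_convergence.

Section cutoff.
Context {R : realType}.
Implicit Types (f : R -> R) (B : R).

(** Continuous cutoff: one on [[- B, B]], zero beyond [B + 1]. *)
Definition cutoff B (x : R) : R := Num.max 0 (Num.min 1 (B + 1 - `|x|)).

Lemma cutoff_ge0 B x : 0 <= cutoff B x. Proof. by rewrite le_max lexx. Qed.

Lemma cutoff_le1 B x : cutoff B x <= 1.
Proof. by rewrite ge_max ler01 ge_min lexx. Qed.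

Lemma cutoff1 B x : `|x| <= B -> cutoff B x = 1.
Proof.
move=> h; rewrite /cutoff; have /min_idPl -> : 1 <= B + 1 - `|x| by lra.
by apply/max_idPr.
Qed.

Lemma cutoff0 B x : B + 1 <= `|x| -> cutoff B x = 0.
Proof.
move=> h; rewrite /cutoff; apply/max_idPl; rewrite ge_min; apply/orP; right; lra.
Qed.

Lemma continuous_cutoff B : continuous (cutoff B).
Proof.
move=> x.
apply: (@continuous_max _ _ (cst 0) (cst 1 \min (fun x => B + 1 - `|x|)) x); first exact: cvg_cst.
apply: (@continuous_min _ _ (cst 1) (fun x => B + 1 - `|x|) x); first exact: cvg_cst.
by apply: cvgB; [exact: cvg_cst|exact: norm_continuous].
Qed.

Lemma cutoff_tight d {T : measurableType d} (Q : probability T R) (W : T -> R) eps :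
  measurable_fun setT W -> 0 < eps ->
  exists2 B, 0 <= B & \int[Q]_w (1 - cutoff B (W w)) <= eps.
Proof.
move=> mW eps0.
have mc B : measurable_fun setT (fun w => 1 - cutoff B (W w)).
  apply: measurable_funB => //; apply: measurableT_comp => //.
  by apply: continuous_measurable_fun; exact: continuous_cutoff.
have h : \int[Q]_w (1 - cutoff n%:R (W w)) @[n --> \oo] --> \int[Q]_w 0.
  apply: (@bounded_convergence _ _ _ Q _ _ 1) => //.
    move=> n w; have := cutoff_ge0 n%:R (W w); have := cutoff_le1 n%:R (W w).
    by rewrite ler_norml => *; apply/andP; split; lra.
  apply: aeW => w.
  apply/cvgrPdist_le => e e0; near=> n; rewrite /= cutoff1 ?subrr ?normr0 ?(ltW e0)//.
  near: n; exact: nbhs_infty_ger.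
have /cvgrPdist_le /(_ eps eps0) [n _ hn] := h.
exists n%:R => //; have := hn n (leqnn n); rewrite /= Rintegral_cst//= mul0r.
by rewrite sub0r normrN; apply: le_trans; exact: ler_norm.
Unshelve. all: by end_near. Qed.

Definition compactly_supported f := exists B, forall x, B <= `|x| -> f x = 0.

Lemma compactly_supported_bounded f : continuous f -> compactly_supported f ->
  exists2 M, 0 <= M & forall x, `|f x| <= M.
Proof.
move=> cf [B hB]; have [B0|B0] := leP B 0.
  by exists 0 => // x; rewrite hB ?normr0// (le_trans B0).
have cn : {within `[- B, B], continuous (fun x => `|f x|)}.
  apply: continuous_subspaceT => x; apply: cvg_comp (cf x) _; exact: norm_continuous.
have [c _ hc] := @EVT_max _ (fun x => `|f x|) (- B) B ltac:(lra) cn.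
exists `|f c| => // x; have [xB|xB] := leP B `|x|; first by rewrite hB ?normr0.
by apply: hc; rewrite in_itv/= -ler_norml ltW.
Qed.

(** Heine's theorem on an interval slightly larger than the support. *)
Lemma compactly_supported_uniform f : continuous f -> compactly_supported f ->
  forall eps, 0 < eps -> exists2 dl, 0 < dl &
    forall x y, `|x - y| <= dl -> `|f x - f y| <= eps.
Proof.
move=> cf [B hB] eps eps0.
pose K := `[- B - 1, B + 1]%classic : set R.
have : \forall dl \near 0^'+, K `<=` (fun x => forall y, `|x - y| <= dl -> `|f x - f y| <= eps).
  have /compact_near_coveringP := @segment_compact R (- B - 1) (B + 1).
  apply => x _; have e2 : 0 < eps / 2 by lra.
  have /cvgrPdist_lt /(_ _ e2)/nbhs_ballP[rho /= rho0 hrho] := cf x.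
  have r2 : 0 < rho / 2 by lra.
  exists (ball x (rho / 2), [set dl | dl < rho / 2]).
    by split; [exact: nbhsx_ballx|exact: nbhs_right_lt].
  move=> [x' dl] /= [xx' dlr] y xy; rewrite /ball/= in xx'.
  have k1 := hrho x'; have k2 := hrho y; rewrite /ball/= in k1 k2.
  have k3 : `|x - x'| < rho by lra.
  have k4 : `|x - y| < rho by have := ler_distD x' x y; lra.
  have := ler_distD (f x) (f x') (f y); have := k1 k3; have := k2 k4.
  by rewrite (distrC (f x') (f x)); lra.
move=> h; have [dl [dlK dl0 dl1]] : exists dl : R, [/\ K `<=` (fun x => forall y, `|x - y| <= dl -> `|f x - f y| <= eps), 0 < dl & dl < 1].
  have h1 : \forall dl \near (0 : R)^'+, dl < 1 by exact: nbhs_right_lt.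
  have h2 : \forall dl \near (0 : R)^'+, 0 < dl by exact: nbhs_right_gt.
  by near (0 : R)^'+ => dl; exists dl; split; near: dl.
exists dl => // x y xy; have [xK|xK] := leP `|x| (B + 1).
  by apply: dlK => //; rewrite /K/= in_itv/=; move: xK; rewrite ler_norml => /andP[? ?]; apply/andP; split; lra.
have := lerB_dist x (x - y); rewrite (_ : x - (x - y) = y); last by ring.
move=> xy'; have yB : B <= `|y| by lra.
by rewrite !hB ?subrr ?normr0 ?(ltW eps0)//; lra.
Unshelve. all: by end_near. Qed.

(** Test functions suffice: no mass of the laws can escape to infinity when the
candidate limit is itself a probability.  The limit is given as the law [nu] of [W]
under [Q], through its integrals of bounded continuous functions. *)
Lemma cvg_in_law_of_test d {T : measurableType d} (P : probability T R)
    (Y : nat -> T -> R) d' {S : measurableType d'} (Q : probability S R) (W : S -> R)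
    (nu : set (measurableTypeR R) -> \bar R) :
  (forall n, measurable_fun setT (Y n)) -> measurable_fun setT W ->
  (forall f, continuous f -> (exists M, forall x, `|f x| <= M) ->
    (\int[nu]_x (f x)%:E = (\int[Q]_w f (W w))%:E)%E) ->
  (forall f, continuous f -> compactly_supported f ->
    \int[P]_w f (Y n w) @[n --> \oo] --> \int[Q]_w f (W w)) ->
  cvg_in_law P Y nu.
Proof.
move=> mY mW hnu hY f cf [M hM].
have mf (g : R -> R) : continuous g -> measurable_fun setT g by exact: continuous_measurable_fun.
have M0 : 0 <= M by apply: le_trans (normr_ge0 _) (hM 0).
have bf d1 (S1 : measurableType d1) (W1 : S1 -> R) : measurable_fun setT W1 ->
    bounded_meas (fun w => f (W1 w)).
  move=> mW1; split; last by exists M.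
  by apply: measurableT_comp => //; exact: mf.
have bc d1 (S1 : measurableType d1) (W1 : S1 -> R) B : measurable_fun setT W1 ->
    bounded_meas (fun w => cutoff B (W1 w)).
  move=> mW1; split; last first.
    by exists 1 => w; rewrite ger0_norm ?cutoff_ge0 ?cutoff_le1.
  by apply: measurableT_comp => //; apply: mf; exact: continuous_cutoff.
suff h : \int[P]_w f (Y n w) @[n --> \oo] --> \int[Q]_w f (W w).
  rewrite hnu//; last by exists M.
  have -> : (fun n => 'E_P[f \o Y n])%E = (fun n => (\int[P]_w f (Y n w))%:E).
    by apply/funext => n; rewrite expectation_mean//; exact: bf.
  by apply: cvg_EFin => //; exact: nearW.
apply/cvgrPdist_le => eps eps0.
pose e1 := eps / (4 * (M + 1)).
have e10 : 0 < e1 by rewrite divr_gt0// mulr_gt0// ltr_wpDl.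
have [B B0 hB] := cutoff_tight Q mW e10.
pose g x := f x * cutoff B x.
have cg : continuous g by move=> x; apply: cvgM; [exact: cf|exact: continuous_cutoff].
have cc : continuous (cutoff B) by exact: continuous_cutoff.
have sc : compactly_supported (cutoff B) by exists (B + 1) => x; exact: cutoff0.
have sg : compactly_supported g by exists (B + 1) => x h; rewrite /g cutoff0 ?mulr0.
have /cvgrPdist_le /(_ e1 e10) [n1 _ h1] := hY _ cc sc.
have e20 : 0 < eps / 4 by lra.
have /cvgrPdist_le /(_ _ e20) [n2 _ h2] := hY _ cg sg.
have rest d1 (S1 : measurableType d1) (Q1 : probability S1 R) (W1 : S1 -> R) :
    measurable_fun setT W1 ->
    `|\int[Q1]_w f (W1 w) - \int[Q1]_w g (W1 w)| <= M * (1 - \int[Q1]_w cutoff B (W1 w)).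
  move=> mW1; have bg : bounded_meas (fun w => g (W1 w)) by apply: bounded_measM; [exact: bf|exact: bc].
  have -> : 1 - \int[Q1]_w cutoff B (W1 w) = \int[Q1]_w (1 - cutoff B (W1 w)).
    rewrite RintegralB//; first by rewrite Rintegral_cst//= probability_setT mulr1.
    - by apply: bounded_meas_integrable; exact: bounded_meas_cst.
    - by apply: bounded_meas_integrable; exact: bc.
  have b1 : bounded_meas (fun w => 1 - cutoff B (W1 w)).
    by apply: bounded_measB; [exact: bounded_meas_cst|exact: bc].
  rewrite -meanZ// -RintegralB//; last 2 first.
  - by apply: bounded_meas_integrable; exact: bf.
  - exact: bounded_meas_integrable.
  apply: abs_mean_le.
  - by apply: bounded_measB => //; exact: bf.
  - by apply: bounded_measM => //; exact: bounded_meas_cst.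
  - apply: nearW => w; rewrite /g -{1}[f (W1 w)]mulr1 -mulrBr normrM.
    have := cutoff_le1 B (W1 w) => cl; rewrite [`|1 - _|]ger0_norm ?subr_ge0//.
    by rewrite ler_wpM2r ?subr_ge0.
exists (maxn n1 n2) => // n /=; rewrite geq_max => /andP[/h1 /= k1 /h2 /= k2].
have r1 := rest _ _ P (Y n) (mY n); have r2 := rest _ _ Q _ mW.
have hB' : 1 - \int[Q]_w cutoff B (W w) <= e1.
  move: hB; rewrite RintegralB//; first by rewrite Rintegral_cst//= probability_setT mulr1.
  - by apply: bounded_meas_integrable; exact: bounded_meas_cst.
  - by apply: bounded_meas_integrable; exact: bc.
have E : M * e1 <= eps / 4.
  rewrite /e1 mulrA ler_pdivrMr ?mulr_gt0 ?ltr_wpDl//.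
  rewrite [leRHS](_ : _ = (M + 1) * eps); last by field.
  by rewrite ler_wpM2r ?(ltW eps0)// lerDl.
have q1 : M * (1 - \int[Q]_w cutoff B (W w)) <= M * e1 by rewrite ler_wpM2l.
have q2 : M * (1 - \int[P]_w cutoff B (Y n w)) <= 2 * (M * e1).
  rewrite mulrCA ler_wpM2l//; move: k1; rewrite ler_distl => /andP[_ k1]; lra.
move: r1 r2 k2; rewrite !ler_norml => /andP[? ?] /andP[? ?] /andP[? ?].
by apply/andP; split; lra.
Qed.

End cutoff.
(** * Gaussian means of test functions *)

Section gaussian.
Context {R : realType} (sg : R) (sg0 : 0 < sg).
Local Notation mu := (@lebesgue_measure R).
Local Notation N := (normal_prob 0 sg).
Implicit Types (f : R -> R) (t u v y : R).

Lemma integral_normal_prob f : N.-integrable setT (EFin \o f) ->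
  (\int[N]_x (f x)%:E = \int[mu]_x (f x * normal_pdf 0 sg x)%:E)%E.
Proof.
move=> fi; rewrite -(Radon_Nikodym_change_of_variables (normal_prob_dominates 0 sg))//=.
apply: ae_eq_integral => //.
- apply: emeasurable_funM; first exact: measurable_int fi.
  apply: (measurable_int mu); apply: Radon_Nikodym_integrable.
  exact: normal_prob_dominates.
- apply/measurable_EFinP/measurable_funM; last exact: measurable_normal_pdf.
  by apply/measurable_EFinP; exact: measurable_int fi.
- rewrite (_ : (fun x => (f x * normal_pdf 0 sg x)%:E) =
    ((EFin \o f) \* (fun x => (normal_pdf 0 sg x)%:E))%E); last by apply/funext => x.
  apply: ae_eqe_mul2l => /=.
  rewrite Radon_NikodymE//=; first exact: normal_prob_dominates.
  move=> numu; case: cid => /= h [h1 h2 h3].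
  apply: integral_ae_eq => //=.
  + by apply/measurable_EFinP; exact: measurable_normal_pdf.
  + by move=> E _ mE; rewrite -h3.
Qed.

(** [heat t] is an unnormalised Gaussian density of variance [t]; the substitution
[z = sqrt t / sg * u] carries it to the reference law of standard deviation [sg]. *)
Lemma heat_normal_pdf t u : 0 < t ->
  heat t (Num.sqrt t / sg * u) * (Num.sqrt t / sg) = Num.sqrt (2 * pi) * normal_pdf 0 sg u.
Proof.
move=> t0; rewrite normal_pdfE ?gt_eqF// /normal_peak /normal_fun subr0 /heat.
have st : 0 < Num.sqrt t by rewrite sqrtr_gt0.
have -> : Num.sqrt (sg ^+ 2 * pi *+ 2) = sg * Num.sqrt (2 * pi).
  by rewrite -mulrnAr -[pi *+ 2]mulr_natl sqrtrM ?sqr_ge0// sqrtr_sqr gtr0_norm.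
have sp : 0 < Num.sqrt (2 * pi : R) by rewrite sqrtr_gt0 mulr_gt0 ?pi_gt0.
rewrite expRD expRN.
have -> : expR (ln t / 2) = Num.sqrt t.
  by rewrite -powR12_sqrt ?(ltW t0)// /powR gt_eqF// mulrC.
have -> : - ((Num.sqrt t / sg * u) ^+ 2 / (2 * t)) = - u ^+ 2 / (sg ^+ 2 *+ 2).
  rewrite !exprMn sqr_sqrtr ?(ltW t0)// -[sg ^+ 2 *+ 2]mulr_natl.
  by field; rewrite !gt_eqF.
by field; rewrite !gt_eqF.
Qed.

Lemma continuous_heat t y : 0 < t -> continuous (fun z => heat t (y - z)).
Proof.
move=> t0 z; have d1 := is_derive_heat (y - z) t0.
have h1 : {for y - z, continuous (heat t)}.
  by apply: differentiable_continuous; apply/derivable1_diffP; exact: ex_derive.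
apply: (@continuous_comp _ _ _ (fun z => y - z) (heat t)) => //.
by apply: cvgB; [exact: cvg_cst|exact: cvg_id].
Qed.

Lemma affine_bounded_meas f M y c : continuous f -> (forall x, `|f x| <= M) ->
  bounded_meas (fun u : measurableTypeR R => f (y + c * u)).
Proof.
move=> cf hM; split; last by exists M.
apply: measurableT_comp; first exact: continuous_measurable_fun.
by apply: measurable_funD => //; apply: measurable_funM.
Qed.

Lemma heat_substitution_ge0 (G : R -> R) M t y : continuous G -> (forall x, 0 <= G x <= M) ->
  0 < t -> (\int[mu]_z (G z * heat t (y - z))%:E =
    (Num.sqrt (2 * pi) * \int[N]_u G (y + Num.sqrt t / sg * u))%:E)%E.
Proof.
move=> cG hG t0; set c := Num.sqrt t / sg.
have c0 : 0 < c by rewrite divr_gt0// sqrtr_gt0.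
have bG : bounded_meas (fun u : measurableTypeR R => G (y + c * u)).
  by apply: (@affine_bounded_meas _ M) => // x; have /andP[? ?] := hG x; rewrite ger0_norm.
pose F u := y + c * u.
have F'E : F^`()%classic = cst c.
  apply/funext => x; rewrite /F derive1E deriveD// derive_cst add0r deriveM//.
  by rewrite derive_cst derive_id scaler0 addr0 scaler1.
have dF x : derivable F x 1 by [].
rewrite (@increasing_ge0_integration_by_substitutionT R F (fun z => G z * heat t (y - z)))//.
- rewrite EFinM (_ : (\int[N]_u G (y + c * u))%:E = (\int[N]_u (G (y + c * u))%:E)%E); last first.
    by rewrite /Rintegral fineK//; apply: integrable_fin_num => //; exact: bounded_meas_integrable.
  rewrite integral_normal_prob; last exact: bounded_meas_integrable.
  rewrite -ge0_integralZl//.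
  + apply: eq_integral => u _; rewrite F'E -EFinM; congr (_%:E).
    rewrite /= /F !fctE opprD addrA subrr add0r.
    have heatN : heat t (- (c * u)) = heat t (c * u) by rewrite /heat sqrrN.
    have := heat_normal_pdf u t0; rewrite -/c => E.
    by rewrite heatN -mulrA E mulrCA.
  + apply/measurable_EFinP/measurable_funM; first exact: bG.1.
    exact: measurable_normal_pdf.
  + by move=> u _; rewrite lee_fin mulr_ge0 ?normal_pdf_ge0//; have /andP[] := hG (y + c * u).
- by move=> a b ab; rewrite /F ltrD2l ltr_pM2l.
- by rewrite F'E => x; exact: cvg_cst.
- by rewrite F'E; exact: is_cvg_cst.
- by rewrite F'E; exact: is_cvg_cst.
- apply: (@cvg_comp _ _ _ (fun u => c * u) (fun u => y + u) _ -oo _).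
    rewrite (_ : (fun u => c * u) = (fun u => id u * c)); last by apply/funext => u; rewrite mulrC.
    exact: (gt0_cvgMlNy (f := id) c0 (@cvg_id _ _)).
  exact: cvg_addrl_Ny.
- apply: (@cvg_comp _ _ _ (fun u => c * u) (fun u => y + u) _ +oo _).
    rewrite (_ : (fun u => c * u) = (fun u => id u * c)); last by apply/funext => u; rewrite mulrC.
    exact: (gt0_cvgMly (f := id) c0 (@cvg_id _ _)).
  exact: cvg_addrl.
- by move=> x; apply: cvgM; [exact: cG|exact: continuous_heat].
- by move=> x; rewrite mulr_ge0 ?expR_ge0//; have /andP[] := hG x.
Qed.

(** The mean of [f] under the Gaussian law with center [y] and variance [v], written as
an integral against one fixed law so that different [v] can be compared pointwise. *)
Definition gauss_mean f y v : R := \int[N]_u f (y + Num.sqrt v / sg * u).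

Lemma heat_gauss_mean f M t y : continuous f -> (forall x, `|f x| <= M) -> 0 < t ->
  mu.-integrable setT (fun z => (f z * heat t (y - z))%:E) /\
  \int[mu]_z (f z * heat t (y - z)) = Num.sqrt (2 * pi) * gauss_mean f y t.
Proof.
move=> cf hM t0; have M0 : 0 <= M by apply: le_trans (normr_ge0 _) (hM 0).
have key (G : R -> R) M' : continuous G -> (forall x, 0 <= G x <= M') ->
    mu.-integrable setT (fun z => (G z * heat t (y - z))%:E) /\
    \int[mu]_z (G z * heat t (y - z)) = Num.sqrt (2 * pi) * gauss_mean G y t.
  move=> cG hG; have E := heat_substitution_ge0 y cG hG t0; split; last by rewrite /Rintegral E.
  apply/integrableP; split.
    apply/measurable_EFinP; apply: continuous_measurable_fun => x.
    by apply: cvgM; [exact: cG|exact: continuous_heat].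
  under eq_integral => z _ do rewrite gee0_abs ?lee_fin ?mulr_ge0 ?expR_ge0 ?(andP (hG z)).1//.
  by rewrite E ltry.
have [i1 E1] : _ /\ _ := key (fun x => f x + M) (M + M)
  (fun x => cvgD (cf x) (cvg_cst _)) ltac:(by move=> x; have := hM x; rewrite ler_norml => /andP[? ?]; apply/andP; split; lra).
have [i2 E2] : _ /\ _ := key (cst M) M (fun x => cvg_cst _) ltac:(by move=> x; rewrite M0 lexx).
have E z : f z * heat t (y - z) = (f z + M) * heat t (y - z) - M * heat t (y - z) by ring.
split; first by under eq_fun do rewrite E; exact: integrable_EFinB.
have -> : \int[mu]_z (f z * heat t (y - z)) =
    \int[mu]_z ((f z + M) * heat t (y - z) - M * heat t (y - z)).
  by apply: eq_Rintegral => z _; rewrite -E.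
rewrite RintegralB// E1 E2 -mulrBr /gauss_mean; congr (_ * _).
have b1 : bounded_meas (fun u : measurableTypeR R => f (y + Num.sqrt t / sg * u)).
  exact: affine_bounded_meas hM.
rewrite RintegralD//; first by rewrite addrK.
- exact: bounded_meas_integrable.
- by apply: bounded_meas_integrable; exact: bounded_meas_cst.
Qed.

Lemma gauss_mean0 f y : gauss_mean f y 0 = f y.
Proof.
rewrite /gauss_mean sqrtr0 mul0r.
have -> : \int[N]_u f (y + 0 * u) = \int[N]_u f y.
  by apply: eq_Rintegral => u _; rewrite mul0r addr0.
by rewrite Rintegral_cst//= probability_setT mulr1.
Qed.

Lemma gauss_mean_bounded f M y v : continuous f -> (forall x, `|f x| <= M) ->
  `|gauss_mean f y v| <= M.
Proof.
move=> cf hM; have b1 := affine_bounded_meas y (Num.sqrt v / sg) cf hM.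
have H := @abs_mean_le R _ (measurableTypeR R) N _ _ b1 (bounded_meas_cst M); apply: le_trans (H _) _.
  exact: aeW.
by rewrite Rintegral_cst//= probability_setT mulr1.
Qed.

Lemma sqrtr_diff_le (v v' : R) : 0 <= v -> 0 <= v' ->
  (Num.sqrt v - Num.sqrt v') ^+ 2 <= `|v - v'|.
Proof.
move=> v0 v'0; have h (x y : R) : 0 <= x -> 0 <= y -> (x - y) ^+ 2 <= `|x ^+ 2 - y ^+ 2|.
  move=> x0 y0; rewrite subr_sqr normrM -(real_normK (num_real (x - y))) expr2.
  by rewrite ler_wpM2l// ler_norml [`|_ + _|]ger0_norm ?addr_ge0//; apply/andP; split; lra.
by have := h _ _ (sqrtr_ge0 v) (sqrtr_ge0 v'); rewrite !sqr_sqrtr.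
Qed.

Let gauss_meanB f f' M M' y y' v v' : continuous f -> (forall x, `|f x| <= M) ->
  continuous f' -> (forall x, `|f' x| <= M') ->
  bounded_meas (fun u : measurableTypeR R =>
     f (y + Num.sqrt v / sg * u) - f' (y' + Num.sqrt v' / sg * u)) /\
  gauss_mean f y v - gauss_mean f' y' v' =
  \int[N]_u (f (y + Num.sqrt v / sg * u) - f' (y' + Num.sqrt v' / sg * u)).
Proof.
move=> cf hM cf' hM'; have b1 := affine_bounded_meas y (Num.sqrt v / sg) cf hM.
have b2 := affine_bounded_meas y' (Num.sqrt v' / sg) cf' hM'.
by split; [exact: bounded_measB|rewrite RintegralB//; exact: bounded_meas_integrable].
Qed.

Lemma gauss_mean_center f : continuous f -> compactly_supported f ->
  forall eps, 0 < eps -> exists2 dl, 0 < dl &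
    forall y y' v, `|y - y'| <= dl -> `|gauss_mean f y v - gauss_mean f y' v| <= eps.
Proof.
move=> cf sf eps eps0; have [M M0 hM] := compactly_supported_bounded cf sf.
have [dl dl0 h] := compactly_supported_uniform cf sf eps0.
exists dl => // y y' v yy'; have [b E] := gauss_meanB y y' v v cf hM cf hM.
rewrite E; have H := @abs_mean_le R _ (measurableTypeR R) N _ _ b (bounded_meas_cst eps); apply: le_trans (H _) _.
  by apply: aeW => u; apply: h; rewrite opprD addrACA subrr addr0.
by rewrite Rintegral_cst//= probability_setT mulr1.
Qed.

(** The displacement [(sqrt v - sqrt v') * u / sg] is small unless [u] is large, which is
rare by tightness, or [v] is far from [v'], which is paid by [K * `|v - v'|]. *)
Lemma gauss_mean_variance f : continuous f -> compactly_supported f ->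
  forall eps, 0 < eps -> exists2 K, 0 <= K & forall y v v', 0 <= v -> 0 <= v' ->
    `|gauss_mean f y v - gauss_mean f y v'| <= eps + K * `|v - v'|.
Proof.
move=> cf sf eps eps0; have [M M0 hM] := compactly_supported_bounded cf sf.
have e2 : 0 < eps / 2 by lra.
have [dl dl0 h] := compactly_supported_uniform cf sf e2.
have e3 : 0 < eps / (4 * (M + 1)) by rewrite divr_gt0// mulr_gt0// ltr_wpDl.
have mid : measurable_fun setT (fun x : measurableTypeR R => x : R) by exact: measurable_id.
have [A A0 hA] := cutoff_tight N mid e3.
pose K := 2 * M * ((A + 1) / (sg * dl)) ^+ 2.
have K0 : 0 <= K by rewrite mulr_ge0 ?sqr_ge0// mulr_ge0.
exists K => // y v v' v0 v'0; have [b ->] := gauss_meanB y y v v' cf hM cf hM.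
have bc : bounded_meas (fun u : measurableTypeR R => 1 - cutoff A u).
  split; first by apply: measurable_funB => //; apply: continuous_measurable_fun; exact: continuous_cutoff.
  exists 1 => u; have := cutoff_ge0 A u; have := cutoff_le1 A u.
  by rewrite ler_norml => *; apply/andP; split; lra.
have b2 : bounded_meas (fun u : measurableTypeR R => 2 * M * (1 - cutoff A u)).
  by apply: bounded_measM => //; exact: bounded_meas_cst.
pose k := eps / 2 + K * `|v - v'|.
have H := @abs_mean_le R _ (measurableTypeR R) N _ _ b (bounded_measD b2 (bounded_meas_cst k)); apply: le_trans (H _) _; last first.
  rewrite RintegralD//; last 2 first.
  - exact: bounded_meas_integrable.
  - by apply: bounded_meas_integrable; exact: bounded_meas_cst.
  rewrite meanZ// Rintegral_cst//= probability_setT mulr1 /k.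
  have : 2 * M * (\int[N]_u (1 - cutoff A u)) <= 2 * M * (eps / (4 * (M + 1))).
    by rewrite ler_wpM2l// mulr_ge0.
  have : 2 * M * (eps / (4 * (M + 1))) <= eps / 2.
    rewrite mulrA ler_pdivrMr ?mulr_gt0 ?ltr_wpDl//.
    rewrite [leRHS](_ : _ = 2 * (M + 1) * eps); last by field.
    by rewrite ler_wpM2r ?(ltW eps0)//; lra.
  set I := \int[N]_u _; move: I => I; lra.
apply: aeW => u; rewrite /k.
have triv : `|f (y + Num.sqrt v / sg * u) - f (y + Num.sqrt v' / sg * u)| <= 2 * M.
  by apply: le_trans (ler_normB _ _) _; rewrite mulr_natl mulr2n lerD.
have Kv : 0 <= K * `|v - v'| by rewrite mulr_ge0.
have [uA|uA] := leP (A + 1) `|u|; first by rewrite cutoff0// subr0 mulr1; lra.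
have c1 : 0 <= 2 * M * (1 - cutoff A u) by rewrite mulr_ge0 ?subr_ge0 ?cutoff_le1// mulr_ge0.
have [near|far] := leP (`|Num.sqrt v - Num.sqrt v'| * (A + 1)) (dl * sg).
  suff /h : `|y + Num.sqrt v / sg * u - (y + Num.sqrt v' / sg * u)| <= dl by lra.
  rewrite (_ : y + _ - _ = (Num.sqrt v - Num.sqrt v') * u / sg); last by field; rewrite gt_eqF.
  rewrite normrM normrM [`|sg^-1|]ger0_norm ?invr_ge0 ?(ltW sg0)// ler_pdivrMr//.
  by apply: le_trans near; rewrite ler_wpM2l// ltW.
suff : 2 * M <= K * `|v - v'| by lra.
rewrite /K -mulrA ler_peMr ?mulr_ge0//.
apply: (@le_trans _ _ (((A + 1) / (sg * dl)) ^+ 2 * (Num.sqrt v - Num.sqrt v') ^+ 2)); last first.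
  by rewrite ler_wpM2l ?sqr_ge0// sqrtr_diff_le.
rewrite -(real_normK (num_real (Num.sqrt v - _))) -exprMn exprn_ege1//.
rewrite mulrAC ler_pdivlMr ?mulr_gt0// mul1r mulrC [leRHS]mulrC ltW//.
Qed.

End gaussian.
(** * Gaussian approximation of the remainder *)

Section finite_expectation.
Context {R : realType} (p q r s : R).
Local Notation mu := (@lebesgue_measure R).

(** The law of the next step as a finite list of weighted values. *)
Definition step_law (x : seq R) : seq (R * R) :=
  if x is [::] then [:: (s, 1); (1 - s, -1)] else
  flatten [seq [:: ((size x)%:R^-1 * p, y); ((size x)%:R^-1 * q, - y); ((size x)%:R^-1 * r, 0)]
    | y <- x].

Lemma avg_step_law x (G : R -> R) :
  avg p q r s x G = \sum_(j <- step_law x) j.1 * G j.2.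
Proof.
case E : x => [|u v]; first by rewrite /= !big_cons big_nil addr0.
rewrite /avg /step_law -E big_flatten big_map mulr_sumr; apply: eq_bigr => y _.
by rewrite !big_cons big_nil /=; ring.
Qed.

Lemma Ex_finite_sum n : exists l : seq (R * seq R),
  forall F, Ex p q r s n F = \sum_(i <- l) i.1 * F i.2.
Proof.
elim: n => [|n [l IH]]; first by exists [:: (1, [::])] => F; rewrite big_seq1 mul1r.
exists (flatten [seq [seq (i.1 * j.1, rcons i.2 j.2) | j <- step_law i.2] | i <- l]) => F.
rewrite ExS IH big_flatten/= big_map; apply: eq_bigr => i _.
by rewrite avg_step_law mulr_sumr big_map; apply: eq_bigr => j _ /=; rewrite mulrA.
Qed.

Lemma Ex_Rintegral n (g : seq R -> R -> R) :
  (forall x, mu.-integrable setT (fun z => (g x z)%:E)) ->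
  mu.-integrable setT (fun z => (Ex p q r s n (fun x => g x z))%:E) /\
  \int[mu]_z Ex p q r s n (fun x => g x z) = Ex p q r s n (fun x => \int[mu]_z g x z).
Proof.
move=> ig; have [l hl] := Ex_finite_sum n; rewrite hl.
have -> : (fun z => (Ex p q r s n (fun x => g x z))%:E) =
    (fun z => (\sum_(i <- l) i.1 * g i.2 z)%:E).
  by apply/funext => z; rewrite hl.
have -> : \int[mu]_z Ex p q r s n (fun x => g x z) = \int[mu]_z (\sum_(i <- l) i.1 * g i.2 z).
  by apply: eq_Rintegral => z _; rewrite hl.
elim: l {hl} => [|i l [IH1 IH2]].
  rewrite big_nil; have E : (fun z : R => \sum_(i <- [::]) i.1 * g i.2 z) = fun=> 0.
    by apply/funext => z; rewrite big_nil.
  rewrite E /= Rintegral_cst//=; split; last by rewrite mul0r.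
  by under eq_fun do rewrite big_nil; exact: integrable0.
have E : (fun z => \sum_(j <- i :: l) j.1 * g j.2 z) =
    (fun z => i.1 * g i.2 z + \sum_(j <- l) j.1 * g j.2 z).
  by apply/funext => z; rewrite big_cons.
have iZ : mu.-integrable setT (fun z => (i.1 * g i.2 z)%:E) by exact: integrable_EFinZ.
rewrite big_cons -IH2; split.
  rewrite (_ : (fun z => _) = (fun z => (i.1 * g i.2 z + \sum_(j <- l) j.1 * g j.2 z)%:E)).
    exact: integrable_EFinD.
  by apply/funext => z; rewrite big_cons.
by rewrite E (RintegralD measurableT iZ IH1) (RintegralZl _ measurableT (ig _)).
Qed.

End finite_expectation.

Lemma compactly_supported_integrable {R : realType} (f : R -> R) :
  continuous f -> compactly_supported f ->
  (@lebesgue_measure R).-integrable setT (fun z => (f z)%:E).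
Proof.
move=> cf [B hB].
have h : (@lebesgue_measure R).-integrable `[- B, B]%classic (EFin \o f).
  apply: continuous_compact_integrable; first exact: segment_compact.
  exact: continuous_subspaceT.
have mI : measurable (`[- B, B]%classic : set (measurableTypeR R)) by [].
have := (integrable_mkcond _ mI).1 h; congr (integrable _ _ _); apply/funext => x; rewrite patchE.
case: ifPn => // xB; rewrite /= hB//; apply/ltW; rewrite ltNge; apply: contra xB.
by rewrite inE/= in_itv/= -ler_norml.
Qed.
Lemma cvg_shift {R : realType} (v : nat -> R) (l : R) n :
  v N @[N --> \oo] --> l -> v (N + n)%N @[N --> \oo] --> l.
Proof. by rewrite (cvg_shiftn n v). Qed.

Lemma cvg_dist_le {R : realType} (u v : nat -> R) (l l' c : R) :
  u N @[N --> \oo] --> l -> v N @[N --> \oo] --> l' ->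
  (forall N, `|u N - v N| <= c) -> `|l - l'| <= c.
Proof.
move=> hu hv h; have hw : `|u N - v N| @[N --> \oo] --> `|l - l'|.
  by apply: cvg_norm; exact: cvgB.
rewrite -(cvg_lim (@Rhausdorff R) hw); apply: limr_le; last exact: nearW.
by apply/cvg_ex; exists `|l - l'|.
Qed.

Lemma ler_dist3 {R : realType} (A B C D e1 e2 e3 : R) :
  `|A - B| <= e1 -> `|B - C| <= e2 -> `|C - D| <= e3 -> `|A - D| <= e1 + e2 + e3.
Proof.
move=> h1 h2 h3; apply: le_trans (ler_distD C A D) _; apply: lerD => //.
by apply: le_trans (ler_distD B A C) _; exact: lerD.
Qed.

Section superdiffusive.
Context {R : realType} d {T : measurableType d} (P : probability T R).
Context (p q r s : R) (X : nat -> {RV P >-> R}) (K : nat -> {RV P >-> nat})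
  (e : nat -> {RV P >-> R}) (L : {RV P >-> R}).
Context (hp : 0 <= p) (hq : 0 <= q) (hr : 0 <= r) (hpqr : p + q + r = 1)
  (hs : 0 <= s <= 1) (hb : 0 < p + q) (hr0 : 0 < r) (hsup : p + q < 2 * (p - q))
  (hX : is_ERWS p q r s X K e)
  (hL : {ae P, forall w, position X n w / n%:R `^ (p - q) @[n --> \oo] --> L w}).
Local Notation mu := (@lebesgue_measure R).
Local Notation b := (p + q).
Local Notation a := (p - q).
Local Notation dd := (2 * (p - q) - (p + q)).
Local Notation Ex := (Ex p q r s).
Local Notation ratio := (ratio p q).
Local Notation clock := (clock p q).
Let tau2 : R := b / dd.
Let tau := Num.sqrt tau2.
Local Notation gauss := (gauss_mean tau).

Let dd0 : 0 < dd. Proof. by rewrite subr_gt0. Qed.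
Let tau20 : 0 < tau2. Proof. by rewrite divr_gt0. Qed.
Let tau0 : 0 < tau. Proof. by rewrite sqrtr_gt0. Qed.

Lemma ratio_ge0 n x : 0 <= ratio n x.
Proof. by rewrite divr_ge0 ?powR_ge0//; apply: sumr_ge0 => y _; exact: sqr_ge0. Qed.

Lemma abs_le_sqr (u eps : R) : 0 < eps -> `|u| <= (2 * eps)^-1 * u ^+ 2 + eps / 2.
Proof.
move=> e0; rewrite -(ler_pM2l (_ : 0 < 2 * eps)) ?mulr_gt0//.
rewrite [leRHS](_ : _ = `|u| ^+ 2 + eps ^+ 2).
  by have := sqr_ge0 (`|u| - eps); lra.
by rewrite real_normK ?num_real//; field; rewrite gt_eqF.
Qed.

Lemma Ex_ratio_abs eps : 0 < eps -> exists n0, forall n k, (n0 < n)%N -> (n <= k)%N ->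
  Ex k (fun x => `|ratio k x - ratio n (take n x)|) <= eps.
Proof.
move=> e0; have e20 : 0 < eps ^+ 2 by rewrite exprn_gt0.
have [n0 h] := Ex_ratio_cauchy hp hq hr hpqr hs hb e20.
exists n0 => -[//|n] [//|k] nn0 nk.
have := h n k nn0 nk; rewrite -/(ratio _ _) => hh.
apply: (@le_trans _ _ (Ex k.+1 (fun x => (2 * eps)^-1 *
    (ratio k.+1 x - ratio n.+1 (take n.+1 x)) ^+ 2 + eps / 2))).
  by apply: le_Ex => // x _ _; exact: abs_le_sqr.
rewrite ExD ExZ Ex_cst//.
have : (2 * eps)^-1 * Ex k.+1 (fun x => (ratio k.+1 x - ratio n.+1 (take n.+1 x)) ^+ 2)
    <= (2 * eps)^-1 * eps ^+ 2.
  by rewrite ler_wpM2l// invr_ge0 mulr_ge0// ltW.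
rewrite [X in _ <= X -> _](_ : _ = eps / 2); last by field; rewrite gt_eqF.
lra.
Qed.

Section test_function.
Context (f : R -> R) (cf : continuous f) (sf : compactly_supported f).

(** The estimate for the heat kernel, integrated against [f] over its centers. *)
Lemma smoothed_lindeberg (t0 kap : R) : 0 < t0 -> 0 <= kap -> exists2 C : R, 0 <= C &
  forall n N (gam : seq R -> R) (eps : R), (0 < n)%N -> (n <= N)%N ->
  (forall x, 0 <= gam x <= kap * n%:R `^ (dd / 2)) ->
  (forall k, (n <= k)%N -> Ex k (fun x => `|ratio k x - ratio n (take n x)|) <= eps) ->
  `|Ex N (fun x => gauss f (gam (take n x) *
        (endpoint (take n x) / n%:R `^ a - endpoint x / N%:R `^ a)) t0)
    - Ex n (fun x => gauss f 0 (t0 + gam x ^+ 2 * ratio n x * clock N n))|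
  <= C * (eps + n%:R `^ (b - 1) + n%:R `^ (- (b / 2))).
Proof.
move=> t00 kap0; have [C C0 hC] := lindeberg hp hq hr hpqr hs hb hr0 hsup t00 kap0.
have [M M0 hM] := compactly_supported_bounded cf sf.
have fi := compactly_supported_integrable cf sf.
have sp : 0 < Num.sqrt (2 * pi : R) by rewrite sqrtr_gt0 mulr_gt0 ?pi_gt0.
pose c := (Num.sqrt (2 * pi : R))^-1.
have c0 : 0 <= c by rewrite invr_ge0 ltW.
have inf := integrable_abse fi.
pose I := \int[mu]_z `|f z|.
exists (c * (I * C)).
  rewrite mulr_ge0// mulr_ge0//; apply: fine_ge0; apply: integral_ge0 => z _.
  by rewrite lee_fin.
move=> n N gam eps n0 nN hg heps.
set y := fun x => gam (take n x) * (endpoint (take n x) / n%:R `^ a - endpoint x / N%:R `^ a).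
set v := fun x => t0 + gam x ^+ 2 * ratio n x * clock N n.
have v0 x : 0 < v x.
  rewrite ltr_wpDr//; apply: mulr_ge0; last exact: (clock_ge0 hb hsup).
  by apply: mulr_ge0; [exact: sqr_ge0|exact: ratio_ge0].
have gE u t : 0 < t -> gauss f u t = c * \int[mu]_z (f z * heat t (u - z)).
  move=> t1; have [_ ->] := heat_gauss_mean tau0 u cf hM t1.
  by rewrite /c mulKf ?gt_eqF.
have E1 : Ex N (fun x => gauss f (y x) t0) =
    c * \int[mu]_z (f z * Ex N (fun x => heat t0 (y x - z))).
  rewrite (_ : (fun x => gauss f (y x) t0) = (fun x => c * \int[mu]_z (f z * heat t0 (y x - z)))).
    rewrite ExZ; congr (_ * _).
    have [_ <-] := @Ex_Rintegral R p q r s N (fun x z => f z * heat t0 (y x - z))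
      (fun x => (heat_gauss_mean tau0 (y x) cf hM t00).1).
    by apply: eq_Rintegral => z _; rewrite ExZ.
  by apply/funext => x; rewrite gE.
have heatN t u : heat t (0 - u) = heat t u :> R by rewrite sub0r /heat sqrrN.
have E2 : Ex n (fun x => gauss f 0 (v x)) =
    c * \int[mu]_z (f z * Ex n (fun x => heat (v x) z)).
  rewrite (_ : (fun x => gauss f 0 (v x)) = (fun x => c * \int[mu]_z (f z * heat (v x) (0 - z)))).
    rewrite ExZ; congr (_ * _).
    have [_ <-] := @Ex_Rintegral R p q r s n (fun x z => f z * heat (v x) (0 - z))
      (fun x => (heat_gauss_mean tau0 0 cf hM (v0 x)).1).
    apply: eq_Rintegral => z _; rewrite ExZ; congr (_ * Ex _ _).
    by apply/funext => x; rewrite heatN.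
  by apply/funext => x; rewrite gE.
have i1 : mu.-integrable setT (fun z => (f z * Ex N (fun x => heat t0 (y x - z)))%:E).
  have [h _] := @Ex_Rintegral R p q r s N (fun x z => f z * heat t0 (y x - z))
      (fun x => (heat_gauss_mean tau0 (y x) cf hM t00).1).
  by move: h; congr (integrable _ _ _); apply/funext => z; rewrite ExZ.
have i2 : mu.-integrable setT (fun z => (f z * Ex n (fun x => heat (v x) z))%:E).
  have [h _] := @Ex_Rintegral R p q r s n (fun x z => f z * heat (v x) (0 - z))
      (fun x => (heat_gauss_mean tau0 0 cf hM (v0 x)).1).
  move: h; congr (integrable _ _ _); apply/funext => z; rewrite ExZ.
  by congr ((_ * Ex _ _)%:E); apply/funext => x; rewrite heatN.
rewrite E1 E2 -mulrBr normrM (ger0_norm c0) -!mulrA ler_wpM2l//.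
rewrite -RintegralB//.
set err := C * _; apply: le_trans (le_normr_Rintegral _ _) _ => //; first exact: integrable_EFinB.
rewrite mulrC -RintegralZl//.
apply: le_Rintegral => //.
- by have := integrable_abse (integrable_EFinB measurableT i1 i2); congr (integrable _ _ _).
- by apply: integrable_EFinZ.
- move=> z _; rewrite -mulrBr normrM mulrC ler_wpM2r//.
  exact: hC.
Qed.

Lemma continuous_gauss v : continuous (fun y => gauss f y v).
Proof.
move=> y; apply/cvgrPdist_le => eps e0.
have [dl dl0 h] := gauss_mean_center tau cf sf e0.
near=> z; apply: h; near: z.
by have /cvgrPdist_le := @cvg_id _ (nbhs y); apply.
Unshelve. all: by end_near. Qed.

Lemma cvg_gauss_variance (y v : R) (u : nat -> R) : 0 <= v -> (forall n, 0 <= u n) ->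
  u n @[n --> \oo] --> v -> gauss f y (u n) @[n --> \oo] --> gauss f y v.
Proof.
move=> v0 u0 uv; apply/cvgrPdist_le => eps e0; have e2 : 0 < eps / 2 by lra.
have [C C0 h] := gauss_mean_variance tau0 cf sf e2.
have e3 : 0 < eps / (2 * (C + 1)) by rewrite divr_gt0// mulr_gt0// ltr_wpDl.
move/cvgrPdist_le : uv => /(_ _ e3) uv.
near=> n; apply: le_trans (h y v (u n) v0 (u0 n)) _.
have : `|v - u n| <= eps / (2 * (C + 1)).
  near: n; exact: uv.
rewrite ler_pdivlMr ?mulr_gt0 ?ltr_wpDl// => k.
have : 0 <= `|v - u n| by []. 
move: k; set w := `|_|; rewrite mulrCA mulrDr mulr1 (mulrC w); lra.
Unshelve. all: by end_near. Qed.

Lemma cvg_clock n : (0 < n)%N -> clock N n @[N --> \oo] --> tau2 * n%:R `^ (- dd).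
Proof.
move=> n0; rewrite -cvg_shiftS /clock/= -/tau2.
apply: cvgM; first exact: cvg_cst.
rewrite -[X in _ --> X]subr0; apply: cvgB; first exact: cvg_cst.
exact: cvg_powRN.
Qed.

(** The horizon [N] is sent to infinity: the walk at time [N] becomes [L] and the clock
becomes the total remaining variance. *)
Lemma limit_lindeberg (t0 kap : R) : 0 < t0 -> 0 <= kap -> exists2 C : R, 0 <= C &
  forall n (gam : seq R -> R) (eps : R), (0 < n)%N ->
  (forall x, 0 <= gam x <= kap * n%:R `^ (dd / 2)) ->
  (forall k, (n <= k)%N -> Ex k (fun x => `|ratio k x - ratio n (take n x)|) <= eps) ->
  `|\int[P]_w gauss f (gam (path X n w) *
        (endpoint (path X n w) / n%:R `^ a - L w)) t0
    - \int[P]_w gauss f 0 (t0 + gam (path X n w) ^+ 2 * ratio n (path X n w) * (tau2 * n%:R `^ (- dd)))|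
  <= C * (eps + n%:R `^ (b - 1) + n%:R `^ (- (b / 2))).
Proof.
move=> t00 kap0; have [C C0 hC] := smoothed_lindeberg t00 kap0.
exists C => // n gam eps n0 hg heps.
have [M M0 hM] := compactly_supported_bounded cf sf.
have gM y v : `|gauss f y v| <= M by exact: gauss_mean_bounded.
pose u N w := gauss f (gam (path X n w) *
   (endpoint (path X n w) / n%:R `^ a - endpoint (path X N w) / N%:R `^ a)) t0.
pose v N w := gauss f 0 (t0 + gam (path X n w) ^+ 2 * ratio n (path X n w) * clock N n).
have mpath m (G : seq R -> R) : measurable_fun setT (fun w => G (path X m w)).
  by have [] := @bounded_meas_path _ _ _ P X m G.
have mg y : measurable_fun setT y -> measurable_fun setT (fun w : T => gauss f (y w) t0).
  move=> my; apply: (measurableT_comp (f := fun y => gauss f y t0) _ my).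
  by apply: continuous_measurable_fun; exact: continuous_gauss.
have cu : \int[P]_w u N w @[N --> \oo] --> \int[P]_w gauss f (gam (path X n w) *
        (endpoint (path X n w) / n%:R `^ a - L w)) t0.
  apply: (@bounded_convergence _ _ _ P _ _ M) => //.
  - move=> N; apply: mg; apply: measurable_funM => //; apply: measurable_funB.
      exact: (mpath n (fun x => endpoint x / n%:R `^ a)).
    exact: (mpath N (fun x => endpoint x / N%:R `^ a)).
  - apply: mg; apply: measurable_funM => //; apply: measurable_funB => //.
    exact: (mpath n (fun x => endpoint x / n%:R `^ a)).
  - by move=> N w; exact: gM.
  - have h := ae_position_path hpqr hX.
    apply: filterS2 h hL => w h1 h2.
    apply: (@cvg_comp _ _ _ _ (fun y => gauss f y t0) _ _ _ _ (@continuous_gauss t0 _)).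
    apply: cvgM; first exact: cvg_cst.
    apply: cvgB; first exact: cvg_cst.
    apply: cvg_trans h2; apply: near_eq_cvg; apply: nearW => N /=.
    by have [-> _] := h1 N.
have cv : \int[P]_w v (N + n)%N w @[N --> \oo] --> \int[P]_w gauss f 0
    (t0 + gam (path X n w) ^+ 2 * ratio n (path X n w) * (tau2 * n%:R `^ (- dd))).
  have pos w : 0 <= gam (path X n w) ^+ 2 * ratio n (path X n w).
    by apply: mulr_ge0; [exact: sqr_ge0|exact: ratio_ge0].
  apply: (@bounded_convergence _ _ _ P _ _ M) => //.
  - by move=> N; exact: (mpath n (fun x => gauss f 0 (t0 + gam x ^+ 2 * ratio n x * clock (N + n) n))).
  - exact: (mpath n (fun x => gauss f 0 (t0 + gam x ^+ 2 * ratio n x * (tau2 * n%:R `^ (- dd))))).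
  - by move=> N w; exact: gM.
  - apply: aeW => w; apply: cvg_gauss_variance.
    + by rewrite addr_ge0 ?(ltW t00)// mulr_ge0// mulr_ge0 ?powR_ge0 ?(ltW tau20).
    + move=> N; rewrite addr_ge0 ?(ltW t00)// mulr_ge0//.
      by apply: (clock_ge0 hb hsup) => //; rewrite leq_addl.
    + apply: cvgD; first exact: cvg_cst.
      apply: cvgM; first exact: cvg_cst.
      exact: (@cvg_shift _ (fun N => clock N n) _ n (cvg_clock n0)).
have cu' : \int[P]_w u (N + n)%N w @[N --> \oo] --> \int[P]_w gauss f (gam (path X n w) *
        (endpoint (path X n w) / n%:R `^ a - L w)) t0.
  exact: (@cvg_shift _ (fun N => \int[P]_w u N w) _ n cu).
apply: (cvg_dist_le cu' cv) => N.
have nN : (n <= N + n)%N by rewrite leq_addl.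
have := hC n (N + n)%N gam eps n0 nN hg heps.
rewrite -!(mean_path hpqr hX).
suff -> : \int[P]_w gauss f (gam (take n (path X (N + n) w)) *
    (endpoint (take n (path X (N + n) w)) / n%:R `^ a -
     endpoint (path X (N + n) w) / (N + n)%:R `^ a)) t0 = \int[P]_w u (N + n)%N w by [].
by apply: eq_Rintegral => w _; rewrite take_path.
Qed.

(** The test function [f] is compared with its Gaussian smoothing at a small scale
[t0] chosen before [n]. *)
Lemma mean_test_gauss (kap : R) (gam : nat -> seq R -> R) : 0 <= kap ->
  (forall n x, 0 <= gam n x <= kap * n%:R `^ (dd / 2)) ->
  \int[P]_w f (gam n.+1 (path X n.+1 w) *
        (endpoint (path X n.+1 w) / n.+1%:R `^ a - L w))
    - \int[P]_w gauss f 0 (gam n.+1 (path X n.+1 w) ^+ 2 * ratio n.+1 (path X n.+1 w) *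
          (tau2 * n.+1%:R `^ (- dd))) @[n --> \oo] --> 0.
Proof.
move=> kap0 hg; apply/cvgrPdist_le => eps e0.
have e8 : 0 < eps / 8 by lra.
have esum : eps / 4 + eps / 2 + eps / 4 <= eps by lra.
have [C C0 hC] := gauss_mean_variance tau0 cf sf e8.
pose t0 := eps / (8 * (C + 1)).
have t00 : 0 < t0 by rewrite divr_gt0// mulr_gt0// ltr_wpDl.
have Ct0 : C * t0 <= eps / 8.
  rewrite /t0 mulrA ler_pdivrMr ?mulr_gt0 ?ltr_wpDl//.
  rewrite [leRHS](_ : _ = (C + 1) * eps); last by field.
  by rewrite ler_wpM2r ?(ltW e0)//; lra.
have t0e : eps / 8 + C * t0 <= eps / 4 by lra.
have [C' C'0 hC'] := limit_lindeberg t00 kap0.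
pose e1 := eps / (6 * (C' + 1)).
have e10 : 0 < e1 by rewrite divr_gt0// mulr_gt0// ltr_wpDl.
have Ce1 : C' * (e1 + e1 + e1) <= eps / 2.
  rewrite [leLHS](_ : _ = (C' / (C' + 1)) * (eps / 2)); last first.
    by rewrite /e1; field; rewrite gt_eqF// ltr_wpDl.
  by rewrite ler_piMl ?(ltW e0)//; [lra|rewrite ler_pdivrMr ?ltr_wpDl// mul1r; lra].
have [n0 hn0] := Ex_ratio_abs e10.
have b1 : 0 < 1 - b by move: hpqr hr0; lra.
have b2 : 0 < b / 2 by move: hb; lra.
have p1 := cvg_powRN b1; have p2 := cvg_powRN b2.
have [M M0 hM] := compactly_supported_bounded cf sf.
move/cvgrPdist_le : p1 => /(_ _ e10) p1; move/cvgrPdist_le : p2 => /(_ _ e10) p2.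
near=> n; rewrite sub0r normrN.
have nn0 : (n0 < n.+1)%N by rewrite ltnS; near: n; exact: nbhs_infty_ge.
have q1 : n.+1%:R `^ (b - 1) <= e1.
  rewrite -(opprB 1 b).
  have : `|0 - n.+1%:R `^ (- (1 - b))| <= e1 by near: n; exact: p1.
  by rewrite sub0r normrN ger0_norm ?powR_ge0.
have q2 : n.+1%:R `^ (- (b / 2)) <= e1.
  have : `|0 - n.+1%:R `^ (- (b / 2))| <= e1 by near: n; exact: p2.
  by rewrite sub0r normrN ger0_norm ?powR_ge0.
have bnd : C' * (e1 + n.+1%:R `^ (b - 1) + n.+1%:R `^ (- (b / 2))) <= eps / 2.
  apply: le_trans Ce1; apply: ler_wpM2l; first exact: C'0.
  by apply: lerD q2; apply: lerD q1.
have main := le_trans (hC' n.+1 (gam n.+1) e1 (ltn0Sn n) (hg n.+1) (fun k => hn0 n.+1 k nn0)) bnd.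
set y := fun w => gam n.+1 (path X n.+1 w) * (endpoint (path X n.+1 w) / n.+1%:R `^ a - L w).
set v := fun w => gam n.+1 (path X n.+1 w) ^+ 2 * ratio n.+1 (path X n.+1 w) *
          (tau2 * n.+1%:R `^ (- dd)).
have mpath m (G : seq R -> R) : measurable_fun setT (fun w => G (path X m w)).
  by have [] := @bounded_meas_path _ _ _ P X m G.
have my : measurable_fun setT y.
  apply: measurable_funM => //; apply: measurable_funB => //.
  exact: (mpath n.+1 (fun x => endpoint x / n.+1%:R `^ a)).
have v0 w : 0 <= v w.
  apply: mulr_ge0; last by rewrite mulr_ge0 ?powR_ge0 ?(ltW tau20).
  by apply: mulr_ge0; [exact: sqr_ge0|exact: ratio_ge0].
have bf : bounded_meas (fun w => f (y w)).
  split; last by exists M.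
  by apply: (measurableT_comp (f := f) _ my); exact: continuous_measurable_fun.
have bg : bounded_meas (fun w => gauss f (y w) t0).
  split; last by exists M => w; exact: gauss_mean_bounded.
  apply: (measurableT_comp (f := fun y => gauss f y t0) _ my).
  by apply: continuous_measurable_fun; exact: continuous_gauss.
have bv t : bounded_meas (fun w => gauss f 0 (t + v w)).
  exact: (bounded_meas_path X n.+1 (fun x => gauss f 0 (t + gam n.+1 x ^+ 2 * ratio n.+1 x *
          (tau2 * n.+1%:R `^ (- dd))))).
have close (g h : T -> R) : bounded_meas g -> bounded_meas h ->
    (forall w, `|g w - h w| <= eps / 4) -> `|\int[P]_w g w - \int[P]_w h w| <= eps / 4.
  move=> bg' bh gh; rewrite -RintegralB//; try exact: bounded_meas_integrable.
  have H := @abs_mean_le R _ T P _ _ (bounded_measB bg' bh) (bounded_meas_cst (eps / 4)).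
  apply: le_trans (H _) _.
    exact: aeW.
  by rewrite Rintegral_cst//= probability_setT mulr1.
have close1 := close _ _ bf bg _.
have close2 := close _ _ (bv t0) (bv 0) _.
have {}close1 : `|\int[P]_w f (y w) - \int[P]_w gauss f (y w) t0| <= eps / 4.
  apply: close1 => w; rewrite -{1}(gauss_mean0 tau f (y w)).
  apply: le_trans (hC _ _ _ _ _) _ => //; first exact: ltW.
  by rewrite sub0r normrN (gtr0_norm t00).
have {}close2 : `|\int[P]_w gauss f 0 (t0 + v w) - \int[P]_w gauss f 0 (0 + v w)| <= eps / 4.
  apply: close2 => w.
  apply: le_trans (hC _ _ _ _ _) _ => //; rewrite ?add0r ?addr_ge0 ?(ltW t00)//.
  by rewrite addrK (gtr0_norm t00).
have E : \int[P]_w gauss f 0 (0 + v w) = \int[P]_w gauss f 0 (v w).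
  by apply: eq_Rintegral => w _; rewrite add0r.
rewrite -E; apply: le_trans (ler_dist3 close1 main close2) _.
exact: esum.
Unshelve. all: by end_near. Qed.

End test_function.

End superdiffusive.
(** * Limit laws *)

Section limit_law.
Context {R : realType} d {T : measurableType d} (P : probability T R).
Context (p q r s : R) (X : nat -> {RV P >-> R}) (K : nat -> {RV P >-> nat})
  (e : nat -> {RV P >-> R}) (L : {RV P >-> R}).
Context (hp : 0 <= p) (hq : 0 <= q) (hr : 0 <= r) (hpqr : p + q + r = 1)
  (hs : 0 <= s <= 1) (hb : 0 < p + q) (hr0 : 0 < r) (hsup : p + q < 2 * (p - q))
  (hX : is_ERWS p q r s X K e)
  (hL : {ae P, forall w, position X n w / n%:R `^ (p - q) @[n --> \oo] --> L w}).
Local Notation b := (p + q).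
Local Notation a := (p - q).
Local Notation dd := (2 * (p - q) - (p + q)).
Local Notation ratio := (ratio p q).
Let tau2 : R := b / dd.
Let tau := Num.sqrt tau2.
Local Notation gauss := (gauss_mean tau).

Let dd0 : 0 < dd. Proof. by rewrite subr_gt0. Qed.
Let tau20 : 0 < tau2. Proof. by rewrite divr_gt0. Qed.
Let tau0 : 0 < tau. Proof. by rewrite sqrtr_gt0. Qed.

(** The variance clock cancels: [(n `^ (dd / 2)) ^+ 2 * n `^ (- dd) = 1]. *)
Let clock_cancel n : n.+1%:R `^ (dd / 2) ^+ 2 * n.+1%:R `^ (- dd) = 1 :> R.
Proof.
rewrite powR_expn mulrCA divff// mulr1 -powRD; last by rewrite pnatr_eq0 implybT.
by rewrite subrr powRr0.
Qed.

Let pow_split n : n.+1%:R `^ a = n.+1%:R `^ (b / 2) * n.+1%:R `^ (dd / 2) :> R.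
Proof.
rewrite -powRD; last by rewrite pnatr_eq0 implybT.
by congr (_ `^ _); field.
Qed.

Let pow_half n : n.+1%:R `^ (b / 2) ^+ 2 = n.+1%:R `^ b :> R.
Proof. by rewrite powR_expn mulrCA divff// mulr1. Qed.

Let deviation n (w : T) := position X n w - n%:R `^ a * L w.

(** Both normalisations are [c * n `^ (b / 2)], with [c ^+ 2] the normalised weight or
one; the deviation is then [n `^ (dd / 2) / c] times the remainder of the martingale. *)
Let deviationE n (c : R) w : position X n.+1 w = endpoint (path X n.+1 w) ->
  c != 0 -> deviation n.+1 w / (c * n.+1%:R `^ (b / 2)) =
  n.+1%:R `^ (dd / 2) / c * (endpoint (path X n.+1 w) / n.+1%:R `^ a - L w).
Proof.
move=> E c0; rewrite /deviation E pow_split.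
have h1 : n.+1%:R `^ (b / 2) != 0 :> R by rewrite gt_eqF// powR_gt0.
have h2 : n.+1%:R `^ (dd / 2) != 0 :> R by rewrite gt_eqF// powR_gt0.
move: h1 h2; set u := _ `^ (b / 2); set v := _ `^ (dd / 2) => h1 h2.
by field; rewrite h1 h2 c0.
Qed.

Let mpath m (G : seq R -> R) : measurable_fun setT (fun w => G (path X m w)).
Proof. by have [] := @bounded_meas_path _ _ _ P X m G. Qed.

Let measurable_position n : measurable_fun setT (position X n : T -> R).
Proof. by apply: measurable_sum => k; exact: measurable_funP. Qed.

Let measurable_ones n : measurable_fun setT (ones X n : T -> R).
Proof. by apply: measurable_sum => k; apply: measurable_funX; exact: measurable_funP. Qed.

Let measurable_deviation n : measurable_fun setT (deviation n).
Proof. by apply: measurable_funB => //; exact: measurable_funM. Qed.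

Let measurable_normalised n (v : T -> R) : measurable_fun setT v ->
  measurable_fun setT (fun w => deviation n w / Num.sqrt (v w)).
Proof.
move=> mv; apply: measurable_funM => //.
rewrite (_ : (fun w => (Num.sqrt (v w))^-1) = (fun w => Num.sqrt (v w) `^ (- 1))).
  apply: (measurableT_comp (f := fun x : R => x `^ (- 1))); first exact: measurable_powR.
  apply: (measurableT_comp (f := (@Num.sqrt R : R -> R))) => //.
  by apply: continuous_measurable_fun; exact: sqrt_continuous.
by apply/funext => w; rewrite powR_inv1// sqrtr_ge0.
Qed.

Section limit_variable.
Let Y n w := ratio n.+1 (path X n.+1 w).

Let bY n : bounded_meas (Y n). Proof. exact: bounded_meas_path. Qed.
Let Y0 n w : 0 <= Y n w. Proof. exact: ratio_ge0. Qed.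

Let hY eps : 0 < eps -> exists n0, forall n N, (n0 <= n)%N -> (n <= N)%N ->
  \int[P]_w (Y N w - Y n w) ^+ 2 <= eps.
Proof.
move=> e0; have [n0 h] := Ex_ratio_cauchy hp hq hr hpqr hs hb e0.
exists n0 => n N n0n nN; apply: le_trans (h n N n0n nN).
rewrite -(mean_path hpqr hX) le_eqVlt; apply/orP; left; apply/eqP.
by apply: eq_Rintegral => w _; rewrite take_path.
Qed.

Let hmom m : \int[P]_w (Y n w ^+ m) @[n --> \oo] --> m`!%:R / Gamma (1 + m%:R * b).
Proof.
have := @Ex_weightX_cvg _ p q r s hp hq hr hpqr hs hb m; apply: cvg_trans.
apply: near_eq_cvg; apply: nearW => n.
exact: esym (mean_path hpqr hX n.+1 (fun x => ratio n.+1 x ^+ m)).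
Qed.

(** [Gamma (1 + m * b)] is at least [c `^ (m * b) * expR (- c)] for every [c]; the choice
of [c] makes the series dominated by a geometric one. *)
Lemma moment_series_bounded (t : R) : exists C : R, forall N,
  \sum_(0 <= m < N) `|t| ^+ m * (m`!%:R / Gamma (1 + m%:R * b)) / m`!%:R <= C.
Proof.
pose c := (2 * (`|t| + 1)) `^ b^-1.
have t1 : 0 < 2 * (`|t| + 1) :> R by rewrite mulr_gt0// ltr_wpDl.
have c0 : 0 < c by rewrite powR_gt0.
have cb m : c `^ (m%:R * b) = (2 * (`|t| + 1)) ^+ m.
  by rewrite /c -powRrM mulrCA mulVf ?gt_eqF// mulr1 powR_mulrn// ltW.
exists (expR c * 2) => N.
have Gm m : 0 < Gamma (1 + m%:R * b).
  by apply: Gamma_gt0; rewrite lerDl mulr_ge0// ltW.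
apply: (@le_trans _ _ (\sum_(0 <= m < N) expR c * 2^-1 ^+ m)).
  apply: ler_sum => m _; have := @Gamma_ge _ c (1 + m%:R * b) c0.
  rewrite addrAC subrr add0r cb lerDl mulr_ge0 ?(ltW hb)// => /(_ isT) G.
  rewrite mulrA -[leLHS]mulrA mulrAC [leLHS](_ : _ = `|t| ^+ m / Gamma (1 + m%:R * b)); last first.
    by field; rewrite gt_eqF//= pnatr_eq0 -lt0n fact_gt0.
  rewrite ler_pdivrMr//; apply: le_trans (ler_wpM2l _ G); last first.
    by rewrite mulr_ge0 ?expR_ge0// exprn_ge0// invr_ge0.
  rewrite [leRHS](_ : _ = (expR c * expR (- c)) * ((2^-1 * (2 * (`|t| + 1))) ^+ m)); last first.
    by rewrite [in RHS]exprMn; ring.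
  rewrite -expRD subrr expR0 mul1r mulrA mulVf// mul1r.
  by rewrite lerXn2r ?nnegrE ?addr_ge0// lerDl.
rewrite -mulr_sumr ler_wpM2l ?expR_ge0//.
have h2 : 1 - 2^-1 != 0 :> R by apply/eqP; lra.
have -> : \sum_(0 <= m < N) 2^-1 ^+ m = (1 - 2^-1 ^+ N) * 2 :> R.
  elim: N => [|N IH]; first by rewrite big_geq// expr0 subrr mul0r.
  by rewrite big_nat_recr//= IH exprS; field.
have : 0 <= 2^-1 ^+ N :> R by rewrite exprn_ge0.
lra.
Qed.

Lemma limit_ratio : exists Z : {RV P >-> R}, [/\ forall w, 0 <= Z w,
  forall eps, 0 < eps -> exists n0, forall n, (n0 <= n)%N ->
    (\int[P]_w ((ratio n.+1 (path X n.+1 w) - Z w) ^+ 2)%:E <= eps%:E)%E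
  & mittag_leffler b Z].
Proof.
have [Z [nn [Z0 _ nnj cZ]]] := mean_square_limit bY Y0 hY.
exists Z; split => //; first by move=> eps e0; exact: (mean_square_cvg bY hY nnj cZ).
move=> t; have [C hC] := moment_series_bounded t.
have := mgf_of_moments bY Y0 hY Z0 nnj cZ hmom hC.
apply: cvg_trans; apply: near_eq_cvg; apply: nearW => N /=; congr (_%:E).
apply: eq_bigr => m _; field.
rewrite pnatr_eq0 -lt0n fact_gt0 /= gt_eqF//; apply: Gamma_gt0.
by rewrite lerDl mulr_ge0// ltW.
Qed.

End limit_variable.

Section test.
Context (f : R -> R) (cf : continuous f) (sf : compactly_supported f).

Let bounded_meas_test (W : T -> R) : measurable_fun setT W -> bounded_meas (fun w => f (W w)).
Proof.
move=> mW; have [M M0 hM] := compactly_supported_bounded cf sf; split; last by exists M.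
by apply: (measurableT_comp (f := f) _ mW); exact: continuous_measurable_fun.
Qed.

Let measurable_gauss (V : T -> R) : measurable_fun setT V -> (forall w, 0 <= V w) ->
  measurable_fun setT (fun w => gauss f 0 (V w)).
Proof.
move=> mV V0; pose g (v : R) : R := gauss f 0 (Num.max 0 v).
rewrite (_ : (fun w => gauss f 0 (V w)) = g \o V); last first.
  by apply/funext => w; rewrite /g /= (max_idPr (V0 w)).
apply: measurableT_comp => //.
apply: continuous_measurable_fun => v; apply/cvgrPdist_le => eps e0; have e2 : 0 < eps / 2 by lra.
have [C C0 hC] := gauss_mean_variance tau0 cf sf e2.
have e3 : 0 < eps / (2 * (C + 1)) by rewrite divr_gt0// mulr_gt0// ltr_wpDl.
have /cvgrPdist_le/(_ _ e3) vz := @cvg_id _ (nbhs v).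
near=> z; apply: le_trans (hC _ _ _ _ _) _; rewrite ?le_max ?lexx//.
have k1 : `|Num.max 0 v - Num.max 0 z| <= `|v - z|.
  by rewrite !maxEle; case: (leP 0 v) => ?; case: (leP 0 z) => ?;
     rewrite !ler_norml; case: (ler0P (v - z)) => ?; apply/andP; split; lra.
have k2 : `|v - z| <= eps / (2 * (C + 1)) by near: z; exact: vz.
have k3 : C * `|Num.max 0 v - Num.max 0 z| <= C * (eps / (2 * (C + 1))).
  by rewrite ler_wpM2l// (le_trans k1).
have k4 : C * (eps / (2 * (C + 1))) <= eps / 2.
  rewrite [leLHS](_ : _ = C / (C + 1) * (eps / 2)); last by field; rewrite gt_eqF// ltr_wpDl.
  by rewrite ler_piMl ?(ltW e2)// ler_pdivrMr ?ltr_wpDl// mul1r lerDl.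
rewrite [leRHS](_ : _ = eps / 2 + eps / 2); last by field.
by rewrite lerD2l (le_trans k3).
Unshelve. all: by end_near. Qed.

(** Freezing the proportion of ones below the level [dl] keeps the normalising factor
bounded; the walks on which this changes something are rare. *)
Lemma random_normalisation_cvg :
  \int[P]_w f (deviation n.+1 w / Num.sqrt (ones X n.+1 w)) @[n --> \oo] --> gauss f 0 tau2.
Proof.
have [M M0 hM] := compactly_supported_bounded cf sf.
apply/cvgrPdist_le => eps e0.
(* The bad walks have probability at most [2 * sqrt dl], and each of the two
   modifications costs at most [2 * M] on them. *)
pose dl := (eps / (16 * (M + 1))) ^+ 2.
have k0 : 0 < eps / (16 * (M + 1)) by rewrite divr_gt0// mulr_gt0// ltr_wpDl.
have dl0 : 0 < dl by rewrite exprn_gt0.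
have sdl : Num.sqrt dl = eps / (16 * (M + 1)) by rewrite sqrtr_sqr gtr0_norm.
have Mdl : 2 * M * (2 * Num.sqrt dl) <= eps / 4.
  rewrite sdl [leLHS](_ : _ = M / (M + 1) * (eps / 4)); last by field; rewrite gt_eqF// ltr_wpDl.
  by rewrite ler_piMl//; [lra|rewrite ler_pdivrMr ?ltr_wpDl// mul1r lerDl].
have e2 : 0 < eps / 2 by lra.
have esum : eps / 4 + eps / 2 + eps / 4 <= eps by lra.
pose m n x := Num.max (ratio n x) dl.
have m0 n x : 0 < m n x by rewrite lt_max dl0 orbT.
pose gam n x : R := n%:R `^ (dd / 2) / Num.sqrt (m n x).
have sm0 n x : 0 < Num.sqrt (m n x) by rewrite sqrtr_gt0.
have hg n x : 0 <= gam n x <= (Num.sqrt dl)^-1 * n%:R `^ (dd / 2).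
  apply/andP; split; first by rewrite divr_ge0 ?powR_ge0 ?sqrtr_ge0.
  rewrite /gam mulrC ler_wpM2r ?powR_ge0//.
  by rewrite lef_pV2 ?posrE ?sqrtr_gt0// ler_wsqrtr// le_max lexx orbT.
have kap0 : 0 <= (Num.sqrt dl)^-1 by rewrite invr_ge0 sqrtr_ge0.
have := @mean_test_gauss R d T P p q r s X K e L hp hq hr hpqr hs hb hr0 hsup hX hL
  f cf sf _ gam kap0 hg.
move/cvgrPdist_le => /(_ _ e2) hlim.
pose y n w := gam n.+1 (path X n.+1 w) * (endpoint (path X n.+1 w) / n.+1%:R `^ a - L w).
pose v n w := gam n.+1 (path X n.+1 w) ^+ 2 * ratio n.+1 (path X n.+1 w) *
  (tau2 * n.+1%:R `^ (- dd)).
have {}hlim : \forall n \near \oo,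
    `|\int[P]_w f (y n w) - \int[P]_w gauss f 0 (v n w)| <= eps / 2.
  by apply: filterS hlim => n; rewrite sub0r normrN.
pose bad n (x : seq R) : R := (weight x < dl * n%:R `^ b)%R%:R.
have hbad n : \int[P]_w bad n.+1 (path X n.+1 w) <= 2 * Num.sqrt dl.
  by rewrite (mean_path hpqr hX); exact: (Ex_weight_small hp hq hr hpqr hs hb (ltn0Sn n) (ltW dl0)).
have good n x : (0 < n)%N -> bad n x = 0 -> m n x = ratio n x.
  move=> n0; rewrite /bad; case: ltP => [_ /eqP|h _]; first by rewrite oner_eq0.
  by apply/max_idPl; rewrite ler_pdivlMr// powR_gt0 ?ltr0n//.
have bad01 n x : bad n x = 0 \/ bad n x = 1 by rewrite /bad; case: ltP; [right|left].
have hbadM n : 2 * M * (\int[P]_w bad n.+1 (path X n.+1 w)) <= eps / 4.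
  by apply: le_trans Mdl; rewrite ler_wpM2l// mulr_ge0.
have bbad n : bounded_meas (fun w => bad n (path X n w)) by exact: bounded_meas_path.
have close n (g h : T -> R) : bounded_meas g -> bounded_meas h ->
    {ae P, forall w, `|g w - h w| <= 2 * M * bad n.+1 (path X n.+1 w)} ->
    `|\int[P]_w g w - \int[P]_w h w| <= eps / 4.
  move=> bg bh gh; apply: le_trans (hbadM n).
  have bB := bounded_measB bg bh.
  rewrite -RintegralB//; try exact: bounded_meas_integrable.
  rewrite -meanZ//; apply: abs_mean_le => //.
  by apply: bounded_measM => //; exact: bounded_meas_cst.
have two_bound (x1 x2 : R) : `|x1| <= M -> `|x2| <= M -> `|x1 - x2| <= 2 * M.
  by move=> ? ?; apply: le_trans (ler_normB _ _) _; rewrite mulr_natl mulr2n lerD.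
near=> n.
have main : `|\int[P]_w f (y n w) - \int[P]_w gauss f 0 (v n w)| <= eps / 2.
  by near: n; exact: hlim.
have my : measurable_fun setT (y n).
  apply: measurable_funM; first exact: (mpath n.+1 (gam n.+1)).
  by apply: measurable_funB => //; exact: (mpath n.+1 (fun x => endpoint x / n.+1%:R `^ a)).
have b1 := bounded_meas_test my.
have b2 : bounded_meas (fun w => f (deviation n.+1 w / Num.sqrt (ones X n.+1 w))).
  by apply: bounded_meas_test; exact: measurable_normalised.
have b3 : bounded_meas (fun w => gauss f 0 (v n w)).
  exact: (bounded_meas_path X n.+1 (fun x => gauss f 0 (gam n.+1 x ^+ 2 * ratio n.+1 x *
    (tau2 * n.+1%:R `^ (- dd))))).
have c1 : `|\int[P]_w f (deviation n.+1 w / Num.sqrt (ones X n.+1 w)) - \int[P]_w f (y n w)| <= eps / 4.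
  apply: (close n _ _ b2 b1).
  apply: filterS (ae_position_path hpqr hX) => w /(_ n.+1)[E1 E2].
  have [b0|->] := bad01 n.+1 (path X n.+1 w); last by rewrite mulr1; exact: two_bound.
  rewrite b0 mulr0; have mr := good n.+1 _ isT b0; have := m0 n.+1 (path X n.+1 w).
  have -> : Num.sqrt (ones X n.+1 w) = Num.sqrt (m n.+1 (path X n.+1 w)) * n.+1%:R `^ (b / 2).
    rewrite mr E2 -[n.+1%:R `^ (b / 2)]ger0_norm ?powR_ge0// -sqrtr_sqr -sqrtrM ?ratio_ge0//.
    by rewrite pow_half /ratio divfK// gt_eqF// powR_gt0.
  by move=> _; rewrite deviationE ?gt_eqF// subrr normr0.
have c2 : `|\int[P]_w gauss f 0 (v n w) - gauss f 0 tau2| <= eps / 4.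
  have -> : gauss f 0 tau2 = \int[P]_w gauss f 0 tau2.
    by rewrite Rintegral_cst//= probability_setT mulr1.
  apply: (close n _ _ b3 (bounded_meas_cst _)); apply: aeW => w.
  have [b0|->] := bad01 n.+1 (path X n.+1 w).
    have mr := good n.+1 _ isT b0; rewrite b0 mulr0.
    have -> : v n w = tau2.
      rewrite /v /gam -mr expr_div_n sqr_sqrtr ?(ltW (m0 _ _))// divfK ?gt_eqF//.
      by rewrite mulrCA clock_cancel mulr1.
    by rewrite subrr normr0.
  by rewrite mulr1; apply: two_bound; exact: gauss_mean_bounded.
rewrite distrC; apply: le_trans (ler_dist3 c1 main c2) _.
exact: esum.
Unshelve. all: by end_near. Qed.

(** With the deterministic normalisation the conditional variance is [tau2] times the
proportion of ones, whose limit is [Z]. *)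
Lemma deterministic_normalisation_cvg (Z : {RV P >-> R}) : (forall w, 0 <= Z w) ->
  (forall eps, 0 < eps -> exists n0, forall n, (n0 <= n)%N ->
    (\int[P]_w ((ratio n.+1 (path X n.+1 w) - Z w) ^+ 2)%:E <= eps%:E)%E) ->
  \int[P]_w f (deviation n.+1 w / Num.sqrt (n.+1%:R `^ b)) @[n --> \oo] -->
  \int[P]_w gauss f 0 (tau2 * Z w).
Proof.
move=> Z0 hZ; have [M M0 hM] := compactly_supported_bounded cf sf.
apply/cvgrPdist_le => eps e0.
have e2 : 0 < eps / 2 by lra.
have e8 : 0 < eps / 8 by lra.
pose gam n (x : seq R) : R := n%:R `^ (dd / 2).
have hg n x : 0 <= gam n x <= 1 * n%:R `^ (dd / 2) by rewrite mul1r lexx powR_ge0.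
have := @mean_test_gauss R d T P p q r s X K e L hp hq hr hpqr hs hb hr0 hsup hX hL
  f cf sf 1 gam ler01 hg.
move/cvgrPdist_le => /(_ _ e2) hlim.
pose y n w := gam n.+1 (path X n.+1 w) * (endpoint (path X n.+1 w) / n.+1%:R `^ a - L w).
pose v n w := gam n.+1 (path X n.+1 w) ^+ 2 * ratio n.+1 (path X n.+1 w) *
  (tau2 * n.+1%:R `^ (- dd)).
have {}hlim : \forall n \near \oo,
    `|\int[P]_w f (y n w) - \int[P]_w gauss f 0 (v n w)| <= eps / 2.
  by apply: filterS hlim => n; rewrite sub0r normrN.
have [C C0 hC] := gauss_mean_variance tau0 cf sf e8.
pose eta := eps / (8 * (C * tau2 + 1)).
have Ct0 : 0 <= C * tau2 by rewrite mulr_ge0// ltW.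
have eta0 : 0 < eta by rewrite divr_gt0// mulr_gt0// ltr_wpDl.
have Ceta : C * tau2 * eta <= eps / 8.
  rewrite /eta [leLHS](_ : _ = C * tau2 / (C * tau2 + 1) * (eps / 8)); last first.
    by field; rewrite gt_eqF// ltr_wpDl.
  by rewrite ler_piMl ?(ltW e8)// ler_pdivrMr ?ltr_wpDl// mul1r lerDl.
have esum : eps / 2 + (eps / 8 + eps / 8) <= eps by lra.
have eta20 : 0 < eta ^+ 2 by rewrite exprn_gt0.
have [n0 hn0] := hZ _ eta20.
near=> n.
have nn0 : (n0 <= n)%N by near: n; exact: nbhs_infty_ge.
have main : `|\int[P]_w f (y n w) - \int[P]_w gauss f 0 (v n w)| <= eps / 2.
  by near: n; exact: hlim.
have vE w : v n w = tau2 * ratio n.+1 (path X n.+1 w).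
  rewrite /v /gam; move: (clock_cancel n); set u := _ `^ (dd / 2); set x := _ `^ (- dd) => ux.
  by rewrite -[RHS]mul1r -[X in _ = X * _]ux; ring.
have c1 : \int[P]_w f (deviation n.+1 w / Num.sqrt (n.+1%:R `^ b)) = \int[P]_w f (y n w).
  apply: ae_eq_mean.
  - by apply: bounded_meas_test; exact: measurable_normalised.
  - apply: bounded_meas_test; apply: measurable_funM => //; apply: measurable_funB => //.
    exact: (mpath n.+1 (fun x => endpoint x / n.+1%:R `^ a)).
  - apply: filterS (ae_position_path hpqr hX) => w /(_ n.+1)[E1 _].
    have -> : Num.sqrt (n.+1%:R `^ b) = 1 * n.+1%:R `^ (b / 2) :> R.
      by rewrite mul1r -pow_half sqrtr_sqr ger0_norm ?powR_ge0.
    by rewrite deviationE ?oner_eq0// divr1.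
have c2 : `|\int[P]_w gauss f 0 (v n w) - \int[P]_w gauss f 0 (tau2 * Z w)| <= eps / 8 + eps / 8.
  pose Yn w := ratio n.+1 (path X n.+1 w).
  have mY : measurable_fun setT Yn by exact: mpath.
  have mYZ : measurable_fun setT (fun w => (Yn w - Z w) ^+ 2).
    by apply: measurable_funX; exact: measurable_funB.
  have hn := hn0 n nn0; rewrite -/(Yn _) in hn.
  have iD : P.-integrable setT (fun w => ((Yn w - Z w) ^+ 2)%:E).
    apply/integrableP; split; first exact/measurable_EFinP.
    under eq_integral do rewrite gee0_abs ?lee_fin ?sqr_ge0//.
    by apply: le_lt_trans hn _; rewrite ltry.
  have hn' : \int[P]_w ((Yn w - Z w) ^+ 2) <= eta ^+ 2.
    by rewrite -lee_fin /Rintegral fineK//; exact: integrable_fin_num.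
  have b1 : bounded_meas (fun w => gauss f 0 (v n w)).
    exact: (bounded_meas_path X n.+1 (fun x => gauss f 0 (gam n.+1 x ^+ 2 * ratio n.+1 x *
      (tau2 * n.+1%:R `^ (- dd))))).
  have b2 : bounded_meas (fun w => gauss f 0 (tau2 * Z w)).
    split; last by exists M => w; exact: gauss_mean_bounded.
    apply: measurable_gauss; first exact: measurable_funM.
    by move=> w; rewrite mulr_ge0// ltW.
  rewrite -RintegralB//; try exact: bounded_meas_integrable.
  have i12 := integrable_EFinB measurableT (bounded_meas_integrable P b1) (bounded_meas_integrable P b2).
  pose c0 := C * tau2 * (2 * eta)^-1; pose c3 := eps / 8 + C * tau2 * (eta / 2).
  have i3 : P.-integrable setT (fun w => (c0 * (Yn w - Z w) ^+ 2)%:E) by exact: integrable_EFinZ.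
  have i4 : P.-integrable setT (fun w : T => c3%:E).
    exact: (bounded_meas_integrable P (bounded_meas_cst c3)).
  apply: le_trans (le_normr_Rintegral _ _) _ => //.
  apply: (@le_trans _ _ (\int[P]_w (c0 * (Yn w - Z w) ^+ 2 + c3))).
    apply: le_Rintegral => //.
    - by have := integrable_abse i12; congr (integrable _ _ _).
    - exact: integrable_EFinD.
    - move=> w _; apply: le_trans (hC _ _ _ _ _) _.
      + by rewrite vE mulr_ge0 ?(ltW tau20)// ratio_ge0.
      + by rewrite mulr_ge0// ltW.
      rewrite vE -mulrBr normrM (gtr0_norm tau20) -/(Yn w).
      have h := ler_wpM2l Ct0 (abs_le_sqr (Yn w - Z w) eta0).
      rewrite [C * (tau2 * _)]mulrA; apply: le_trans (lerD (lexx (eps / 8)) h) _.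
      by rewrite le_eqVlt; apply/orP; left; apply/eqP; rewrite /c0 /c3; ring.
  rewrite (RintegralD measurableT i3 i4) (RintegralZl _ measurableT iD).
  rewrite [X in _ + X](_ : _ = c3); last by rewrite Rintegral_cst//= probability_setT mulr1.
  have k1 : c0 * (\int[P]_w ((Yn w - Z w) ^+ 2)) <= c0 * eta ^+ 2.
    by rewrite ler_wpM2l// mulr_ge0// invr_ge0 mulr_ge0// ltW.
  have k2 : c0 * eta ^+ 2 + c3 = eps / 8 + C * tau2 * eta.
    by rewrite /c0 /c3; field; rewrite gt_eqF.
  apply: (@le_trans _ _ (c0 * eta ^+ 2 + c3)); first by rewrite lerD2r.
  by rewrite k2 lerD2l.
rewrite distrC c1; apply: le_trans (ler_distD (\int[P]_w gauss f 0 (v n w)) _ _) _.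
apply: le_trans esum; exact: lerD.
Unshelve. all: by end_near. Qed.

End test.

Let sqrt_tau2 z : 0 <= z -> Num.sqrt (tau2 * z) / tau = Num.sqrt z.
Proof. by move=> z0; rewrite sqrtrM ?(ltW tau20)// -/tau mulrAC divff ?mul1r// gt_eqF. Qed.

Let gauss_scale (f : R -> R) z : 0 <= z ->
  gauss f 0 (tau2 * z) = \int[normal_prob 0 tau]_u f (Num.sqrt z * u).
Proof.
by move=> z0; apply: eq_Rintegral => u _; rewrite add0r sqrt_tau2.
Qed.

Lemma random_normalisation_cvg_in_law :
  cvg_in_law P (fun n w => (position X n w - n%:R `^ a * L w) / Num.sqrt (ones X n w))
    (normal_prob 0 tau).
Proof.
pose N : probability (measurableTypeR R) R := normal_prob 0 tau.
have mid : measurable_fun setT (fun u : measurableTypeR R => u : R) by exact: measurable_id.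
have mdev n : measurable_fun setT (fun w => deviation n w / Num.sqrt (ones X n w)).
  exact: measurable_normalised.
apply: (@cvg_in_law_of_test R d T P _ _ _ N _ _ mdev mid) => [f cf [M hM]|f cf sf].
  rewrite /Rintegral fineK//; apply: integrable_fin_num => //.
  apply: bounded_meas_integrable; split; last by exists M.
  exact: continuous_measurable_fun.
rewrite -(cvg_shiftS (fun n => \int[P]_w f (deviation n w / Num.sqrt (ones X n w)))).
have -> : \int[normal_prob 0 tau]_x f x = gauss f 0 (tau2 * 1).
  by rewrite gauss_scale//; apply: eq_Rintegral => u _; rewrite sqrtr1 mul1r.
by rewrite mulr1; exact: random_normalisation_cvg.
Qed.

Lemma exists_random_variable d' {S : measurableType d'} (Q : probability S R) (f : S -> R) :
  measurable_fun setT f -> exists Z : {RV Q >-> R}, forall w, Z w = f w.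
Proof.
move=> mf; pose M := @isMeasurableFun.Build _ _ _ _ f mf.
by exists (HB.pack_for {RV Q >-> R} f M).
Qed.

(** The mixing variable and the Gaussian variable are made independent on the product
of the original space with the Gaussian line. *)
Lemma deterministic_normalisation_cvg_in_law :
  exists (d' : measure_display) (T' : measurableType d')
    (Q : probability T' R) (Sigma' Z W : {RV Q >-> R}),
    [/\ mittag_leffler b Sigma',
        forall A, measurable A -> distribution Q Z A = normal_prob 0 tau A,
        independent_RV Sigma' Z,
        forall w, W w = Num.sqrt (Sigma' w) * Z w
      & cvg_in_law P (fun n w => (position X n w - n%:R `^ a * L w) / Num.sqrt (n%:R `^ b))
          (distribution Q W)].
Proof.
have [Z [Z0 hZ mlZ]] := limit_ratio.
pose N : probability (measurableTypeR R) R := normal_prob 0 tau.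
pose Q : probability (T * measurableTypeR R)%type R := (P \x N)%E.
have mZ : measurable_fun setT Z by exact: measurable_funP.
have mfst : measurable_fun setT (fun wu : T * measurableTypeR R => Z wu.1).
  exact: (measurableT_comp mZ measurable_fst).
have msnd : measurable_fun setT (fun wu : T * measurableTypeR R => wu.2 : R).
  exact: measurable_snd.
have msq : measurable_fun setT (fun wu : T * measurableTypeR R => Num.sqrt (Z wu.1)).
  apply: (measurableT_comp (f := (@Num.sqrt R : R -> R)) _ mfst).
  by apply: continuous_measurable_fun; exact: sqrt_continuous.
have [Sg SgE] := exists_random_variable Q mfst.
have [G GE] := exists_random_variable Q msnd.
have [W WE] := exists_random_variable Q (measurable_funM msq msnd).
have Qprod A B : measurable A -> measurable B -> Q (A `*` B) = (P A * N B)%E.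
  by move=> mA mB; exact: product_measure1E.
have mpre A : measurable A -> measurable (Z @^-1` A).
  by move=> mA; rewrite -[X in measurable X]setTI; exact: mZ.
have SgA A : Sg @^-1` A = (Z @^-1` A) `*` setT.
  by apply/seteqP; split => -[w u] /=; rewrite SgE//= => -[].
have GB B : G @^-1` B = setT `*` B.
  by apply/seteqP; split => -[w u] /=; rewrite GE//= => -[].
exists _, _, Q, Sg, G, W; split.
- move=> t; have := mlZ t; rewrite /mmt_gen_fun.
  have -> : ('E_Q[expR \o t \o* Sg] = 'E_P[expR \o t \o* Z])%E.
    have expE d1 (S : measurableType d1) (Q1 : probability S R) (g : S -> R) :
      ('E_Q1[g] = \int[Q1]_w (g w)%:E)%E by rewrite unlock.
    rewrite !expE.
    have -> : (\int[Q]_wu ((expR \o t \o* Sg) wu)%:E = \int[Q]_wu (expR (Z wu.1 * t))%:E)%E.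
      by apply: eq_integral => wu _; rewrite /= SgE.
    rewrite /Q fubini_tonelli1.
    + by apply: eq_integral => w _; rewrite /fubini_F/= integral_cst//= probability_setT mule1.
    + apply/measurable_EFinP; apply: measurableT_comp => //.
      exact: measurable_funM.
    + by move=> wu; rewrite lee_fin expR_ge0.
  by [].
- move=> A mA; rewrite /distribution/= /pushforward/= GB Qprod//.
  by rewrite probability_setT mul1e.
- move=> A B mA mB; rewrite SgA GB.
  have -> : ((Z @^-1` A) `*` setT) `&` (setT `*` B) = (Z @^-1` A) `*` B.
    by apply/seteqP; split => -[w u] /=; tauto.
  rewrite !Qprod//; try exact: mpre.
  by rewrite !probability_setT mule1 mul1e.
- by move=> w; rewrite WE SgE GE.
- have mdev n : measurable_fun setT (fun w => deviation n w / Num.sqrt (n%:R `^ b)).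
    exact: measurable_normalised.
  have mW : measurable_fun setT W by exact: measurable_funP.
  have bfW (f : R -> R) : continuous f -> (exists M, forall x, `|f x| <= M) ->
      bounded_meas (fun wu => f (W wu)).
    move=> cf [M hM]; split; last by exists M.
    by apply: (measurableT_comp (f := f)); first exact: continuous_measurable_fun.
  apply: (@cvg_in_law_of_test R d T P _ _ _ Q W _ mdev mW) => [f cf hM|f cf sf].
    have ifW := bounded_meas_integrable Q (bfW f cf hM).
    have mf : measurable_fun [set: measurableTypeR R] (EFin \o f).
      by apply/measurable_EFinP; exact: continuous_measurable_fun.
    rewrite /Rintegral fineK; last exact: integrable_fin_num.
    exact: (@integral_pushforward _ _ _ (measurableTypeR R) R W mW Q setT (EFin \o f) mf ifW).
  rewrite -(cvg_shiftS (fun n => \int[P]_w f (deviation n w / Num.sqrt (n%:R `^ b)))).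
  suff -> : \int[Q]_wu f (W wu) = \int[P]_w gauss f 0 (tau2 * Z w).
    exact: deterministic_normalisation_cvg.
  have [M M0 hM] := compactly_supported_bounded cf sf.
  have ifW : Q.-integrable setT (fun wu => (f (W wu))%:E).
    by apply: bounded_meas_integrable; apply: bfW => //; exists M.
  congr fine.
  rewrite -integral12_prod_meas1//; apply: eq_integral => w _.
  rewrite /fubini_F gauss_scale//.
  have bfw : bounded_meas (fun u : measurableTypeR R => f (Num.sqrt (Z w) * u)).
    split; last by exists M.
    apply: (measurableT_comp (f := f)); first exact: continuous_measurable_fun.
    exact: measurable_funM.
  rewrite /Rintegral fineK; last by apply: integrable_fin_num => //; exact: (bounded_meas_integrable N bfw).
  by apply: eq_integral => u _; rewrite /= WE.
Qed.

End limit_law.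

Theorem theorem3p9 (R : realType) (d : measure_display) (T : measurableType d)
    (P : probability T R) (p q r s : R)
    (X : nat -> {RV P >-> R}) (K : nat -> {RV P >-> nat})
    (e : nat -> {RV P >-> R}) (L : {RV P >-> R})
    (hp : 0 <= p <= 1) (hq : 0 <= q <= 1) (hpqr : p + q + r = 1)
    (hr : 0 < r < 1) (hs : 0 <= s <= 1)
    (hX : is_ERWS p q r s X K e)
    (hsuper : 3 / 4 < p / (1 - r))
    (hL : {ae P, forall w,
      position X n w / n%:R `^ (2 * p + r - 1) @[n --> \oo] --> L w}) :
  let tau2 := (1 - r) / (4 * p - 3 * (1 - r)) in
  cvg_in_law P
    (fun n w => (position X n w - n%:R `^ (2 * p + r - 1) * L w)
                / Num.sqrt (ones X n w))
    (normal_prob 0 (Num.sqrt tau2))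
  /\
  exists (d' : measure_display) (T' : measurableType d')
    (Q : probability T' R) (Sigma' Z W : {RV Q >-> R}),
    [/\ mittag_leffler (1 - r) Sigma',
        forall A, measurable A ->
          distribution Q Z A = normal_prob 0 (Num.sqrt tau2) A,
        independent_RV Sigma' Z,
        forall w, W w = Num.sqrt (Sigma' w) * Z w
      & cvg_in_law P
          (fun n w => (position X n w - n%:R `^ (2 * p + r - 1) * L w)
                      / Num.sqrt (n%:R `^ (1 - r)))
          (distribution Q W)].
Proof.
move=> tau2; have /andP[p0 _] := hp; have /andP[q0 _] := hq; have /andP[r0 r1] := hr.
have Ea : 2 * p + r - 1 = p - q by lra.
have Eb : 1 - r = p + q by lra.
have Ed : 4 * p - 3 * (p + q) = 2 * (p - q) - (p + q) by lra.
have hb : 0 < p + q by lra.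
have hsup : p + q < 2 * (p - q).
  by move: hsuper; rewrite Eb ltr_pdivlMr//; lra.
rewrite Ea in hL *; rewrite /tau2 Eb Ed; split.
  exact: (random_normalisation_cvg_in_law p0 q0 (ltW r0) hpqr hs hb r0 hsup hX hL).
exact: (deterministic_normalisation_cvg_in_law p0 q0 (ltW r0) hpqr hs hb r0 hsup hX hL).
Qed.
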